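(* There exists a solution $(g,u)$ to the nonlocal optimal control problem $(\mathcal P^\delta)$, i.e. there is $(g,u)\in\mathcal A^\delta$ such that $I_\delta(g,u)=\min_{(f,v)\in\mathcal A^\delta}I_\delta(f,v)$.
   Context: Let $\Omega\subset\mathbb R^N$ be a bounded open domain, $\delta>0$ fixed, $\Omega_\delta=\Omega\cup\bigcup_{q\in\partial\Omega}B(q,\delta)$, $p>1$, $p'=p/(p-1)$, $s\in(0,1)$ with $N>ps$. Kernel: $k_\delta\ge 0$ is radial with $\operatorname{supp}k_\delta\subset B(0,\delta)$, $\frac1{C_N}\int_{B(0,\delta)}k_\delta(|z|)\,dz=1$, where $C_N=\frac{1}{\operatorname{meas}(S^{N-1})}\int_{S^{N-1}}|\omega\cdot e|^p\,d\sigma^{N-1}(\omega)$ ($e$ any unit vector), and $k_\delta(|z|)\ge \frac{c_0}{|z|^{N+(s-1)p}}$ for $0<|z|<\delta$, with a constant $c_0>0$. Coefficients: given $0<h_{\min}<h_{\max}$, $\mathcal H$ is the set of measurable $h:\Omega_\delta\to\mathbb R$ with $h(x)\in[h_{\min},h_{\max}]$ for a.e. $x\in\Omega$ and $h=0$ in $\Omega_\delta\setminus\Omega$. Fix $h\in\mathcal H$. For $\eta\in\mathcal H$, $$B_\eta(u,w)=\int_{\Omega_\delta}\int_{\Omega_\delta}\tfrac{\eta(x')+\eta(x)}2\,k_\delta(|x'-x|)\frac{|u(x')-u(x)|^{p-2}(u(x')-u(x))}{|x'-x|^p}(w(x')-w(x))\,dx'dx,$$ and $B$ denotes the same expression with the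 factor $\tfrac{\eta(x')+\eta(x)}2$ replaced by $1$. Spaces: $X=\{u\in L^p(\Omega_\delta):B(u,u)<\infty\}$, $X_0=\{u\in X:u=0\text{ in }\Omega_\delta\setminus\Omega\}$. The boundary datum $u_0$ is in $\{w|_{\Omega_\delta\setminus\Omega}:w\in X\}$ and is identified with an element of $X$ extending it, still denoted $u_0$; $u_0+X_0=\{u_0+w:w\in X_0\}$. State: for $g\in L^{p'}(\Omega)$, the state associated to $g$ is the unique $u\in u_0+X_0$ such that $B_h(u,w)=\int_\Omega g\,w\,dx$ for all $w\in X_0$. $\mathcal A^\delta$ is the set of pairs $(g,u)\in L^{p'}(\Omega)\times X$ with $u$ the state associated to $g$. Problem $(\mathcal P^\delta)$: minimize over $\mathcal A^\delta$ the cost $$I_\delta(g,u)=\int_\Omega\left(G(x,u(x))+\beta|g(x)|^{p'}\right)dx+\gamma B_{h_0}(u,u),$$ where $\beta,\gamma>0$ and $h_0\in\mathcal H$ are given and $G:\Omega\times\mathbb R\to\mathbb R$ is a measurable positive function for which there is $L>0$ with $|G(x,a)-G(x,b)|\le L|a-b|$ for all $x\in\Omega$, $a,b\in\mathbb R$. *)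

(* Defs.v *)
From HB Require Import structures.
From mathcomp Require Import all_boot all_order all_algebra.
From mathcomp Require Import all_classical all_reals all_analysis.
From mathcomp Require Import measurable_realfun.

Set Implicit Arguments.
Unset Strict Implicit.
Unset Printing Implicit Defensive.
Import Order.TTheory GRing.Theory Num.Theory.
Import numFieldNormedType.Exports.
Local Open Scope classical_set_scope.
Local Open Scope ring_scope.

(* R^n is 'rV[R]_n with its library topology and the sigma-algebra generated
   by the coordinates, i.e. the Borel one. *)
Section measurable_rV.
Context {R : realType} (n : nat).

Let coords : 'I_n -> 'rV[R]_n -> R := fun i v => v ord0 i.

Let rV_set0 : g_sigma_preimage coords set0.
Proof. exact: sigma_algebra0. Qed.

Let rV_setC A : g_sigma_preimage coords A -> g_sigma_preimage coords (~` A).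
Proof. exact: sigma_algebraC. Qed.

Let rV_bigcup (F : _^nat) : (forall i, g_sigma_preimage coords (F i)) ->
  g_sigma_preimage coords (\bigcup_i (F i)).
Proof. exact: sigma_algebra_bigcup. Qed.

HB.instance Definition _ := @isMeasurable.Build default_measure_display
  'rV[R]_n (g_sigma_preimage coords) rV_set0 rV_setC rV_bigcup.

End measurable_rV.

Section rV_measurability.
Context {R : realType}.

Lemma measurable_coord n (i : 'I_n) :
  measurable_fun setT (fun v : 'rV[R]_n => v ord0 i).
Proof.
move=> _ Y mY; rewrite setTI; apply: sub_sigma_algebra => /=.
rewrite -bigcup_seq/=; exists i => /=; first by rewrite mem_index_enum.
by exists Y => //; rewrite setTI.
Qed.

Lemma measurable_fun_rV d (T : measurableType d) n (f : T -> 'rV[R]_n) :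
  (forall i, measurable_fun setT (fun x => f x ord0 i)) ->
  measurable_fun setT f.
Proof.
move=> mf.
suff : preimage_set_system setT f
    (g_sigma_preimage (fun (i : 'I_n) (v : 'rV[R]_n) => v ord0 i)) `<=` measurable.
  by move=> H _ A mA; apply: H; exists A.
rewrite -g_sigma_preimage_comp.
apply: smallest_sub; first exact: sigma_algebra_measurable.
case: n => [|n] in f mf *; first by rewrite big_ord0.
rewrite -bigcup_mkord_ord; apply: bigcup_sub => i Ii.
by move=> A [B mB <-]; exact: mf.
Qed.

End rV_measurability.

Section lebesgue_rV.
Context {R : realType}.

Definition rV_cons n (xv : measurableTypeR R * 'rV[R]_n) : 'rV[R]_n.+1 :=
  \row_i (if unlift ord0 i is Some j then xv.2 ord0 j else xv.1).

Definition rV_uncons n (v : 'rV[R]_n.+1) : measurableTypeR R * 'rV[R]_n :=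
  (v ord0 ord0, \row_i v ord0 (lift ord0 i)).

Lemma rV_consK n : cancel (@rV_cons n) (@rV_uncons n).
Proof.
move=> [x v]; rewrite /rV_uncons /rV_cons /= mxE unlift_none; congr pair.
by apply/rowP => i; rewrite !mxE liftK.
Qed.

Lemma rV_unconsK n : cancel (@rV_uncons n) (@rV_cons n).
Proof.
move=> v; apply/rowP => i; rewrite /rV_uncons /rV_cons /= mxE.
by case: (unliftP ord0 i) => [j ->|->] /=; rewrite ?mxE.
Qed.

Lemma measurable_rV_cons n : measurable_fun setT (@rV_cons n).
Proof.
apply: measurable_fun_rV => i; case: (unliftP ord0 i) => [j ->|->].
  under eq_fun do rewrite mxE liftK.
  exact: (measurableT_comp (measurable_coord j) measurable_snd).
under eq_fun do rewrite mxE unlift_none.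
exact: measurable_fst.
Qed.

Lemma measurable_rV_uncons n : measurable_fun setT (@rV_uncons n).
Proof.
apply: measurable_fun_pair; first exact: measurable_coord.
apply: measurable_fun_rV => i.
under eq_fun do rewrite mxE.
exact: measurable_coord.
Qed.

Section lebesgue_rVS.
Variables (n : nat) (m : {sigma_finite_measure set 'rV[R]_n -> \bar R}).

Definition lebesgue_rVS : set 'rV[R]_n.+1 -> \bar R :=
  pushforward (@lebesgue_measure R \x m)%E (@rV_cons n).

Let mpre A : measurable A -> measurable (@rV_cons n @^-1` A).
Proof.
by move=> mA; rewrite -[X in measurable X]setTI; exact: measurable_rV_cons.
Qed.

Let lebesgue_rVS0 : lebesgue_rVS set0 = 0%E.
Proof. by rewrite /lebesgue_rVS /pushforward preimage_set0 measure0. Qed.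

Let lebesgue_rVS_ge0 A : (0 <= lebesgue_rVS A)%E.
Proof. by rewrite /lebesgue_rVS /pushforward measure_ge0. Qed.

Let lebesgue_rVS_sigma_additive : semi_sigma_additive lebesgue_rVS.
Proof.
move=> F mF tF mUF; rewrite /lebesgue_rVS /pushforward preimage_bigcup.
apply: measure_semi_sigma_additive.
- by move=> k; exact: mpre.
- apply/trivIsetP => /= i j _ _ ij; rewrite -preimage_setI.
  by move/trivIsetP : tF => /(_ _ _ _ _ ij) -> //; rewrite preimage_set0.
- by rewrite -preimage_bigcup; exact: mpre.
Qed.

HB.instance Definition _ := isMeasure.Build _ _ _ lebesgue_rVS
  lebesgue_rVS0 lebesgue_rVS_ge0 lebesgue_rVS_sigma_additive.

Let lebesgue_rVS_sigma_finite : sigma_finite setT lebesgue_rVS.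
Proof.
have /sigma_finiteP[F [TF ndF Foo]] := sigma_finiteT (@lebesgue_measure R).
have /sigma_finiteP[G [TG ndG Goo]] := sigma_finiteT m.
exists (fun k => @rV_uncons n @^-1` (F k `*` G k)).
  rewrite -preimage_bigcup (_ : \bigcup_k _ = setT) ?preimage_setT//.
  rewrite -setXTT TF TG predeqE => -[x y]; split.
    by move=> [k _ [? ?]]; split; exists k.
  move=> [/= [k _ Fkx] [l _ Gly]]; exists (maxn k l) => //; split.
  - by move: x Fkx; exact/subsetPset/ndF/leq_maxl.
  - by move: y Gly; exact/subsetPset/ndG/leq_maxr.
move=> k; have [mFk Fkoo] := Foo k; have [mGk Gkoo] := Goo k; split.
  rewrite -[X in measurable X]setTI.
  by apply: measurable_rV_uncons => //; exact: measurableX.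
rewrite /lebesgue_rVS /pushforward -comp_preimage.
rewrite (_ : _ \o _ = id) ?preimage_id; last first.
  by apply/funext => xv; exact: rV_consK.
by rewrite product_measure1E// lte_mul_pinfty// ge0_fin_numE.
Qed.

HB.instance Definition _ := Measure_isSigmaFinite.Build _ _ _ lebesgue_rVS
  lebesgue_rVS_sigma_finite.

End lebesgue_rVS.

(* n-dimensional Lebesgue measure: the n-fold product of the one-dimensional
   one, R^0 being a point of mass 1. *)
Fixpoint lebesgue_rV n : {sigma_finite_measure set 'rV[R]_n -> \bar R} :=
  match n with
  | 0%N => \d_(0 : 'rV[R]_0)
  | n'.+1 => lebesgue_rVS (lebesgue_rV n')
  end.

End lebesgue_rV.

Section euclidean.
Context {R : realType} {N : nat}.
Implicit Types (x v w : 'rV[R]_N) (r : R).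

(* The library norm of 'rV[R]_N is the sup norm. *)
Definition enorm v : R := Num.sqrt (\sum_i v ord0 i ^+ 2).

Definition dotp v w : R := \sum_i v ord0 i * w ord0 i.

Definition eball x r : set 'rV[R]_N := [set y | enorm (y - x) < r].

Definition esphere : set 'rV[R]_N := [set w | enorm w = 1].

Definition direction v : 'rV[R]_N := (enorm v)^-1 *: v.

Lemma measurable_enorm : measurable_fun setT (@enorm).
Proof.
have -> : @enorm = fun v => (\sum_i v ord0 i ^+ 2) `^ (2^-1).
  by apply/funext => v; rewrite powR12_sqrt// sumr_ge0// => i _; exact: sqr_ge0.
apply: (measurableT_comp (measurable_powR _)).
by apply: measurable_sum => i; apply: measurable_funX; exact: measurable_coord.
Qed.

Lemma measurable_direction : measurable_fun setT direction.
Proof.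
apply: measurable_fun_rV => i; under eq_fun do rewrite mxE.
apply: measurable_funM; last exact: measurable_coord.
have -> : (fun v => (enorm v)^-1) = (fun v => enorm v `^ (-1)).
  by apply/funext => v; rewrite powR_inv1// sqrtr_ge0.
exact: (measurableT_comp (measurable_powR _) measurable_enorm).
Qed.

Lemma measurable_unit_ball : measurable (eball 0 1).
Proof.
rewrite (_ : eball 0 1 = setT `&` @enorm @^-1` `]-oo, 1[).
  by apply: measurable_enorm => //; exact: measurable_itv.
by apply/seteqP; split => [v|v []]; rewrite /eball /= subr0 in_itv.
Qed.

(* Surface measure on the sphere through polar coordinates:
   sigma(A) = N * |{x : 0 < |x| < 1, x / |x| in A}| for A in the sphere. *)
Definition surface_measure (A : set 'rV[R]_N) : \bar R :=
  (N%:R%:E * lebesgue_rV N (direction @^-1` A `&` eball 0 1))%E.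

Let mdir A : measurable A -> measurable (direction @^-1` A `&` eball 0 1).
Proof.
move=> mA; apply: measurableI; last exact: measurable_unit_ball.
by rewrite -[X in measurable X]setTI; exact: measurable_direction.
Qed.

Let surface_measure0 : surface_measure set0 = 0%E.
Proof. by rewrite /surface_measure preimage_set0 set0I measure0 mule0. Qed.

Let surface_measure_ge0 A : (0 <= surface_measure A)%E.
Proof. by rewrite /surface_measure mule_ge0// lee_fin. Qed.

Let surface_measure_sigma_additive : semi_sigma_additive surface_measure.
Proof.
move=> F mF tF mUF.
rewrite [X in X @ _ --> _](_ : _ = (fun n => N%:R%:E *
    \sum_(0 <= i < n) lebesgue_rV N (direction @^-1` F i `&` eball 0 1))%E).
  apply: cvgeZl => //; rewrite preimage_bigcup setI_bigcupl.
  apply: measure_semi_sigma_additive.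
  - by move=> i; exact: mdir.
  - apply/trivIsetP => /= i j _ _ ij; rewrite setIACA -preimage_setI.
    by move/trivIsetP : tF => /(_ _ _ _ _ ij) -> //; rewrite preimage_set0 set0I.
  - by rewrite -setI_bigcupl -preimage_bigcup; exact: mdir.
by apply/funext => n; rewrite ge0_sume_distrr.
Qed.

HB.instance Definition _ := isMeasure.Build _ _ _ surface_measure
  surface_measure0 surface_measure_ge0 surface_measure_sigma_additive.

(* Independent of the unit vector e, by rotation invariance. *)
Definition CN (p : R) (e : 'rV[R]_N) : R :=
  (fine (surface_measure esphere))^-1 *
  \int[surface_measure]_(w in esphere) (`|dotp w e| `^ p).

End euclidean.

Section nonlocal.
Context {R : realType} {N : nat}.
Local Notation E := 'rV[R]_N.
Local Notation leb := (lebesgue_rV N).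
Implicit Types (D Omega : set E) (u v w g h eta : E -> R) (k : R -> R) (p : R).

Definition delta_nbhd Omega (delta : R) : set E :=
  Omega `|` \bigcup_(q in closure Omega `\` interior Omega) eball q delta.

(* Functions on a subset of R^N are represented by functions on R^N, of which
   only the values on the subset are used, up to null sets. *)
Definition Lp_on D p : set (E -> R) := [set u | u \_ D \in Lfun leb p%:E].

(* The double integral with weight a(x', x); the factors 0 / 0 arising on the
   diagonal are 0 by convention. *)
Definition nlform p k D (a : E -> E -> R) u w : \bar R :=
  (\int[leb]_(x in D) \int[leb]_(x' in D)
    (a x' x * k (enorm (x' - x)) *
     (`|u x' - u x| `^ (p - 2) * (u x' - u x) / enorm (x' - x) `^ p) *
     (w x' - w x))%:E)%E.

Definition Beta p k D eta u w : \bar R :=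
  nlform p k D (fun x' x => (eta x' + eta x) / 2) u w.

Definition B1 p k D u w : \bar R := nlform p k D (fun _ _ => 1) u w.

Definition coefficients Omega D (hmin hmax : R) : set (E -> R) :=
  [set h | [/\ measurable_fun D h,
    {ae leb, forall x, Omega x -> hmin <= h x <= hmax} &
    {ae leb, forall x, (D `\` Omega) x -> h x = 0}]].

Definition Xspace p k D : set (E -> R) :=
  [set u | Lp_on D p u /\ (B1 p k D u u < +oo)%E].

Definition X0space p k Omega D : set (E -> R) :=
  [set u | Xspace p k D u /\ {ae leb, forall x, (D `\` Omega) x -> u x = 0}].

Definition weak_solution p k Omega D h u0 g u :=
  X0space p k Omega D (u \- u0) /\
  forall w, X0space p k Omega D w ->
    Beta p k D h u w = (\int[leb]_(x in Omega) (g x * w x)%:E)%E.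

Definition is_state p k Omega D h u0 g u :=
  weak_solution p k Omega D h u0 g u /\
  forall v, weak_solution p k Omega D h u0 g v ->
    {ae leb, forall x, D x -> v x = u x}.

Definition admissible p k Omega D h u0 g u :=
  [/\ Lp_on Omega (p / (p - 1)) g, Xspace p k D u &
      is_state p k Omega D h u0 g u].

Definition cost p k Omega D h0 (G : E -> R -> R) (beta gamma : R) g u : \bar R :=
  (\int[leb]_(x in Omega) (G x (u x) + beta * `|g x| `^ (p / (p - 1)))%:E
   + gamma%:E * Beta p k D h0 u u)%E.

End nonlocal.

(* Main.v *)
From HB Require Import structures.
From mathcomp Require Import all_boot all_order all_algebra.
From mathcomp Require Import all_classical all_reals all_analysis.
From mathcomp Require Import ring lra measurable_realfun.
Require Import Defs.
Set Implicit Arguments.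
Unset Strict Implicit.
Unset Printing Implicit Defensive.
Import Order.TTheory GRing.Theory Num.Theory.
Import numFieldNormedType.Exports.
Local Open Scope classical_set_scope.
Local Open Scope ring_scope.

(** The direct method, in which convexity takes the place of weak topologies.

The form [B_eta(u, u)] is the integral over pairs of points of
[|wdiff eta u|^p], where [wdiff eta u] is a weighted increment of [u], linear
in [u] ([Beta_wdiff]). Everything then follows from the convexity of
[t |-> |t|^p], used pointwise and integrated. In particular [u = u0 + w] is the
state of a control [g] if and only if [w] minimizes the energy of [u0 + v],
divided by [p], minus the integral of [g v], among the [v] that vanish outside
[Omega] ([weak_solution_minimizer], [minimizer_weak_solution]); uniform
convexity makes the minimizer unique ([minimizer_unique]).

Take a minimizing sequence of controls [f_n] and states [u0 + w_n]. The cost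
bounds the [h0]-energy of the states. Sets of bounded energy are compact
in [L^p] ([X0fun_compact]): by the lower bound on the kernel, increments of [w] at
distance at most [rho] are at most [rho^((N + s p) / p)] times a function
bounded in [L^p] ([nl_control]). Chains of cubes leading out of [Omega] give a
Poincare inequality from this ([poincare]); and as [w_n] differs little from
its mean on every cube of a fine grid, while the finitely many means converge
along an ultrafilter, [w_n] is Cauchy along that ultrafilter ([rellich]). So a
subsequence of [w_n] converges to some [w] almost everywhere and in [L^p].

The controls are merely bounded in the dual exponent [q]. With [w] fixed,
consider the controls [g] for which [(g, u0 + w)] has a cost within [1 / (n+1)]
of the infimum and [w] minimizes up to [1 / (n+1)]. They form a convex set,
which contains late terms [f_m]: the energies and the cost of [G] are lower
semicontinuous by Fatou's lemma, and the integral of [f_m (w_m - w)] tends to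
0. Elements of almost least norm of a decreasing sequence of bounded convex
sets converge strongly, by uniform convexity ([Lp_midconvex_limit]); their
limit [g] satisfies both conditions without error, so [w] is the minimizer for
[g] and [(g, u0 + w)] is optimal ([cost_limit]).

If the infimum of the cost is infinite every admissible pair is optimal, and
the zero control provides one ([minimizer0_exists]). *)

(** * Convexity of the p-th power *)

Section powR_inequalities.
Context {R : realType}.
Implicit Types (p a b c x : R).

(** The derivative of [|a|^p / p]. *)
Definition dpow p a := `|a| `^ (p - 2) * a.

Lemma normr_powRM p a b : `|a * b| `^ p = `|a| `^ p * `|b| `^ p.
Proof. by rewrite normrM powRM. Qed.

Lemma le_powR p a b : 0 <= p -> 0 <= a -> a <= b -> a `^ p <= b `^ p.
Proof.
by move=> p0 a0 ab; rewrite ge0_ler_powR// nnegrE// (le_trans a0).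
Qed.

Lemma powR_add_le p a b : 0 <= p ->
  `|a + b| `^ p <= 2 `^ p * (`|a| `^ p + `|b| `^ p).
Proof.
move=> p0; wlog ab : a b / `|b| <= `|a|.
  move=> H; case: (lerP `|b| `|a|) => [|/ltW] /H//.
  by rewrite addrC [X in _ * X]addrC.
apply: (@le_trans _ _ ((2 * `|a|) `^ p)).
  apply: le_powR => //; apply: (le_trans (ler_normD _ _)).
  by rewrite mulr_natl mulr2n lerD2l.
by rewrite powRM// ler_wpM2l ?powR_ge0// lerDl powR_ge0.
Qed.

Lemma dpowE p a : 1 < p -> dpow p a * a = `|a| `^ p.
Proof.
move=> p1; rewrite /dpow -mulrA -expr2 -real_normK ?num_real//.
rewrite -powR_mulrn// -powRD ?subrK//.
by apply/implyP => /eqP pE; move: p1; rewrite -[p](subrK 2) pE; lra.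
Qed.

Lemma normr_dpow p a : 1 < p -> `|dpow p a| = `|a| `^ (p - 1).
Proof.
move=> p1; have [->|a0] := eqVneq a 0.
  by rewrite /dpow mulr0 normr0 powR0// subr_eq0 gt_eqF.
apply: (mulIf (x := `|a|)); first by rewrite normr_eq0.
rewrite -normrM dpowE// ger0_norm ?powR_ge0//.
by rewrite mulrC mulr_powRB1//; lra.
Qed.

Lemma powR_conjugate p x : 1 < p -> 0 <= x ->
  (x `^ (p - 1)) `^ (p / (p - 1)) = x `^ p.
Proof. by move=> p1 x0; rewrite -powRrM mulrC divfK// subr_eq0 gt_eqF. Qed.

Lemma young p a b : 1 < p ->
  `|a * b| <= `|a| `^ (p / (p - 1)) * (1 - p^-1) + `|b| `^ p / p.
Proof.
move=> p1; have p10 : 0 < p - 1 by lra.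
rewrite normrM; have := @conjugate_powR R `|a| `|b| (p / (p - 1)) p.
rewrite invf_div (_ : (p - 1) / p = 1 - p^-1); last by field; lra.
move=> /(_ (normr_ge0 _) (normr_ge0 _)); apply.
- by rewrite divr_gt0//; lra.
- lra.
- lra.
Qed.

(** Young's inequality for [dpow p a * b], because [|dpow p a|] raised to the
    conjugate exponent is [|a|^p]. *)
Lemma powR_tangent p a b : 1 < p ->
  `|a| `^ p + p * dpow p a * (b - a) <= `|b| `^ p.
Proof.
move=> p1; have := young (dpow p a) b p1.
rewrite normr_dpow// powR_conjugate// => yab.
have {}yab := le_trans (ler_norm _) yab.
have p0 : 0 < p by lra.
rewrite -(ler_pM2l p0) in yab.
have -> : p * dpow p a * (b - a) = p * (dpow p a * b) - p * (dpow p a * a) by ring.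
rewrite dpowE//.
move: yab.
have -> : p * (`|a| `^ p * (1 - p^-1) + `|b| `^ p / p) =
    p * `|a| `^ p - `|a| `^ p + `|b| `^ p by field; rewrite gt_eqF.
lra.
Qed.

(** Rescaling the two factors by inverse amounts puts the small constant on the
    factor that will be merely bounded. *)
Lemma young_eps p (eps : R) : 1 < p -> 0 < eps -> exists2 C, 0 < C &
  forall a b, `|a * b| <= eps * `|a| `^ (p / (p - 1)) + C * `|b| `^ p.
Proof.
move=> p1 e0; set q := p / (p - 1).
have q0 : 0 < q by rewrite /q divr_gt0//; lra.
pose l := eps `^ q^-1.
have l0 : 0 < l by rewrite powR_gt0.
have lE : l `^ q = eps by rewrite -powRrM mulVf ?gt_eqF// powRr1// ltW.
exists (l^-1 `^ p); first by rewrite powR_gt0 ?invr_gt0.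
move=> a b; have -> : a * b = (l * a) * (l^-1 * b) by field; rewrite gt_eqF.
apply: (le_trans (young _ _ p1)).
have lV : `|l^-1| = l^-1 by rewrite gtr0_norm ?invr_gt0.
rewrite !normr_powRM (gtr0_norm l0) -/q lE lV.
have pi : 0 < p^-1 < 1 by rewrite invr_gt0 invf_lt1//; lra.
apply: lerD; rewrite ler_piMr// ?mulr_ge0 ?powR_ge0//; first exact: ltW; lra.
Qed.

Lemma powR_midpoint p a b : 1 < p ->
  `|(a + b) / 2| `^ p <= (`|a| `^ p + `|b| `^ p) / 2.
Proof.
move=> p1; have := powR_tangent ((a + b) / 2) a p1.
have := powR_tangent ((a + b) / 2) b p1.
have -> : b - (a + b) / 2 = - (a - (a + b) / 2) by field.
lra.
Qed.

(** Squaring the tangent inequality of [y |-> y^p] at [1], with [y = sqrt x]: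
    the square of its linear side leaves a quadratic gain over the tangent of
    [x |-> x^p], for all [p > 1] at once and without second derivatives. *)
Lemma powR_tangent1_sqr p x : 1 < p -> 1 <= x ->
  1 + p * (x - 1) + p * (p - 1) * (Num.sqrt x - 1) ^+ 2 <= x `^ p.
Proof.
move=> p1 x1; set y := Num.sqrt x.
have x0 : 0 <= x by lra.
have y1 : 1 <= y by rewrite -sqrtr1 ler_wsqrtr.
have xE : x = y ^+ 2 by rewrite sqr_sqrtr.
have xpE : x `^ p = (y `^ p) ^+ 2.
  rewrite {1}xE -(powR_mulrn 2 (le_trans ler01 y1)) powRAC powR_mulrn//.
  exact: powR_ge0.
have := powR_tangent 1 y p1.
rewrite /dpow normr1 !powR1 !mulr1 (ger0_norm (le_trans ler01 y1)) => h.
rewrite xpE xE; apply: (@le_trans _ _ ((1 + p * (y - 1)) ^+ 2)).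
  by rewrite le_eqVlt; apply/orP; left; apply/eqP; ring.
by rewrite ler_sqr// nnegrE ?powR_ge0// addr_ge0// mulr_ge0//; lra.
Qed.

(** Let [m] be the midpoint of [1] and [t]. If [m] is small, [|m|^p <= m] is
    already below the average. Otherwise average the tangent inequality at [m]
    evaluated at [t] and the improved one evaluated at [1]: the linear parts
    cancel and the quadratic gain is left. *)
Lemma powR_uniform_convex1 p (eta : R) : 1 < p -> 0 < eta ->
  exists2 d, 0 < d & forall t, -1 <= t <= 1 - eta ->
    d <= (1 + `|t| `^ p) / 2 - `|(1 + t) / 2| `^ p.
Proof.
move=> p1 eta0; have p0 : 0 <= p by lra.
(* a lower bound of the quadratic gain for [1/4 <= m <= 1 - eta / 2], where
   [1 - sqrt m >= (1 - m) / 2 >= eta / 4] *)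
pose d := p * (p - 1) * (4^-1 `^ (p - 1)) * (eta / 4) ^+ 2 / 2.
have d0 : 0 < d.
  rewrite divr_gt0// mulr_gt0// ?exprn_gt0 ?divr_gt0// mulr_gt0 ?powR_gt0//.
  by rewrite mulr_gt0//; lra.
exists (Num.min 4^-1 d); first by rewrite lt_min d0 andbT.
move=> t /andP[t1 t2]; rewrite ge_min; set m := (1 + t) / 2.
have m0 : 0 <= m by rewrite /m; lra.
have [m4|m4] := lerP m 4^-1.
  apply/orP; left.
  have : `|m| `^ p <= m.
    rewrite ger0_norm//; have [->|mn0] := eqVneq m 0.
      by rewrite powR0//; lra.
    rewrite -[leRHS]powRr1//; apply: ger_powR; last lra.
    by rewrite lt0r mn0 m0/=; lra.
  have := powR_ge0 `|t| p; lra.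
apply/orP; right.
have mp : 0 < m by lra.
have m1 : m <= 1 - eta / 2 by rewrite /m; lra.
have mi1 : 1 <= m^-1 by rewrite invf_ge1//; lra.
have h1 := powR_tangent1_sqr p1 mi1.
have h2 := powR_tangent m t p1.
rewrite (ger0_norm m0) in h2 *.
have mpE : m `^ p = m * m `^ (p - 1) by rewrite mulr_powRB1//; lra.
have dE : dpow p m = m `^ (p - 1).
  apply: (mulIf (x := m)); first by rewrite gt_eqF.
  by rewrite dpowE// ger0_norm// mpE mulrC.
have mV : m^-1 `^ p * m `^ p = 1.
  by rewrite -powRM ?mulVf ?powR1 ?gt_eqF// invr_ge0.
have h3 : m `^ p + p * m `^ (p - 1) * (1 - m)
    + p * (p - 1) * m `^ (p - 1) * (1 - Num.sqrt m) ^+ 2 <= 1.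
  rewrite -[leRHS]mV; apply: le_trans (ler_wpM2r (powR_ge0 m p) h1).
  rewrite le_eqVlt; apply/orP; left; apply/eqP.
  rewrite sqrtrV// mpE; set s := Num.sqrt m.
  have mE : m = s ^+ 2 by rewrite sqr_sqrtr.
  have s0 : s != 0 by rewrite sqrtr_eq0 -ltNge.
  by move: (m `^ (p - 1)) => M; rewrite mE; field.
have h4 : d <= p * (p - 1) * m `^ (p - 1) * (1 - Num.sqrt m) ^+ 2 / 2.
  rewrite /d ler_pM2r//; apply: ler_pM.
  - by rewrite mulr_ge0 ?powR_ge0// mulr_ge0//; lra.
  - exact: exprn_ge0 (divr_ge0 (ltW eta0) _).
  - rewrite ler_wpM2l ?mulr_ge0//; first lra.
    by apply: le_powR => //; lra.
  - have sm1 : Num.sqrt m <= 1 by rewrite -sqrtr1 ler_wsqrtr//; lra.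
    have sm0 := sqrtr_ge0 m.
    have smE : m = Num.sqrt m ^+ 2 by rewrite sqr_sqrtr.
    have : (1 - m) / 2 <= 1 - Num.sqrt m by rewrite {1}smE; nra.
    move=> h; rewrite ler_sqr ?nnegrE; lra.
have tE : t - m = - (1 - m) by rewrite /m; field.
rewrite dE tE in h2; lra.
Qed.

(** Uniform convexity in a form that can be integrated. Divide by the larger of
    the two numbers: either their quotient is so close to [1] that the left
    side is absorbed by [eps], or the midpoint gap is bounded below. *)
Lemma powR_uniform_convex p (eps : R) : 1 < p -> 0 < eps ->
  exists2 C, 0 <= C & forall a b, `|a - b| `^ p <=
    eps * (`|a| `^ p + `|b| `^ p) +
    C * ((`|a| `^ p + `|b| `^ p) / 2 - `|(a + b) / 2| `^ p).
Proof.
move=> p1 e0; have p0 : 0 < p by lra.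
have [d d0 hd] := powR_uniform_convex1 p1 (powR_gt0 p^-1 e0).
have C0 : 0 <= 2 `^ p / d by rewrite divr_ge0 ?powR_ge0// ltW.
exists (2 `^ p / d) => // a b.
wlog ab : a b / `|b| <= `|a|.
  move=> H; case: (lerP `|b| `|a|) => [|/ltW] /H//.
  by rewrite distrC [`|b| `^ p + _]addrC [b + a]addrC.
have [a0|a0] := eqVneq a 0.
  move: ab; rewrite a0 normr0 normr_le0 => /eqP ->.
  by rewrite subrr addr0 mul0r normr0 powR0 ?gt_eqF//; lra.
pose t := b / a.
have bE : b = a * t by rewrite /t mulrC divfK.
have t1 : `|t| <= 1 by rewrite normf_div ler_pdivrMr ?normr_gt0// mul1r.
have -> : a - b = a * (1 - t) by rewrite bE; ring.
have -> : (a + b) / 2 = a * ((1 + t) / 2) by rewrite bE; field.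
have -> : `|b| `^ p = `|a| `^ p * `|t| `^ p by rewrite bE normr_powRM.
rewrite ![`|a * _| `^ p]normr_powRM; set A := `|a| `^ p.
have A0 : 0 <= A by exact: powR_ge0.
suff h : `|1 - t| `^ p <= eps * (1 + `|t| `^ p) +
    2 `^ p / d * ((1 + `|t| `^ p) / 2 - `|(1 + t) / 2| `^ p).
  apply: (le_trans (ler_wpM2l A0 h)).
  rewrite le_eqVlt; apply/orP; left; apply/eqP.
  by move: (`|t| `^ p) (`|(1 + t) / 2| `^ p) => x y; ring.
have := powR_midpoint 1 t p1; rewrite normr1 powR1 -subr_ge0 => def0.
have [te|te] := lerP `|1 - t| (eps `^ p^-1).
  apply: (@le_trans _ _ eps).
    rewrite (le_trans (le_powR (ltW p0) (normr_ge0 _) te))//.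
    by rewrite -powRrM mulVf ?gt_eqF// powRr1// ltW.
  have := mulr_ge0 C0 def0; have := mulr_ge0 (ltW e0) (powR_ge0 `|t| p).
  lra.
have tt : -1 <= t <= 1 - eps `^ p^-1.
  move: t1; rewrite ler_norml => /andP[t0 t1].
  by move: te; rewrite ger0_norm; lra.
apply: (@le_trans _ _ (2 `^ p / d * d)).
  rewrite divfK ?gt_eqF//; apply: le_powR => //; first exact: ltW.
  by apply: (le_trans (ler_normB _ _)); rewrite normr1; lra.
have := ler_wpM2l C0 (hd t tt).
have := mulr_ge0 (ltW e0) (addr_ge0 ler01 (powR_ge0 `|t| p)); lra.
Qed.

(** The domination, uniform in [t], under which the first variation passes to
    the limit [t = 0]. *)
Lemma dpow_bound p a b (t : R) : 1 < p -> 0 <= t <= 1 ->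
  `|dpow p (a + t * b) * b| <= 2 `^ p * (`|a| `^ p + `|b| `^ p).
Proof.
move=> p1 /andP[t0 t1]; rewrite normrM normr_dpow//.
have ab0 : 0 <= `|a| + `|b| by rewrite addr_ge0.
apply: (@le_trans _ _ ((`|a| + `|b|) `^ p)).
  rewrite -(@mulr_powRB1 _ (`|a| + `|b|) p)//; last lra.
  rewrite mulrC; apply: ler_pM => //; rewrite ?powR_ge0// ?lerDr//.
  apply: le_powR => //; first lra.
  apply: (le_trans (ler_normD _ _)); rewrite lerD2l normrM ger0_norm//.
  by rewrite ler_piMl.
have := @powR_add_le p `|a| `|b|; rewrite !normr_id ger0_norm//; apply; lra.
Qed.

Lemma continuous_powR_normr_neq0 p a : a != 0 ->
  {for a, continuous (fun x : R => `|x| `^ p)}.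
Proof.
move=> a0; apply: (@continuous_comp _ _ _ (fun x : R => `|x|) (fun y => y `^ p)).
  exact: norm_continuous.
apply/differentiable_continuous/derivable1_diffP/derivable_powR.
by rewrite in_itv/= andbT normr_gt0.
Qed.

Lemma powR_normr_near0 p (e : R) : 0 < p -> 0 < e ->
  \forall x \near (0 : R), `|x| `^ p < e.
Proof.
move=> p0 e0; near=> x.
have -> : e = (e `^ p^-1) `^ p by rewrite -powRrM mulVf ?gt_eqF// powRr1// ltW.
rewrite gt0_ltr_powR ?nnegrE ?powR_ge0//.
rewrite -[x]subr0 distrC; near: x.
by apply: (@cvgr_dist_lt _ _ _ _ _ id); [exact: cvg_id|rewrite powR_gt0].
Unshelve. all: by end_near. Qed.

Lemma continuous_powR_normr p : 0 < p -> continuous (fun x : R => `|x| `^ p).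
Proof.
move=> p0 a; have [->|a0] := eqVneq a 0; last first.
  exact: continuous_powR_normr_neq0.
apply/cvgrPdist_lt => e e0; near=> x.
rewrite normr0 powR0 ?gt_eqF// sub0r normrN ger0_norm ?powR_ge0//.
by near: x; exact: powR_normr_near0.
Unshelve. all: by end_near. Qed.

Lemma continuous_dpow p : 1 < p -> continuous (@dpow p).
Proof.
move=> p1 a; have [->|a0] := eqVneq a 0.
  apply/cvgrPdist_lt => e e0; have p10 : 0 < p - 1 by lra.
  near=> x; rewrite /dpow mulr0 sub0r normrN -/(dpow p x) normr_dpow//.
  by near: x; exact: powR_normr_near0.
by apply: cvgM; [exact: continuous_powR_normr_neq0|exact: cvg_id].
Unshelve. all: by end_near. Qed.

End powR_inequalities.

(** * Integrals of p-th powers *)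

Section integrals.
Context d (T : measurableType d) (R : realType).
Variable mu : {measure set T -> \bar R}.
Implicit Types (f g : T -> R) (p : R).

Lemma measurable_powR_normr p f : measurable_fun setT f ->
  measurable_fun setT (fun x => `|f x| `^ p).
Proof.
move=> mf; apply: (measurableT_comp (measurable_powR p)).
exact: measurableT_comp.
Qed.

Lemma integrable_le f g : measurable_fun setT f ->
  (forall x, `|f x| <= g x) -> mu.-integrable setT (EFin \o g) ->
  mu.-integrable setT (EFin \o f).
Proof.
move=> mf fg; apply: le_integrable => //; first exact/measurable_EFinP.
by move=> x _ /=; rewrite lee_fin (le_trans (fg x))// ler_norm.
Qed.

Lemma integrable_ge0 f : measurable_fun setT f -> (forall x, 0 <= f x) ->
  (\int[mu]_x (f x)%:E < +oo)%E -> mu.-integrable setT (EFin \o f).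
Proof.
move=> mf f0 foo; apply/integrableP; split; first exact/measurable_EFinP.
by under eq_integral do rewrite /= ger0_norm//.
Qed.

Lemma EFin_Rintegral f : mu.-integrable setT (EFin \o f) ->
  ((\int[mu]_x f x)%R)%:E = (\int[mu]_x (f x)%:E)%E.
Proof. by move=> fi; rewrite /Rintegral fineK// integrable_fin_num. Qed.

Lemma integrableD_EFin f g : mu.-integrable setT (EFin \o f) ->
  mu.-integrable setT (EFin \o g) ->
  mu.-integrable setT (EFin \o (fun x => f x + g x)).
Proof.
move=> fi gi; have := integrableD measurableT fi gi.
by apply: eq_integrable => // x _; rewrite /= EFinD.
Qed.

Lemma integrableZ_EFin c f : mu.-integrable setT (EFin \o f) ->
  mu.-integrable setT (EFin \o (fun x => c * f x)).
Proof.
move=> fi; have := integrableZl measurableT c fi.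
by apply: eq_integrable => // x _; rewrite /= EFinM.
Qed.

Lemma integrableB_EFin f g : mu.-integrable setT (EFin \o f) ->
  mu.-integrable setT (EFin \o g) ->
  mu.-integrable setT (EFin \o (fun x => f x - g x)).
Proof.
move=> fi /(integrableZ_EFin (-1)) /(integrableD_EFin fi).
by apply: eq_integrable => // x _ /=; rewrite mulN1r.
Qed.

(** Fatou's lemma as lower semicontinuity, in a form that still has a content
    when the integral of the limit is infinite. *)
Lemma fatou_ae_near (F : nat -> T -> R) f (r : R) :
  (forall n, measurable_fun setT (F n)) -> measurable_fun setT f ->
  (forall n x, 0 <= F n x) ->
  {ae mu, forall x, F ^~ x @ \oo --> f x} ->
  (r%:E < \int[mu]_x (f x)%:E)%E ->
  \forall n \near \oo, (r%:E < \int[mu]_x (F n x)%:E)%E.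
Proof.
move=> mF mf F0 Ff rf.
have mEF n : measurable_fun setT (fun x => (F n x)%:E) by exact/measurable_EFinP.
have EF0 n x : setT x -> (0 <= (F n x)%:E)%E by rewrite lee_fin.
have := fatou mu measurableT mEF EF0.
have -> : (\int[mu]_x limn_einf (fun n => (F n x)%:E) = \int[mu]_x (f x)%:E)%E.
  apply: ae_eq_integral => //.
  - rewrite (_ : (fun x => _) = (fun x => - limn_esup (fun n => - (F n x)%:E))%E).
      apply: measurableT_comp => //; apply: measurable_fun_limn_esup => n.
      exact: measurableT_comp.
    by apply/funext => x; rewrite limn_esupN oppeK.
  - exact/measurable_EFinP.
  - apply: filterS Ff => x Fx _.
    have cF : (F n x)%:E @[n --> \oo] --> (f x)%:E by apply: cvg_EFin => //; near=> n.
    by rewrite is_cvg_limn_einfE; [apply/cvg_lim|apply/cvg_ex; exists (f x)%:E].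
move=> /(lt_le_trans rf); rewrite limn_einf_lim.
rewrite (cvg_lim _ (ereal_nondecreasing_cvgn (nondecreasing_einfs _)))//.
move=> /ereal_sup_gt[_ [n _ <-] rn]; exists n => // m nm.
apply: lt_le_trans rn _; apply: ereal_inf_lbound.
by exists m.
Unshelve. all: by end_near. Qed.

Lemma fatou_ae (F : nat -> T -> R) f (c : R) :
  (forall n, measurable_fun setT (F n)) -> measurable_fun setT f ->
  (forall n x, 0 <= F n x) ->
  {ae mu, forall x, F ^~ x @ \oo --> f x} ->
  (\forall n \near \oo, (\int[mu]_x (F n x)%:E <= c%:E)%E) ->
  (\int[mu]_x (f x)%:E <= c%:E)%E.
Proof.
move=> mF mf F0 Ff Fc; rewrite leNgt; apply/negP => /(fatou_ae_near mF mf F0 Ff).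
move=> cF; have [n []] := filter_ex (filterI cF Fc).
by rewrite ltNge => /negP.
Qed.

End integrals.

Section Lp.
Context d (T : measurableType d) (R : realType).
Variable mu : {measure set T -> \bar R}.
Implicit Types (f g : T -> R) (p : R).

Definition Lpfun p f := measurable_fun setT f /\
  mu.-integrable setT (EFin \o (fun x => `|f x| `^ p)).

(** The p-th power of the norm is kept, without taking the root: convexity and
    tangent inequalities for it are pointwise ones integrated. *)
Definition Lpint p f : R := \int[mu]_x (`|f x| `^ p).

Lemma Lpint_ge0 p f : 0 <= Lpint p f.
Proof. by apply: Rintegral_ge0 => x _; exact: powR_ge0. Qed.

Lemma LpfunP p f : measurable_fun setT f ->
  (\int[mu]_x (`|f x| `^ p)%:E < +oo)%E -> Lpfun p f.
Proof.
move=> mf fo; split => //; apply: integrable_ge0 => //.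
exact: measurable_powR_normr.
Qed.

Lemma EFin_Lpint p f : Lpfun p f ->
  (Lpint p f)%:E = (\int[mu]_x (`|f x| `^ p)%:E)%E.
Proof. by move=> [_ fi]; rewrite EFin_Rintegral. Qed.

Lemma Lpfun_le p f (g : T -> R) : measurable_fun setT f ->
  mu.-integrable setT (EFin \o g) -> (forall x, `|f x| `^ p <= g x) ->
  Lpfun p f.
Proof.
move=> mf ig fg; split => //; apply: integrable_le ig.
  exact: measurable_powR_normr.
by move=> x; rewrite ger0_norm ?powR_ge0.
Qed.

Lemma Lpfun_bound p f (c : R) : measurable_fun setT f ->
  (\int[mu]_x (`|f x| `^ p)%:E <= c%:E)%E -> Lpfun p f /\ Lpint p f <= c.
Proof.
move=> mf fc; have fL : Lpfun p f.
  by apply: LpfunP => //; apply: le_lt_trans fc _; rewrite ltry.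
by split => //; rewrite -lee_fin EFin_Lpint.
Qed.

Lemma LpfunD p f g : 0 <= p -> Lpfun p f -> Lpfun p g ->
  Lpfun p (fun x => f x + g x).
Proof.
move=> p0 [mf fi] [mg gi].
apply: (@Lpfun_le _ _ (fun x => 2 `^ p * (`|f x| `^ p + `|g x| `^ p))).
- exact: measurable_funD.
- by apply: integrableZ_EFin; exact: integrableD_EFin.
- by move=> x; exact: powR_add_le.
Qed.

Lemma LpfunZ p c f : Lpfun p f -> Lpfun p (fun x => c * f x).
Proof.
move=> [mf fi]; apply: (@Lpfun_le _ _ (fun x => `|c| `^ p * `|f x| `^ p)).
- exact: measurable_funM.
- exact: integrableZ_EFin.
- by move=> x; rewrite normr_powRM.
Qed.

Lemma LpfunB p f g : 0 <= p -> Lpfun p f -> Lpfun p g ->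
  Lpfun p (fun x => f x - g x).
Proof.
move=> p0 fL /(LpfunZ (-1)) /(LpfunD p0 fL).
by under [X in Lpfun _ X -> _]eq_fun do rewrite mulN1r.
Qed.

Lemma LpintZ p c f : Lpfun p f ->
  Lpint p (fun x => c * f x) = `|c| `^ p * Lpint p f.
Proof.
move=> [mf fi]; rewrite /Lpint -RintegralZl//.
by apply: eq_Rintegral => x _; rewrite normr_powRM.
Qed.

Lemma Lpint_add_le p f g : 0 <= p -> Lpfun p f -> Lpfun p g ->
  Lpint p (fun x => f x + g x) <= 2 `^ p * (Lpint p f + Lpint p g).
Proof.
move=> p0 fL gL; have [_ sL] := LpfunD p0 fL gL.
have [_ fi] := fL; have [_ gi] := gL.
rewrite /Lpint -RintegralD// -RintegralZl//; last exact: integrableD_EFin.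
apply: le_Rintegral => //.
  by apply: integrableZ_EFin; exact: integrableD_EFin.
by move=> x _; exact: powR_add_le.
Qed.

Lemma Lpint_sub_le p f g : 0 <= p -> Lpfun p f -> Lpfun p g ->
  Lpint p (fun x => f x - g x) <= 2 `^ p * (Lpint p f + Lpint p g).
Proof.
move=> p0 fL gL; have := Lpint_add_le p0 fL (LpfunZ (-1) gL).
rewrite LpintZ// normrN1 powR1 mul1r.
by under [X in Lpint _ X <= _ -> _]eq_fun do rewrite mulN1r.
Qed.

Lemma Lpfun_mul p f g : 1 < p -> Lpfun (p / (p - 1)) f -> Lpfun p g ->
  mu.-integrable setT (EFin \o (fun x => f x * g x)).
Proof.
move=> p1 [mf fi] [mg gi]; have [C C0 yC] := young_eps p1 ltr01.
apply: (@integrable_le _ _ _ _ _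
  (fun x => 1 * `|f x| `^ (p / (p - 1)) + C * `|g x| `^ p)).
- exact: measurable_funM.
- by move=> x; exact: yC.
- by apply: integrableD_EFin; exact: integrableZ_EFin.
Qed.

(** Used in place of Hoelder's inequality: once [eps] is small with respect to a
    bound on the first factor, the integral is small with the second factor. *)
Lemma Rintegral_mul_le p (eps : R) : 1 < p -> 0 < eps ->
  exists2 C, 0 < C & forall f g, Lpfun (p / (p - 1)) f -> Lpfun p g ->
  `| \int[mu]_x (f x * g x) | <=
    eps * Lpint (p / (p - 1)) f + C * Lpint p g.
Proof.
move=> p1 e0; have [C C0 yC] := young_eps p1 e0; exists C => // f g fL gL.
have ifg := Lpfun_mul p1 fL gL.
have [_ fi] := fL; have [_ gi] := gL.
apply: (le_trans (le_normr_Rintegral measurableT ifg)).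
rewrite /Lpint -!RintegralZl//.
rewrite -RintegralD//; [|exact: integrableZ_EFin..].
apply: le_Rintegral => //.
- by have := integrable_norm ifg.
- by apply: integrableD_EFin; exact: integrableZ_EFin.
Qed.

Lemma Lpint_uniform_convex p (eps : R) : 1 < p -> 0 < eps ->
  exists2 C, 0 <= C & forall f g, Lpfun p f -> Lpfun p g ->
    Lpint p (fun x => f x - g x) <= eps * (Lpint p f + Lpint p g) +
    C * ((Lpint p f + Lpint p g) / 2 - Lpint p (fun x => (f x + g x) / 2)).
Proof.
move=> p1 e0; have p0 : 0 <= p by lra.
have [C C0 uC] := powR_uniform_convex p1 e0; exists C => // f g fL gL.
have [_ sL] := LpfunB p0 fL gL.
have mL : Lpfun p (fun x => (f x + g x) / 2).
  have := LpfunZ 2^-1 (LpfunD p0 fL gL).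
  by under [X in Lpfun _ X -> _]eq_fun do rewrite mulrC.
have [_ fi] := fL; have [_ gi] := gL; have [_ mi] := mL.
have fgi := integrableD_EFin fi gi.
have h1 := integrableZ_EFin eps fgi.
have h2 := integrableB_EFin (integrableZ_EFin 2^-1 fgi) mi.
have h3 := integrableZ_EFin C h2.
have -> : eps * (Lpint p f + Lpint p g) +
    C * ((Lpint p f + Lpint p g) / 2 - Lpint p (fun x => (f x + g x) / 2)) =
  \int[mu]_x (eps * (`|f x| `^ p + `|g x| `^ p) + C * (
    2^-1 * (`|f x| `^ p + `|g x| `^ p) - `|(f x + g x) / 2| `^ p)).
  rewrite RintegralD// !RintegralZl// RintegralB// ?RintegralZl// ?RintegralD//.
    by rewrite (mulrC (Lpint p f + _)).
  exact: integrableZ_EFin.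
apply: le_Rintegral => //; first exact: integrableD_EFin.
by move=> x _; rewrite (mulrC 2^-1); exact: uC.
Qed.

Lemma Lpint_midpoint p f g : 1 < p -> Lpfun p f -> Lpfun p g ->
  Lpfun p (fun x => (f x + g x) / 2) /\
  Lpint p (fun x => (f x + g x) / 2) <= (Lpint p f + Lpint p g) / 2.
Proof.
move=> p1 fL gL; have p0 : 0 <= p by lra.
have mL : Lpfun p (fun x => (f x + g x) / 2).
  have := LpfunZ 2^-1 (LpfunD p0 fL gL).
  by under [X in Lpfun _ X -> _]eq_fun do rewrite mulrC.
split => //; have [_ fi] := fL; have [_ gi] := gL; have [_ mi] := mL.
have fgi := integrableD_EFin fi gi.
rewrite mulrC /Lpint -RintegralD// -RintegralZl//; apply: le_Rintegral => //.
  exact: integrableZ_EFin.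
by move=> x _; rewrite [leRHS]mulrC; exact: powR_midpoint.
Qed.

End Lp.

(** * Completeness *)

Section Lp_complete.
Context d (T : measurableType d) (R : realType).
Variable mu : {measure set T -> \bar R}.
Implicit Types (f g : T -> R) (p : R).

(** The weights [2^i] force [|u (i+1) - u i|] to decay geometrically, whatever
    [p > 0], so that the increments are summable. *)
Lemma cvg_summable_powR p (u : nat -> R) (S : R) : 0 < p ->
  (forall n, \sum_(0 <= i < n) 2 ^+ i * `|u i.+1 - u i| `^ p <= S) ->
  cvgn u.
Proof.
move=> p0 uS.
have S0 : 0 <= S by have := uS 0%N; rewrite big_geq.
pose rho : R := (2^-1) `^ p^-1.
have rho1 : `|rho| < 1.
  rewrite ger0_norm ?powR_ge0//.
  have <- : (1 : R) `^ p^-1 = 1 by rewrite powR1.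
  by rewrite gt0_ltr_powR ?invr_gt0// ?nnegrE//; lra.
have udist n : `|telescope u n| <= geometric (S `^ p^-1) rho n.
  rewrite /telescope /geometric/=.
  have -> : rho ^+ n = (2^-1 ^+ n) `^ p^-1.
    by rewrite /rho -powR_mulrn ?powR_ge0// powRAC powR_mulrn.
  have tE : `|u n.+1 - u n| = (`|u n.+1 - u n| `^ p) `^ p^-1.
    by rewrite -powRrM divff ?gt_eqF// powRr1.
  rewrite -powRM// [leLHS]tE; apply: le_powR.
  - by rewrite invr_ge0 ltW.
  - exact: powR_ge0.
  - rewrite exprVn ler_pdivlMr ?exprn_gt0// mulrC.
    apply: le_trans (uS n.+1); rewrite big_nat_recr//= lerDr.
    by apply: sumr_ge0 => i _; rewrite mulr_ge0 ?powR_ge0.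
have cs : cvgn (series (telescope u)).
  apply: normed_cvg; apply: (series_le_cvg _ _ udist) => //.
    by move=> n; rewrite /geometric/= mulr_ge0 ?exprn_ge0 ?powR_ge0.
  exact: is_cvg_geometric_series.
have -> : u = (fun n => u 0%N + series (telescope u) n).
  by apply/funext => n; rewrite -eq_sum_telescope.
by apply: is_cvgD => //; exact: is_cvg_cst.
Qed.

(** The sum of the p-th powers of the increments, weighted by [2^n], has a finite
    integral, so it is finite almost everywhere. *)
Lemma ae_cvg_fast_Cauchy p (f : nat -> T -> R) : 0 < p ->
  (forall n, measurable_fun setT (f n)) ->
  (forall n, \int[mu]_x (`|f n.+1 x - f n x| `^ p)%:E <= (4^-1 ^+ n)%:E)%E ->
  {ae mu, forall x, cvgn (f ^~ x)}.
Proof.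
move=> p0 mf fb.
pose F n x := (2 ^+ n * `|f n.+1 x - f n x| `^ p)%:E : \bar R.
have mq n : measurable_fun setT (fun x => `|f n.+1 x - f n x| `^ p).
  by apply: measurable_powR_normr; exact: measurable_funB.
have mF n : measurable_fun setT (F n).
  by apply/measurable_EFinP; exact: measurable_funM.
have F0 n x : setT x -> (0 <= F n x)%E.
  by move=> _; rewrite lee_fin mulr_ge0 ?powR_ge0 ?exprn_ge0.
have Foo : (\int[mu]_x (\sum_(0 <= n <oo) F n x) < +oo)%E.
  rewrite integral_nneseries//.
  apply: (@le_lt_trans _ _ (\sum_(0 <= n <oo) (geometric 1 2^-1 n)%:E)%E).
    apply: lee_nneseries => [n _ _|n _]; first by apply: integral_ge0 => x; exact: F0.
    rewrite /F (_ : (fun x => _) = (fun x =>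
        (2 ^+ n)%:E * (`|f n.+1 x - f n x| `^ p)%:E)%E)//.
    rewrite ge0_integralZl_EFin//; last exact/measurable_EFinP.
    rewrite (le_trans (lee_wpmul2l _ (fb n)))//.
    rewrite /geometric/= mul1r -EFinM -exprMn lee_fin.
    by have -> : 2 * 4^-1 = 2^-1 :> R by lra.
  have /cvg_ex[l hl] : cvgn (series (geometric 1 (2^-1 : R))).
    by apply: is_cvg_geometric_series; rewrite ger0_norm; lra.
  have -> : (\sum_(0 <= n <oo) (geometric 1 2^-1 n)%:E = l%:E)%E.
    apply/cvg_lim => //; under eq_fun do rewrite sumEFin.
    by apply: cvg_EFin => //; exact: nearW.
  exact: ltry.
have iF : mu.-integrable setT (fun x => (\sum_(0 <= n <oo) F n x)%E).
  apply/integrableP; split.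
    by apply: ge0_emeasurable_sum => // n x _ _; exact: F0.
  under eq_integral => x _.
    rewrite gee0_abs; first over.
    by apply: nneseries_ge0 => n _ _; exact: F0.
  exact: Foo.
have := integrable_ae measurableT iF; apply: filterS => x /(_ I) fin.
apply: (@cvg_summable_powR p _ (fine (\sum_(0 <= n <oo) F n x))%E) => // n.
rewrite -lee_fin fineK// -sumEFin.
by apply: nneseries_lim_ge => k _ _; exact: F0.
Qed.

(** Completeness along an arbitrary filter: compactness provides a Cauchy
    ultrafilter, minimization a Cauchy sequence. Indices are extracted along
    which consecutive distances decrease geometrically; the sets [B n] serve to
    impose that the extracted indices grow. *)
Lemma Lp_Cauchy_filter p (J : Type) (F : set_system J) (f : J -> T -> R)
    (B : nat -> set J) : ProperFilter F -> 0 < p ->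
  (forall i, Lpfun mu p (f i)) -> (forall n, F (B n)) ->
  (forall e, 0 < e -> exists2 A, F A & forall i j, A i -> A j ->
     Lpint mu p (fun x => f i x - f j x) <= e) ->
  exists (k : nat -> J) (g : T -> R), [/\ forall n, B n (k n), Lpfun mu p g,
    {ae mu, forall x, f (k n) x @[n --> \oo] --> g x} &
    Lpint mu p (fun x => f (k n) x - g x) @[n --> \oo] --> 0].
Proof.
move=> FF p0 fL FB Fc.
have e0 n : 0 < 4^-1 ^+ n :> R by rewrite exprn_gt0.
have /choice[A AP] n : exists A, F A /\ forall i j, A i -> A j ->
    Lpint mu p (fun x => f i x - f j x) <= 4^-1 ^+ n.
  by have [S] := Fc _ (e0 n); exists S.
have FA n : F (\bigcap_(i < n.+1) A i `&` B n).
  apply: filterI => //; elim: n => [|n IH].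
    by rewrite bigcap_mkord big_ord_recl big_ord0 setIT; case: (AP 0%N).
  move: IH; rewrite !bigcap_mkord => IH; rewrite big_ord_recr/=.
  by apply: filterI => //; case: (AP n.+1).
have /choice[k kP] : forall n, exists k, (\bigcap_(i < n.+1) A i `&` B n) k.
  by move=> n; exact: filter_ex (FA n).
have kA m n : (m <= n)%N -> A m (k n) by move=> mn; apply: (kP n).1 => /=.
have fk i j : (i <= j)%N ->
    (\int[mu]_x (`|f (k i) x - f (k j) x| `^ p)%:E <= (4^-1 ^+ i)%:E)%E.
  move=> ij; rewrite -EFin_Lpint; last by apply: LpfunB => //; exact: ltW.
  by rewrite lee_fin; apply: (AP i).2; exact: kA.
have mf i : measurable_fun setT (f i) by case: (fL i).
have ac : {ae mu, forall x, cvgn (fun n => f (k n) x)}.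
  apply: (@ae_cvg_fast_Cauchy p) => // n.
  by under eq_integral do rewrite distrC; exact: fk.
(* the upper limit is measurable, and finite where the sequence converges *)
pose g x := fine (limn_esup (fun n => (f (k n) x)%:E)).
have mg : measurable_fun setT g.
  apply: measurableT_comp => //; apply: measurable_fun_limn_esup => n.
  exact/measurable_EFinP.
have cg : {ae mu, forall x, f (k n) x @[n --> \oo] --> g x}.
  apply: filterS ac => x /cvg_ex[l fl].
  have cE : (f (k n) x)%:E @[n --> \oo] --> l%:E.
    by apply: cvg_EFin => //; exact: nearW.
  rewrite /g is_cvg_limn_esupE; last by apply/cvg_ex; exists l%:E.
  by rewrite (cvg_lim _ cE).
have fg i : Lpfun mu p (fun x => f (k i) x - g x) /\
    Lpint mu p (fun x => f (k i) x - g x) <= 4^-1 ^+ i.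
  apply: Lpfun_bound; first exact: measurable_funB.
  apply: (@fatou_ae _ _ _ _ (fun j x => `|f (k i) x - f (k j) x| `^ p)).
  - by move=> j; apply: measurable_powR_normr; exact: measurable_funB.
  - by apply: measurable_powR_normr; exact: measurable_funB.
  - by move=> j x; exact: powR_ge0.
  - apply: filterS cg => x fgx.
    have : f (k i) x - f (k j) x @[j --> \oo] --> f (k i) x - g x.
      by apply: cvgB => //; exact: cvg_cst.
    apply: (@continuous_cvg _ _ _ _ _ _ (fun y : R => `|y| `^ p)).
    exact: continuous_powR_normr.
  - by exists i => // j /= ij; exact: fk.
exists k, g; split => //.
- by move=> n; exact: (kP n).2.
- have := LpfunB (ltW p0) (fL (k 0%N)) (fg 0%N).1.
  by under [X in Lpfun _ _ X -> _]eq_fun do rewrite subKr.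
- apply: (@squeeze_cvgr _ _ _ _ (fun=> 0) (fun n => 4^-1 ^+ n)).
  + by apply: nearW => n; rewrite Lpint_ge0 (fg n).2.
  + exact: cvg_cst.
  + by apply: cvg_expr; rewrite ger0_norm; lra.
Qed.

End Lp_complete.

(** * Decreasing sequences of convex sets *)

Section convex_limit.
Context d (T : measurableType d) (R : realType).
Variable mu : {measure set T -> \bar R}.
Implicit Types (f g : T -> R) (p : R).

(** This plays the part of the weak compactness of balls and of Mazur's lemma.
    The infima of [Lpint] over the [C n] increase to a limit; two late elements
    that almost reach these infima have their midpoint in a common [C N], where
    [Lpint] cannot be much smaller, so uniform convexity makes them close. *)
Lemma Lp_midconvex_limit p (C : nat -> set (T -> R)) (M : R) : 1 < p ->
  (forall m n, (m <= n)%N -> C n `<=` C m) ->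
  (forall n, C n !=set0) ->
  (forall n f, C n f -> Lpfun mu p f /\ Lpint mu p f <= M) ->
  (forall n f g, C n f -> C n g -> C n (fun x => (f x + g x) / 2)) ->
  exists (f : nat -> T -> R) g, [/\ forall n, C n (f n), Lpfun mu p g,
    {ae mu, forall x, f n x @[n --> \oo] --> g x} &
    Lpint mu p (fun x => f n x - g x) @[n --> \oo] --> 0].
Proof.
have avg_le (x y b : R) : x <= b -> y <= b -> (x + y) / 2 <= b by lra.
have sum_le (x y b : R) : x <= b -> y <= b -> x + y <= 2 * (b + 1) by lra.
have gap (x y l t : R) : x <= l + t -> l - t < y -> x - y <= 2 * t by lra.
have halves (x y e : R) : x <= e / 2 -> y <= e / 2 -> x + y <= e by lra.
move=> p1 Cdec C0 CM Cmid; have p0 : 0 < p by lra.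
pose V n := [set Lpint mu p f | f in C n].
have Vinf n : has_inf (V n).
  split; first by have [f Cf] := C0 n; exists (Lpint mu p f), f.
  by exists 0 => _ [f _ <-]; exact: Lpint_ge0.
pose a n := inf (V n).
have aM n : a n <= M.
  have [f Cf] := C0 n; apply: le_trans (CM _ _ Cf).2.
  by apply: ge_inf; [case: (Vinf n)|exists f].
have aV n f : C n f -> a n <= Lpint mu p f.
  by move=> Cf; apply: ge_inf; [case: (Vinf n)|exists f].
have aP n : exists f, C n f /\ Lpint mu p f <= a n + n.+1%:R^-1.
  have n0 : 0 < n.+1%:R^-1 :> R by rewrite invr_gt0.
  by have [_ [f Cf <-] /ltW] := inf_adherent n0 (Vinf n); exists f.
have /choice[f fP] := aP.
have fL n : Lpfun mu p (f n) by have [/CM[]] := fP n.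
have anond : {homo a : n m / (n <= m)%N >-> n <= m}.
  move=> n m nm; apply: lb_le_inf; first by case: (Vinf m).
  by move=> _ [h Ch <-]; apply: aV; exact: Cdec Ch.
have /cvg_ex[l al] : cvgn a.
  apply: nondecreasing_is_cvgn => //.
  by exists M => _ [n _ <-].
have M0 : 0 <= M by apply: le_trans (Lpint_ge0 _ _ _) (CM _ _ (fP 0%N).1).2.
have [k [g [kn gL fg Lg]]] : exists (k : nat -> nat) g,
    [/\ forall n, (n <= k n)%N, Lpfun mu p g,
    {ae mu, forall x, f (k n) x @[n --> \oo] --> g x} &
    Lpint mu p (fun x => f (k n) x - g x) @[n --> \oo] --> 0].
  apply: (@Lp_Cauchy_filter _ _ _ mu p _ \oo f (fun n m => (n <= m)%N)) => //.
    by move=> n; exists n.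
  move=> e e0; pose e1 := e / (4 * (M + 1)).
  have e10 : 0 < e1 by rewrite divr_gt0//; lra.
  have e1E : e1 * (2 * (M + 1)) = e / 2 by rewrite /e1; field; rewrite gt_eqF//; lra.
  have [K K0 uK] := Lpint_uniform_convex mu p1 e10.
  pose t := e / (4 * (K + 1)).
  have t0 : 0 < t by rewrite divr_gt0//; lra.
  have tE : (K + 1) * (2 * t) = e / 2 by rewrite /t; field; rewrite gt_eqF//; lra.
  have : \forall n \near \oo, l - t < a n /\ n.+1%:R^-1 < t :> R.
    have h1 : \forall n \near \oo, l - t < a n.
      by apply: (cvgr_gt l al); rewrite ltrBlDr ltrDl.
    have h2 := near_infty_natSinv_lt (PosNum t0).
    by apply: filterS2 h1 h2 => n.
  have al' n : a n <= l.
    have <- : limn a = l by exact/cvg_lim.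
    by apply: nondecreasing_cvgn_le => //; apply/cvg_ex; exists l.
  move=> [N _ NP]; exists [set n | (N <= n)%N]; first by exists N.
  move=> i j /= Ni Nj.
  have [_ ti] := NP _ Ni; have [_ tj] := NP _ Nj.
  have [aN _] := NP _ (leqnn N).
  have [Ci fi] := fP i; have [Cj fj] := fP j.
  apply: (le_trans (uK _ _ (fL i) (fL j))).
  have mid : a N <= Lpint mu p (fun x => (f i x + f j x) / 2).
    by apply: aV; apply: Cmid; [exact: Cdec Ci|exact: Cdec Cj].
  have h1 : e1 * (Lpint mu p (f i) + Lpint mu p (f j)) <= e / 2.
    apply: (@le_trans _ _ (e1 * (2 * (M + 1)))).
      by rewrite ler_pM2l// sum_le// ?(CM _ _ Ci).2 ?(CM _ _ Cj).2.
    by rewrite e1E.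
  have h2 : K * ((Lpint mu p (f i) + Lpint mu p (f j)) / 2 -
      Lpint mu p (fun x => (f i x + f j x) / 2)) <= e / 2.
    apply: (@le_trans _ _ ((K + 1) * (2 * t))).
      apply: (@le_trans _ _ (K * (2 * t))).
        apply: ler_wpM2l => //; apply: (gap _ _ l).
          apply: avg_le; [apply: le_trans fi _|apply: le_trans fj _].
            exact: lerD (al' i) (ltW ti).
          exact: lerD (al' j) (ltW tj).
        exact: lt_le_trans aN mid.
      by rewrite ler_wpM2r// ?lerDl// mulr_ge0// ltW.
    by rewrite tE.
  exact: halves.
exists (f \o k), g; split => // n; apply: (Cdec _ _ (kn n)).
exact: (fP _).1.
Qed.

End convex_limit.

(** * First variation of the p-th power *)

Section Euler_Lagrange.
Context d (T : measurableType d) (R : realType).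
Variable mu : {measure set T -> \bar R}.
Implicit Types (A B : T -> R) (p c : R).

Lemma integrable_dpow p A B (t : R) : 1 < p -> 0 <= t <= 1 ->
  Lpfun mu p A -> Lpfun mu p B ->
  mu.-integrable setT (EFin \o (fun x => dpow p (A x + t * B x) * B x)).
Proof.
move=> p1 t01 [mA iA] [mB iB].
apply: (@integrable_le _ _ _ _ _
  (fun x => 2 `^ p * (`|A x| `^ p + `|B x| `^ p))).
- apply: measurable_funM => //; apply: (measurableT_comp (f := dpow p)).
    exact: continuous_measurable_fun (continuous_dpow p1).
  by apply: measurable_funD => //; exact: measurable_funM.
- by move=> x; exact: dpow_bound.
- by apply: integrableZ_EFin; exact: integrableD_EFin.
Qed.

(** The tangent inequality at the far end [A + t B], so that the derivative
    bounds the difference quotient from above. *)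
Lemma Lpint_tangent p A B (t : R) : 1 < p -> 0 <= t <= 1 ->
  Lpfun mu p A -> Lpfun mu p B ->
  Lpint mu p (fun x => A x + t * B x) - Lpint mu p A <=
    p * t * \int[mu]_x (dpow p (A x + t * B x) * B x).
Proof.
move=> p1 t01 AL BL; have p0 : 0 <= p by lra.
have [_ iA] := AL; have sL := LpfunD p0 AL (LpfunZ t BL).
have iD := integrable_dpow p1 t01 AL BL.
rewrite -RintegralZl// /Lpint -RintegralB//; last by case: sL.
apply: le_Rintegral => //.
- by apply: integrableB_EFin; case: sL.
- exact: integrableZ_EFin.
- move=> x _; have := powR_tangent (A x + t * B x) (A x) p1.
  rewrite -subr_ge0 => h; rewrite -subr_ge0; apply: le_trans h _.
  by rewrite le_eqVlt; apply/orP; left; apply/eqP; ring.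
Qed.

Lemma Lpint_tangent_le p A B : 1 < p -> Lpfun mu p A -> Lpfun mu p B ->
  Lpint mu p A + p * \int[mu]_x (dpow p (A x) * B x) <=
    Lpint mu p (fun x => A x + B x).
Proof.
move=> p1 AL BL; have p0 : 0 <= p by lra.
have [_ iA] := AL; have [_ sL] := LpfunD p0 AL BL.
have iD : mu.-integrable setT (EFin \o (fun x => dpow p (A x) * B x)).
  have t01 : 0 <= (0 : R) <= 1 by rewrite lexx ler01.
  have := integrable_dpow p1 t01 AL BL.
  by apply: eq_integrable => // x _ /=; rewrite mul0r addr0.
rewrite -RintegralZl// /Lpint -RintegralD//; last exact: integrableZ_EFin.
apply: le_Rintegral => //.
  by apply: integrableD_EFin => //; exact: integrableZ_EFin.
move=> x _; have := powR_tangent (A x) (A x + B x) p1.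
by rewrite addrAC subrr add0r mulrA.
Qed.

(** Minimality bounds the slopes at [t > 0] from below by [c]; they converge to
    the slope at [0] by dominated convergence. *)
Lemma Lpint_minimizer_le p A B c : 1 < p -> Lpfun mu p A -> Lpfun mu p B ->
  (forall t, 0 <= t -> Lpint mu p A / p <=
     Lpint mu p (fun x => A x + t * B x) / p - t * c) ->
  c <= \int[mu]_x (dpow p (A x) * B x).
Proof.
have slope (I1 I0 J s : R) : 0 < p -> 0 < s ->
    I1 - I0 <= p * s * J -> I0 / p <= I1 / p - s * c -> c <= J.
  move=> p0 s0 h1 h2; rewrite -(ler_pM2l s0) -(ler_pM2l p0) mulrA.
  have : I0 <= I1 - p * (s * c).
    have -> : I0 = p * (I0 / p) by field; rewrite gt_eqF.
    have -> : I1 - p * (s * c) = p * (I1 / p - s * c) by field; rewrite gt_eqF.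
    by rewrite ler_pM2l.
  by rewrite mulrA; lra.
move=> p1 AL BL Amin; have p0 : 0 < p by lra.
pose t n : R := n.+1%:R^-1.
have t0 n : 0 < t n by rewrite invr_gt0.
have t01 n : 0 <= t n <= 1 by rewrite ltW//= invf_le1// ler1n.
have tcv : t n @[n --> \oo] --> 0 by exact: cvg_harmonic.
have ct n : c <= \int[mu]_x (dpow p (A x + t n * B x) * B x).
  have /andP[tn0 _] := t01 n.
  have := Amin _ tn0; have := Lpint_tangent p1 (t01 n) AL BL.
  exact: slope (t0 n).
have [mA iA] := AL; have [mB iB] := BL.
have iD n := integrable_dpow p1 (t01 n) AL BL.
have iD0 : mu.-integrable setT (EFin \o (fun x => dpow p (A x) * B x)).
  have z01 : 0 <= (0 : R) <= 1 by rewrite lexx ler01.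
  have := integrable_dpow p1 z01 AL BL.
  by apply: eq_integrable => // x _ /=; rewrite mul0r addr0.
have /= cv : (\int[mu]_x (dpow p (A x + t n * B x) * B x)%:E @[n --> \oo] -->
    \int[mu]_x (dpow p (A x) * B x)%:E)%E.
  pose g x := (2 `^ p * (`|A x| `^ p + `|B x| `^ p))%:E.
  have ig : mu.-integrable setT g.
    by apply: integrableZ_EFin; exact: integrableD_EFin.
  have mD n := measurable_int _ (iD n).
  have mD0 := measurable_int _ iD0.
  suff cvx x : (dpow p (A x + t n * B x) * B x)%:E @[n --> \oo] -->
      (dpow p (A x) * B x)%:E.
    have [_ _] := dominated_convergence measurableT mD mD0
      (aeW mu (fun x _ => cvx x)) ig
      (aeW mu (fun x n _ => dpow_bound (A x) (B x) p1 (t01 n))).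
    exact.
  apply: cvg_EFin; first exact: nearW.
  apply: cvgM; last exact: cvg_cst.
  apply: (@continuous_cvg _ _ _ _ _ _ (dpow p)); first exact: continuous_dpow.
  rewrite -[X in _ --> X]addr0 -[X in _ --> _ + X](mul0r (B x)).
  by apply: cvgD; [exact: cvg_cst|apply: cvgM => //; exact: cvg_cst].
rewrite -lee_fin EFin_Rintegral// -(cvg_lim _ cv)//.
apply: lime_ge; first by apply/cvg_ex; eexists; exact: cv.
by apply: nearW => n; rewrite -EFin_Rintegral// lee_fin.
Qed.

(** The Euler-Lagrange equation: one-sided minimality applies along [B] and
    along [- B]. *)
Lemma Lpint_minimizerP p A B c : 1 < p -> Lpfun mu p A -> Lpfun mu p B ->
  (forall t, Lpint mu p A / p <=
     Lpint mu p (fun x => A x + t * B x) / p - t * c) ->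
  \int[mu]_x (dpow p (A x) * B x) = c.
Proof.
move=> p1 AL BL Amin; apply/eqP; rewrite eq_le; apply/andP; split; last first.
  by apply: Lpint_minimizer_le => // t _; exact: Amin.
rewrite -lerN2.
have -> : - (\int[mu]_x (dpow p (A x) * B x)) =
    \int[mu]_x (dpow p (A x) * (-1 * B x)).
  rewrite -[LHS]mulN1r -RintegralZl//; first by apply: eq_Rintegral => x _; rewrite mulrCA.
  have z01 : 0 <= (0 : R) <= 1 by rewrite lexx ler01.
  have := integrable_dpow p1 z01 AL BL.
  by apply: eq_integrable => // x _ /=; rewrite mul0r addr0.
apply: Lpint_minimizer_le => //; first exact: LpfunZ.
move=> t _; have := Amin (- t).
have -> : (fun x => A x + t * (-1 * B x)) = (fun x => A x + - t * B x).
  by apply/funext => x; rewrite mulrA mulrN1.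
by rewrite mulrN mulNr.
Qed.

End Euler_Lagrange.

(** * Products and boxes *)

Section ae_product.
Context d1 d2 (T1 : measurableType d1) (T2 : measurableType d2) (R : realType).
Variables (m1 : {sigma_finite_measure set T1 -> \bar R})
          (m2 : {sigma_finite_measure set T2 -> \bar R}).

Lemma ae_fst (P : T1 -> Prop) :
  {ae m1, forall x, P x} -> {ae (m1 \x m2)%E, forall z, P z.1}.
Proof.
move=> [A [mA A0 PA]]; exists (A `*` setT); split.
- exact: measurableX.
- apply: eq_trans (product_measure1E _ _ mA measurableT) _.
  exact: eq_trans (congr1 (fun t => t * m2 setT)%E A0) (mul0e _).
- by move=> [x y] /= Pxy; split => //; exact: PA.
Qed.

Lemma ae_snd (P : T2 -> Prop) :
  {ae m2, forall x, P x} -> {ae (m1 \x m2)%E, forall z, P z.2}.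
Proof.
move=> [A [mA A0 PA]]; exists (setT `*` A); split.
- exact: measurableX.
- apply: eq_trans (product_measure1E _ _ measurableT mA) _.
  exact: eq_trans (congr1 (fun t => m1 setT * t)%E A0) (mule0 _).
- by move=> [x y] /= Pxy; split => //; exact: PA.
Qed.

End ae_product.

Section lebesgue_box.
Context {R : realType}.

Definition box n (a : 'rV[R]_n) (r : R) : set 'rV[R]_n :=
  [set x | forall i, a ord0 i <= x ord0 i < a ord0 i + r].

Lemma measurable_box n (a : 'rV[R]_n) r : measurable (box a r).
Proof.
rewrite (_ : box a r = \bigcap_(i in [set: 'I_n])
    ((fun x : 'rV[R]_n => x ord0 i) @^-1` `[a ord0 i, a ord0 i + r[%classic)).
  apply: fin_bigcap_measurable => // i _.
  by rewrite -[X in measurable X]setTI; apply: measurable_coord.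
apply/seteqP; split => x.
  by move=> xa i _ /=; rewrite in_itv/=; exact: xa.
by move=> xa i; have := xa i I; rewrite /= in_itv.
Qed.

Lemma lebesgue_rV_box n (a : 'rV[R]_n) r : 0 <= r ->
  lebesgue_rV n (box a r) = (r ^+ n)%:E.
Proof.
move=> r0; elim: n a => [|n IH] a.
  by rewrite /= diracE mem_set// => -[].
pose b : 'rV[R]_n := \row_i a ord0 (lift ord0 i).
pose I0 : set (measurableTypeR R) := `[a ord0 ord0, a ord0 ord0 + r[%classic.
rewrite /= /lebesgue_rVS /pushforward.
have -> : @rV_cons R n @^-1` (box a r) = I0 `*` box b r.
  apply/seteqP; split => -[x v] /=.
    move=> H; split.
      by have := H ord0; rewrite /I0/= mxE unlift_none /= in_itv.
    by move=> i; have := H (lift ord0 i); rewrite !mxE liftK.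
  move=> [x1 H] i; rewrite mxE; case: (unliftP ord0 i) => [j ->|->] /=.
    by have := H j; rewrite mxE.
  by move: x1; rewrite /I0/= in_itv.
transitivity (@lebesgue_measure R I0 * lebesgue_rV n (box b r))%E.
  by apply: product_measure1E; [exact: measurable_itv|exact: measurable_box].
rewrite IH /I0 lebesgue_measure_itv/= lte_fin ltrDl.
case: ltgtP r0 => // [r0 _|<- _].
  by rewrite -EFinD (addrC _ r) addrK -EFinM exprS.
by rewrite mul0e exprS mul0r.
Qed.

(** The sigma-algebra is generated by the coordinates, so boxes are measurable;
    those with rational data form a countable base. *)
Lemma open_measurable_rV n (U : set 'rV[R]_n) : open U -> measurable U.
Proof.
move=> oU.
pose B (am : 'rV[rat]_n * nat) : set 'rV[R]_n :=
  [set y | forall i, ratr (am.1 ord0 i) - am.2.+1%:R^-1 < y ord0 i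
                     < ratr (am.1 ord0 i) + am.2.+1%:R^-1].
have mB am : measurable (B am).
  rewrite (_ : B am = \bigcap_(i in [set: 'I_n])
    ((fun x : 'rV[R]_n => x ord0 i) @^-1`
      `]ratr (am.1 ord0 i) - am.2.+1%:R^-1,
        ratr (am.1 ord0 i) + am.2.+1%:R^-1[%classic)).
    apply: fin_bigcap_measurable => // i _.
    by rewrite -[X in measurable X]setTI; apply: measurable_coord.
  apply/seteqP; split => x.
    by move=> h i _ /=; rewrite in_itv/=; exact: h.
  by move=> h i; have := h i I; rewrite /= in_itv.
have -> : U = \bigcup_(am in [set am | B am `<=` U]) B am.
  apply/seteqP; split => [x Ux|x [am /= BU] /BU//].
  have /nbhs_ballP[e /= e0 eU] : nbhs x U by exact: open_nbhs_nbhs.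
  have e20 : 0 < e / 2 by lra.
  have [m _ /(_ m (leqnn m)) /= me] := near_infty_natSinv_lt (PosNum e20).
  have m0 : 0 < m.+1%:R^-1 :> R by rewrite invr_gt0.
  have /choice[q qP] i : exists q : rat,
      ratr q - m.+1%:R^-1 < x ord0 i < ratr q + m.+1%:R^-1.
    move: (x ord0 i) (m.+1%:R^-1) m0 => xi mi mi0.
    have xx : xi - mi < xi + mi by lra.
    have [q] := rat_in_itvoo xx.
    by rewrite in_itv/= => /andP[q1 q2]; exists q; lra.
  exists (\row_i q i, m) => /=; last by move=> i; rewrite mxE.
  move=> y yB; apply: eU; split => // i j.
  have := yB j; have := qP j; rewrite mxE (ord1 i) /ball/= => h1 h2.
  move: (m.+1%:R^-1) (x ord0 j) (y ord0 j) (ratr _) me h1 h2 => mi xj yj qj *.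
  by rewrite ltr_norml; lra.
rewrite bigcup_mkcond; apply: countable_bigcupT_measurable => [|am]; first exact: countableP.
by case: ifPn => _ //; exact: measurable0.
Qed.

End lebesgue_box.

(** * Geometry of the neighbourhood of the domain *)

Section euclidean_geometry.
Context {R : realType} {N : nat}.
Implicit Types (x y v : 'rV[R]_N) (Omega : set 'rV[R]_N).

Lemma enorm_ge0 v : 0 <= enorm v. Proof. exact: sqrtr_ge0. Qed.

Lemma enormZ (t : R) v : enorm (t *: v) = `|t| * enorm v.
Proof.
rewrite /enorm -sqrtr_sqr -sqrtrM ?sqr_ge0// mulr_sumr.
by congr Num.sqrt; apply: eq_bigr => i _; rewrite mxE exprMn.
Qed.

Lemma enorm_le (r : R) v : 0 <= r -> (forall i, `|v ord0 i| <= r) ->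
  enorm v <= N%:R * r.
Proof.
move=> r0 vr; have Nr0 : 0 <= N%:R * r by rewrite mulr_ge0.
rewrite -(ger0_norm Nr0) -sqrtr_sqr; apply: ler_wsqrtr.
apply: (@le_trans _ _ (\sum_(i < N) r ^+ 2)).
  by apply: ler_sum => i _; rewrite -real_normK ?num_real// lerXn2r ?nnegrE.
rewrite sumr_const card_ord -[leLHS]mulr_natl exprMn.
apply: ler_wpM2r; first exact: sqr_ge0.
by rewrite -natrX ler_nat; rewrite -mulnn; case: (N) => // n; rewrite leq_pmulr.
Qed.

Lemma continuous_enorm : continuous (@enorm R N).
Proof.
move=> v; rewrite /enorm; apply: continuous_comp; last exact: sqrt_continuous.
apply: continuous_big => [|i _ w]; first exact: add_continuous.
apply: (@continuous_comp _ _ _ (fun w : 'rV[R]_N => w ord0 i) (fun t => t ^+ 2)).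
  exact: coord_continuous.
exact: exprn_continuous.
Qed.

Lemma open_eball x (r : R) : open (eball x r).
Proof.
rewrite (_ : eball x r = (fun y => enorm (y - x)) @^-1` [set t | t < r])//.
apply: open_comp; last exact: open_lt.
move=> y _; apply: continuous_comp; last exact: continuous_enorm.
by apply: continuousB => //; exact: cst_continuous.
Qed.

Lemma open_delta_nbhd Omega (delta : R) : open Omega ->
  open (delta_nbhd Omega delta).
Proof.
by move=> oO; apply: openU => //; apply: bigcup_open => q _; exact: open_eball.
Qed.

(** On the segment from [x] to [y], the supremum of the parameters of the points
    in [Omega] is the parameter of a boundary point. *)
Lemma segment_exit Omega x y : open Omega -> Omega x -> ~ Omega y ->
  exists2 q, (closure Omega `\` interior Omega) q &
    enorm (y - q) <= enorm (y - x).
Proof.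
move=> oO Ox nOy; pose ga (t : R) := x + t *: (y - x).
have cga : continuous ga.
  move=> t; apply: cvgD; first exact: cvg_cst.
  by apply: cvgZr_tmp; exact: cvg_id.
pose A := [set t : R | 0 <= t <= 1 /\ Omega (ga t)].
have A0 : A 0 by split; [rewrite lexx ler01|rewrite /ga scale0r addr0].
have ubA : has_ubound A by exists 1 => t [/andP[]].
have A1 t : A t -> t <= sup A by move=> At; exact: ub_le_sup.
have s1 : sup A <= 1 by apply: ge_sup; [exists 0|move=> t [/andP[]]].
have s0 : 0 <= sup A by exact: A1.
exists (ga (sup A)); last first.
  have -> : y - ga (sup A) = (1 - sup A) *: (y - x).
    by rewrite /ga scalerBl scale1r opprD addrA.
  by rewrite enormZ ger0_norm ?subr_ge0// ler_piMl ?enorm_ge0// gerBl.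
split.
  move=> B /cga nB; have := closure_sup (ex_intro _ _ A0) ubA nB.
  by move=> [t [[_ Ot] Bt]]; exists (ga t).
move=> /interior_subset Oq.
have s_lt1 : sup A < 1.
  rewrite lt_neqAle s1 andbT; apply/eqP => sE; apply: nOy; move: Oq.
  by rewrite sE /ga scale1r addrCA subrr addr0.
have /cga/nbhs_ballP[e /= e0 eO] : nbhs (ga (sup A)) Omega.
  exact: open_nbhs_nbhs.
pose t := sup A + Num.min (e / 2) (1 - sup A).
have m0 : 0 < Num.min (e / 2) (1 - sup A).
  by rewrite lt_min divr_gt0//= subr_gt0.
have : A t.
  split.
    rewrite addr_ge0 ?(ltW m0)//= /t -lerBrDl ge_min lexx orbT//.
  apply: eO; rewrite /ball/= /t opprD addrA subrr sub0r normrN gtr0_norm//.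
  by rewrite gt_min; apply/orP; left; lra.
by move=> /A1; rewrite /t gerDl leNgt m0.
Qed.

(** The neighbourhood is defined by balls around boundary points. That it also
    contains those around points of the domain is what brings every short pair
    with one end in [Omega] into the range of the double integral. *)
Lemma delta_nbhd_eball Omega (delta : R) x y : open Omega -> 0 < delta ->
  Omega x -> enorm (y - x) < delta -> delta_nbhd Omega delta y.
Proof.
move=> oO d0 Ox yx; have [Oy|/(segment_exit oO Ox)[q q1 q2]] := pselect (Omega y).
  by left.
by right; exists q => //; exact: le_lt_trans q2 yx.
Qed.

End euclidean_geometry.

(** * Iterated integrals *)

Section product_integrals.
Context d1 d2 (T1 : measurableType d1) (T2 : measurableType d2) (R : realType).
Variables (m1 : {sigma_finite_measure set T1 -> \bar R})
          (m2 : {sigma_finite_measure set T2 -> \bar R}).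
Local Open Scope ereal_scope.

Lemma ge0_integral_setX (A : set T1) (B : set T2) (f : T1 * T2 -> \bar R) :
  measurable A -> measurable B -> measurable_fun setT f ->
  (forall z, 0 <= f z) ->
  \int[m1]_(x in A) \int[m2]_(y in B) f (x, y) =
  \int[m1 \x m2]_(z in A `*` B) f z.
Proof.
move=> mA mB mf f0; rewrite [RHS]integral_mkcond fubini_tonelli1; first last.
- by move=> z; rewrite patchE; case: ifP.
- by apply/measurable_restrict => //; [exact: measurableX|rewrite setTI; exact: measurable_funTS].
rewrite integral_mkcond; apply: eq_integral => x _.
rewrite patchE /fubini_F; case: ifPn => xA.
  rewrite [LHS]integral_mkcond; apply: eq_integral => y _.
  rewrite !patchE; congr (if _ then _ else _).
  apply/idP/idP => [yB|/set_mem[]//].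
    by rewrite mem_set//; split; [exact: set_mem|exact/set_mem].
  by move=> _ /mem_set.
rewrite integral0_eq// => y _; rewrite patchE; case: ifPn => // /set_mem[/= xA'].
by rewrite mem_set in xA.
Qed.

Lemma measurable_fun_integral_snd (B : set T2) (f : T1 * T2 -> \bar R) :
  measurable B -> measurable_fun setT f -> (forall z, 0 <= f z) ->
  measurable_fun setT (fun x => \int[m2]_(y in B) f (x, y)).
Proof.
move=> mB mf f0.
rewrite (_ : (fun x => _) = fubini_F m2 (f \_ ([set: T1] `*` B))).
  apply: measurable_fun_fubini_tonelli_F.
    apply/measurable_restrict => //; first exact: measurableX.
    by rewrite setTI; exact: measurable_funTS.
  by move=> z; rewrite patchE; case: ifP.
apply/funext => x; rewrite integral_mkcond; apply: eq_integral => y _.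
rewrite !patchE; congr (if _ then _ else _).
apply/idP/idP => [yB|/set_mem[]//]; last by move=> _ /mem_set.
by rewrite mem_set//; split => //; exact: set_mem.
Qed.

End product_integrals.

(** * Oscillation and means *)

Section oscillation.
Context d (T : measurableType d) (R : realType).
Variable mu : {sigma_finite_measure set T -> \bar R}.
Implicit Types (f : T -> R) (p : R) (A B Q : set T).

Lemma measurable_powR_diff p f : measurable_fun setT f ->
  measurable_fun setT (fun z : T * T => (`|f z.2 - f z.1| `^ p)%:E).
Proof.
move=> mf; apply/measurable_EFinP; apply: measurable_powR_normr.
by apply: measurable_funB; apply: measurableT_comp.
Qed.

Lemma measurable_EFin_powR p f : measurable_fun setT f ->
  measurable_fun setT (fun x => (`|f x| `^ p)%:E).
Proof. by move=> mf; apply/measurable_EFinP; exact: measurable_powR_normr. Qed.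

Local Open Scope ereal_scope.

(** [|f x|^p <= 2^p (|f y - f x|^p + |f y|^p)] integrated over [A] times [B]:
    a bound on [B] is carried over to [A] at the price of the increments. *)
Lemma powR_integral_transfer p f A B : (0 <= p)%R ->
  measurable A -> measurable B -> measurable_fun setT f ->
  mu B * \int[mu]_(x in A) (`|f x| `^ p)%:E <=
  (2 `^ p)%:E * (\int[mu \x mu]_(z in A `*` B) (`|f z.2 - f z.1| `^ p)%:E +
                 mu A * \int[mu]_(x in B) (`|f x| `^ p)%:E).
Proof.
move=> p0 mA mB mf; have mfp := measurable_EFin_powR p mf.
have fp0 x : 0 <= (`|f x| `^ p)%:E by rewrite lee_fin powR_ge0.
have mAB : measurable (A `*` B) by exact: measurableX.
have mf1 : measurable_fun setT (fun z : T * T => (`|f z.1| `^ p)%:E).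
  by apply: (measurableT_comp mfp); exact: measurable_fst.
have mf2 : measurable_fun setT (fun z : T * T => (`|f z.2| `^ p)%:E).
  by apply: (measurableT_comp mfp); exact: measurable_snd.
have mdf := measurable_powR_diff p mf.
have -> : mu B * \int[mu]_(x in A) (`|f x| `^ p)%:E =
    \int[mu \x mu]_(z in A `*` B) (`|f z.1| `^ p)%:E.
  rewrite -(ge0_integral_setX mu mu mA mB mf1 (fun z => fp0 z.1)).
  rewrite -ge0_integralZl//; last exact: measurable_funTS.
  apply: eq_integral => x _ /=.
  by rewrite muleC; exact: esym (integral_cst mu mB _).
have -> : mu A * \int[mu]_(x in B) (`|f x| `^ p)%:E =
    \int[mu \x mu]_(z in A `*` B) (`|f z.2| `^ p)%:E.
  rewrite -(ge0_integral_setX mu mu mA mB mf2 (fun z => fp0 z.2)).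
  by rewrite muleC; exact: esym (integral_cst mu mA _).
rewrite -ge0_integralD//; first last.
- exact: measurable_funTS.
- exact: measurable_funTS.
rewrite -ge0_integralZl//; first last.
- by move=> z _; rewrite adde_ge0.
- by apply: emeasurable_funD; exact: measurable_funTS.
apply: ge0_le_integral => //.
- exact: measurable_funTS.
- by apply: measurable_funeM; apply: emeasurable_funD; exact: measurable_funTS.
move=> z _; rewrite -EFinD -EFinM lee_fin.
have := @powR_add_le _ p (- (f z.2 - f z.1)) (f z.2) p0; rewrite normrN.
by have -> : (- (f z.2 - f z.1) + f z.2 = f z.1)%R by lra.
Qed.

Lemma integrable_cst_lty (c : R) Q : measurable Q -> mu Q < +oo ->
  mu.-integrable Q (cst c%:E).
Proof.
move=> mQ Qoo; apply/integrableP; split=> //.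
by rewrite (_ : (fun x => _) = cst `|c%:E|)// integral_cst//= lte_mul_pinfty.
Qed.

Lemma Lpfun_integrable p f Q : (1 <= p)%R -> measurable Q -> mu Q < +oo ->
  Lpfun mu p f ->
  mu.-integrable Q (EFin \o f) /\
  `| \int[mu]_(x in Q) f x |%R%:E <= mu Q + (Lpint mu p f)%:E.
Proof.
move=> p1 mQ Qoo [mf fi].
have ip : mu.-integrable Q (EFin \o (fun x => `|f x| `^ p)%R).
  exact: integrableS measurableT mQ (@subsetT _ _) fi.
have i1 : mu.-integrable Q (EFin \o (fun x => 1 + `|f x| `^ p)%R).
  have := integrableD mQ (integrable_cst_lty 1 mQ Qoo) ip.
  by apply: eq_integrable.
have fle x : (`|f x| <= 1 + `|f x| `^ p)%R.
  have [f1|/ltW f1] := lerP `|f x| 1%R.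
    by rewrite (le_trans f1)// lerDl powR_ge0.
  by apply: le_trans (le1r_powR f1 p1) _; rewrite lerDr.
have iQ : mu.-integrable Q (EFin \o f).
  apply: le_integrable i1 => //.
    by apply/measurable_EFinP; exact: measurable_funTS.
  by move=> x _; rewrite /= lee_fin [leRHS]ger0_norm ?addr_ge0 ?powR_ge0.
split => //; rewrite EFin_normr_Rintegral//.
apply: le_trans (le_abse_integral _ mQ _) _; first exact: measurable_int iQ.
apply: (@le_trans _ _ (\int[mu]_(x in Q) (1 + `|f x| `^ p)%:E)).
  apply: ge0_le_integral => //.
  - by apply/measurable_EFinP; apply: measurableT_comp => //; exact: measurable_funTS.
  - exact: measurable_int i1.
  - by move=> x _; rewrite lee_fin.
under eq_integral do rewrite EFinD.
rewrite ge0_integralD//; first last.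
- exact: measurable_int ip.
rewrite -[X in _ <= X + _]mul1e -(integral_cst mu mQ) leeD2l// EFin_Lpint; last by split.
by apply: ge0_subset_integral => //; exact: measurable_EFin_powR.
Qed.

(** Jensen's inequality for [f x - f y] averaged over [y]: the linear part of the
    tangent at the average [a = f x - m] integrates to zero. *)
Lemma mean_oscillation p f Q (q : R) : (1 < p)%R -> (0 < q)%R ->
  measurable Q -> mu Q = q%:E -> Lpfun mu p f ->
  q%:E * \int[mu]_(x in Q) (`|f x - q^-1 * \int[mu]_(y in Q) f y| `^ p)%:E <=
  \int[mu \x mu]_(z in Q `*` Q) (`|f z.2 - f z.1| `^ p)%:E.
Proof.
move=> p1 q0 mQ Qq fL; have [mf fi] := fL.
have Qoo : mu Q < +oo by rewrite Qq ltry.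
have [fQ _] := Lpfun_integrable (ltW p1) mQ Qoo fL.
have [mdf fp0] := (measurable_powR_diff p mf, powR_ge0).
set m := (q^-1 * _)%R.
rewrite -(ge0_integral_setX mu mu mQ mQ mdf); last first.
  by move=> z; rewrite lee_fin powR_ge0.
have mfm : measurable_fun setT (fun x => f x - m)%R by exact: measurable_funB.
rewrite -ge0_integralZl//; first last.
- by rewrite lee_fin ltW.
- by apply: measurable_funTS; exact: measurable_EFin_powR.
apply: ge0_le_integral => //.
- by move=> x _; rewrite -EFinM lee_fin mulr_ge0 ?powR_ge0// ltW.
- by apply: measurable_funTS; apply: measurable_funeM; exact: measurable_EFin_powR.
- apply: measurable_funTS.
  apply: (measurable_fun_integral_snd mu mQ mdf) => z.
  by rewrite lee_fin powR_ge0.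
move=> x _ /=; set a := (f x - m)%R.
have iB : mu.-integrable Q (EFin \o (fun y => f x - f y)%R).
  have := integrableB mQ (integrable_cst_lty (f x) mQ Qoo) fQ.
  by apply: eq_integrable.
have mp : measurable_fun setT (fun y => (`|f y - f x| `^ p)%:E).
  by apply: measurable_EFin_powR; exact: measurable_funB.
have ip : mu.-integrable Q (EFin \o (fun y => `|f y - f x| `^ p)%R).
  apply: (@le_integrable _ _ _ _ _ mQ _
    (EFin \o (fun y => 2 `^ p * (`|f y| `^ p + `|f x| `^ p))%R)).
  - exact: measurable_funTS.
  - move=> y _ /=; rewrite lee_fin [leLHS]ger0_norm ?powR_ge0//.
    rewrite [leRHS]ger0_norm ?mulr_ge0 ?addr_ge0 ?powR_ge0//.
    by rewrite -(normrN (f x)); apply: powR_add_le; lra.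
  - have := integrableZl mQ (2 `^ p) (integrableD mQ
      (integrableS measurableT mQ (@subsetT _ _) fi)
      (integrable_cst_lty (`|f x| `^ p) mQ Qoo)).
    by apply: eq_integrable.
have iL : mu.-integrable Q (EFin \o
    (fun y => `|a| `^ p + p * dpow p a * ((f x - f y) - a))%R).
  have := integrableD mQ (integrable_cst_lty (`|a| `^ p) mQ Qoo)
    (integrableZl mQ (p * dpow p a) (integrableB mQ iB (integrable_cst_lty a mQ Qoo))).
  by apply: eq_integrable.
have Eq : (q%:E * (`|a| `^ p)%:E)%E =
  \int[mu]_(y in Q) (`|a| `^ p + p * dpow p a * ((f x - f y) - a))%:E.
  rewrite -[RHS](fineK (integrable_fin_num mQ iL)) -EFinM; congr EFin.
  rewrite -[RHS]/(Rintegral mu Q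
    (fun y => `|a| `^ p + p * dpow p a * ((f x - f y) - a))%R).
  have ic c : mu.-integrable Q (EFin \o cst c) by exact: integrable_cst_lty.
  have iBa : mu.-integrable Q (EFin \o (fun y => f x - f y - a)%R).
    have := integrableB mQ iB (ic a).
    by apply: eq_integrable.
  have iZ : mu.-integrable Q (EFin \o (fun y => p * dpow p a * (f x - f y - a))%R).
    have := integrableZl mQ (p * dpow p a) iBa.
    by apply: eq_integrable.
  have Rc c : (\int[mu]_(y in Q) cst c y = c * q)%R.
    transitivity (c * fine (mu Q))%R; first exact: Rintegral_cst.
    by rewrite Qq.
  have RB : (\int[mu]_(y in Q) (f x - f y) = f x * q - q * m)%R.
    transitivity (\int[mu]_(y in Q) cst (f x) y - \int[mu]_(y in Q) f y)%R.
      exact: (RintegralB mQ (ic _) fQ).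
    by rewrite Rc /m mulrA divff ?gt_eqF// mul1r.
  have RBa : (\int[mu]_(y in Q) (f x - f y - a) = f x * q - q * m - a * q)%R.
    transitivity (\int[mu]_(y in Q) (f x - f y) - \int[mu]_(y in Q) cst a y)%R.
      exact: (RintegralB mQ iB (ic _)).
    by rewrite Rc RB.
  rewrite (RintegralD mQ (ic _) iZ) (RintegralZl _ mQ iBa) RBa Rc /a.
  by move: (`|f x - m| `^ p)%R => A; ring.
rewrite Eq; apply: le_integral => //.
by move=> y _; rewrite lee_fin -(distrC (f x) (f y)); exact: powR_tangent.
Qed.

Lemma powR_integral_le_mean p f Q (q : R) : (1 < p)%R -> (0 < q)%R ->
  measurable Q -> mu Q = q%:E -> Lpfun mu p f ->
  \int[mu]_(x in Q) (`|f x| `^ p)%:E <=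
  (2 `^ p)%:E * ((q^-1)%:E *
      \int[mu \x mu]_(z in Q `*` Q) (`|f z.2 - f z.1| `^ p)%:E +
    (q * `|q^-1 * \int[mu]_(y in Q) f y| `^ p)%:E).
Proof.
move=> p1 q0 mQ Qq fL; have [mf fi] := fL.
have := mean_oscillation p1 q0 mQ Qq fL.
set m := (q^-1 * _)%R => osc.
have mfm : measurable_fun setT (fun x => f x - m)%R by exact: measurable_funB.
apply: (@le_trans _ _ (\int[mu]_(x in Q)
    ((2 `^ p)%:E * ((`|f x - m| `^ p)%:E + (`|m| `^ p)%:E)))).
  apply: ge0_le_integral => //.
  - by apply: measurable_funTS; exact: measurable_EFin_powR.
  - apply: measurable_funTS; apply: measurable_funeM.
    by apply: emeasurable_funD => //; exact: measurable_EFin_powR.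
  - move=> x _; rewrite -EFinD -EFinM lee_fin.
    have := @powR_add_le _ p (f x - m) m; rewrite subrK; apply; lra.
rewrite ge0_integralZl//; first last.
- by move=> x _; apply: adde_ge0; rewrite lee_fin powR_ge0.
- apply: measurable_funTS.
  by apply: emeasurable_funD => //; exact: measurable_EFin_powR.
apply: lee_wpmul2l; first by rewrite lee_fin powR_ge0.
rewrite ge0_integralD//; last first.
  by apply: measurable_funTS; exact: measurable_EFin_powR.
apply: leeD; last first.
  have -> : \int[mu]_(x in Q) (`|m| `^ p)%:E = (`|m| `^ p)%:E * mu Q.
    exact: integral_cst.
  by rewrite Qq -EFinM mulrC.
by rewrite lee_pdivlMl.
Qed.

End oscillation.

(** * Grids of cubes *)

Section grid.
Context {R : realType} {N : nat}.
Implicit Types (x y a : 'rV[R]_N) (r M : R).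

Lemma box_enorm x y a r : 0 <= r -> box a r x -> box a r y ->
  enorm (y - x) <= N%:R * r.
Proof.
move=> r0 ax ay; apply: enorm_le => // i; rewrite !mxE.
have /andP[x1 x2] := ax i; have /andP[y1 y2] := ay i.
by rewrite ler_norml; lra.
Qed.

Lemma box_next_enorm x y a r (i0 : 'I_N) : 0 <= r -> box a r x ->
  box (a + r *: delta_mx ord0 i0) r y -> enorm (y - x) <= N%:R * (2 * r).
Proof.
move=> r0 ax ay; apply: enorm_le => [|i]; first by rewrite mulr_ge0.
rewrite !mxE; have /andP[x1 x2] := ax i; have := ay i; rewrite !mxE eqxx/=.
have : 0 <= r * (i == i0)%:R <= r by case: eqP => _; rewrite ?mulr1 ?mulr0 ?lexx ?r0.
move: (r * _) => t /andP[t0 tr] /andP[y1 y2].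
by rewrite ler_norml; lra.
Qed.

(** The lower corners of cubes of side [r] that tile a cube of side [K r]. *)
Definition corner (K : nat) M r (c : {ffun 'I_N -> 'I_K}) : 'rV[R]_N :=
  \row_i (- M + (c i)%:R * r).

Lemma grid_cover (K : nat) M r x : 0 < r -> 2 * M < K%:R * r ->
  (forall i, `|x ord0 i| <= M) -> exists c : {ffun 'I_N -> 'I_K},
  box (corner M r c) r x.
Proof.
move=> r0 KM xM.
have t0 i : 0 <= (x ord0 i + M) / r.
  by rewrite divr_ge0 ?(ltW r0)//; have := xM i; rewrite ler_norml; lra.
have tK i : (Num.truncn ((x ord0 i + M) / r) < K)%N.
  have /andP[h _] := truncn_itv (t0 i).
  rewrite -(ltr_nat R); apply: le_lt_trans h _.
  by rewrite ltr_pdivrMr//; have := xM i; rewrite ler_norml; lra.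
exists [ffun i => Ordinal (tK i)] => i; rewrite mxE ffunE/=.
have /andP[h1 h2] := truncn_itv (t0 i).
move: h1 h2; rewrite ler_pdivlMr// ltr_pdivrMr// -natr1 [in X in _ < X]mulrDl.
by rewrite mul1r => h1 h2; apply/andP; split; lra.
Qed.

Lemma grid_disjoint (K : nat) M r x (c c' : {ffun 'I_N -> 'I_K}) : 0 < r ->
  box (corner M r c) r x -> box (corner M r c') r x -> c = c'.
Proof.
move=> r0 cx cx'; apply/ffunP => i; apply/val_inj => /=.
have aux (m n : nat) : - M + m%:R * r <= x ord0 i < - M + m%:R * r + r ->
    - M + n%:R * r <= x ord0 i < - M + n%:R * r + r -> (m <= n)%N.
  move=> /andP[h1 _] /andP[_ h2]; rewrite -ltnS -(ltr_nat R) -(ltr_pM2r r0).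
  by rewrite -natr1 mulrDl mul1r; lra.
have := cx i; have := cx' i; rewrite !mxE => h1 h2.
by apply/eqP; rewrite eqn_leq !aux.
Qed.

End grid.

Section grid_integrals.
Context {R : realType} {N : nat}.
Local Notation E := 'rV[R]_N.
Local Notation leb := (lebesgue_rV N).
Local Notation P := (leb \x leb)%E.
Variables (K : nat) (M r : R).
Hypotheses (r0 : 0 < r) (KM : 2 * M < K%:R * r).
Local Notation Q := (fun c : {ffun 'I_N -> 'I_K} => box (corner M r c) r).
Local Open Scope ereal_scope.

Lemma integral_le_grid (f : E -> R) : measurable_fun setT f ->
  (forall x, 0 <= f x)%R -> (forall x, f x != 0 -> forall i, `|x ord0 i| <= M)%R ->
  \int[leb]_x (f x)%:E <= \sum_(c : {ffun 'I_N -> 'I_K}) \int[leb]_(x in Q c) (f x)%:E.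
Proof.
move=> mf f0 fM.
under eq_bigr do rewrite integral_mkcond.
have mfE : measurable_fun setT (fun x => (f x)%:E) by exact/measurable_EFinP.
have mfc c : measurable_fun setT ((fun x => (f x)%:E) \_ (Q c)).
  apply/measurable_restrict => //; first exact: measurable_box.
  by rewrite setTI; exact: measurable_funTS.
have fc0 c x : 0 <= ((fun x => (f x)%:E) \_ (Q c)) x.
  by rewrite patchE; case: ifP => // _; rewrite lee_fin.
rewrite -ge0_integral_sum//; apply: ge0_le_integral => //.
- by move=> x _; rewrite lee_fin.
- by apply: emeasurable_sum.
move=> x _; have [->|fx] := eqVneq (f x) 0%R; first exact: sume_ge0.
have [c xc] := grid_cover r0 KM (fM _ fx).
rewrite (bigD1 c)//= patchE mem_set//.
by rewrite leeDl// sume_ge0.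
Qed.

Lemma grid_pairs_le (A : E * E -> R) : measurable_fun setT A ->
  (forall z, 0 <= A z)%R ->
  \sum_(c : {ffun 'I_N -> 'I_K}) \int[P]_(z in Q c `*` Q c) (A z)%:E <=
  \int[P]_z (A z)%:E.
Proof.
move=> mA A0.
under eq_bigr do rewrite integral_mkcond.
have mAE : measurable_fun setT (fun x => (A x)%:E) by exact/measurable_EFinP.
have mAc c : measurable_fun setT ((fun x => (A x)%:E) \_ (Q c `*` Q c)).
  apply/measurable_restrict => //.
    by apply: measurableX; exact: measurable_box.
  by rewrite setTI; exact: measurable_funTS.
have Ac0 c x : 0 <= ((fun x => (A x)%:E) \_ (Q c `*` Q c)) x.
  by rewrite patchE; case: ifP => // _; rewrite lee_fin.
rewrite -ge0_integral_sum//; apply: ge0_le_integral => //.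
- by move=> x _; apply: sume_ge0.
- by apply: emeasurable_sum.
move=> z _; have [[c [z1 z2]]|nz] := pselect (exists c, (Q c `*` Q c) z).
  rewrite (bigD1 c)//= patchE mem_set//= big1 ?adde0// => c' c'c.
  rewrite patchE; case: ifPn => // /set_mem[z1' _].
  by rewrite (grid_disjoint r0 z1 z1') eqxx in c'c.
rewrite big1 ?lee_fin// => c _; rewrite patchE; case: ifPn => // /set_mem zc.
by exfalso; apply: nz; exists c.
Qed.

End grid_integrals.

Lemma ultra_bounded_cvg {R : realType} (U : set_system nat) (s : nat -> R) (B : R) :
  UltraFilter U -> (forall n, `|s n| <= B) -> exists l : R, s @ U --> l.
Proof.
move=> UU sB; have UF : ProperFilter U by exact: ultra_proper.
have FB : (s @ U) `[-B, B]%classic.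
  apply: (@filterS _ U _ setT) => [n _ /=|]; last exact: filterT.
  by rewrite /= in_itv/= -ler_norml.
have [l [_ cl]] := segment_compact (fmap_proper_filter s UF) FB.
exists l => V /= lV; have [//|nV] := in_ultra_setVsetC (s @^-1` V) UU.
have [x [/= nVx Vx]] := cl (~` V) V nV lV.
by [].
Qed.

(** * Poincare inequality and compactness *)

Section nonlocal_control.
Context {R : realType} {N : nat}.
Local Notation E := 'rV[R]_N.
Local Notation leb := (lebesgue_rV N).
Local Notation P := (leb \x leb)%E.
Variables (Omega : set E) (p sigma c delta : R).
Hypotheses (p1 : 1 < p) (c0 : 0 <= c) (delta0 : 0 < delta).

Let p_gt0 : 0 < p. Proof. exact: lt_trans p1. Qed.

Let p_neq0 : p != 0. Proof. by rewrite gt_eqF. Qed.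

(** What the lower bound on the kernel says of a function [w] that vanishes
    outside [Omega], with [sigma = N + s p] and [A] the energy density. This
    form of it is stable under differences, up to constants. *)
Definition nl_control (w : E -> R) (A : E * E -> R) :=
  [/\ measurable_fun setT w, forall x, ~ Omega x -> w x = 0,
    P.-integrable setT (EFin \o A), forall z, 0 <= A z &
    forall rho z, 0 < rho < delta -> enorm (z.2 - z.1) <= rho ->
      `|w z.2 - w z.1| `^ p <= c * rho `^ sigma * A z].

Lemma nl_control_sub w1 w2 A1 A2 : nl_control w1 A1 -> nl_control w2 A2 ->
  nl_control (fun x => w1 x - w2 x) (fun z => 2 `^ p * (A1 z + A2 z)).
Proof.
move=> [mw1 w10 iA1 A10 wA1] [mw2 w20 iA2 A20 wA2]; split.
- exact: measurable_funB.
- by move=> x nx; rewrite w10// w20// subr0.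
- by apply: integrableZ_EFin; exact: integrableD_EFin.
- by move=> z; rewrite mulr_ge0 ?powR_ge0 ?addr_ge0.
- move=> rho z rd zr; have := wA1 _ _ rd zr; have := wA2 _ _ rd zr.
  move=> h1 h2.
  have -> : w1 z.2 - w2 z.2 - (w1 z.1 - w2 z.1) =
    (w1 z.2 - w1 z.1) + - (w2 z.2 - w2 z.1) by lra.
  apply: le_trans (powR_add_le _ _ (ltW p_gt0)) _.
  rewrite normrN mulrCA ler_wpM2l ?powR_ge0// mulrDr.
  exact: lerD.
Qed.

Lemma nl_control_pairs (w : E -> R) A (Q1 Q2 : set E) (rho : R) :
  nl_control w A -> 0 < rho < delta -> measurable Q1 -> measurable Q2 ->
  (forall x y, Q1 x -> Q2 y -> enorm (y - x) <= rho) ->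
  (\int[P]_(z in Q1 `*` Q2) (`|w z.2 - w z.1| `^ p)%:E <=
   (c * rho `^ sigma)%:E * \int[P]_(z in Q1 `*` Q2) (A z)%:E)%E.
Proof.
move=> [mw w0 iA A0 wA] rd mQ1 mQ2 Qr.
have mQ : measurable (Q1 `*` Q2) by exact: measurableX.
have mA : measurable_fun (Q1 `*` Q2) (EFin \o A).
  by apply: measurable_funTS; exact: measurable_int iA.
have k0 : 0 <= c * rho `^ sigma by rewrite mulr_ge0 ?powR_ge0.
rewrite -ge0_integralZl//; last by move=> z _; rewrite lee_fin.
apply: ge0_le_integral => //.
- by apply: measurable_funTS; exact: measurable_powR_diff.
- exact: measurable_funeM.
- by move=> z [z1 z2]; rewrite -EFinM lee_fin; apply: wA => //; exact: Qr.
Qed.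

Section poincare.
Variables (i0 : 'I_N) (M r : R) (K : nat).
Hypotheses (r0 : 0 < r) (KM : 2 * M < K%:R * r).
Hypothesis OM : forall x, Omega x -> forall i, `|x ord0 i| <= M.
Let rho : R := N%:R * (2 * r).
Hypothesis rhod : 0 < rho < delta.

(* the constant reached after [m] steps of the walk *)
Let b m : R := iter m (fun t => 2 `^ p * (c * rho `^ sigma / r ^+ N + t)) 0.

(** Walk in the direction [i0], one cube at a time, until [Omega] has been left
    and [w] vanishes; each step back is a transfer between adjacent cubes. *)
Lemma poincare_chain w A (a : E) m : nl_control w A ->
  (forall x, box (a + (m%:R * r) *: delta_mx ord0 i0) r x -> ~ Omega x) ->
  (\int[leb]_(x in box a r) (`|w x| `^ p)%:E <=
    (b m * \int[P]_z A z)%:E)%E.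
Proof.
move=> wA; have [mw w0 iA A0 _] := wA; elim: m a => [|m IH] a aO.
  rewrite mul0r integral0_eq// => x ax.
  rewrite w0 ?normr0 ?powR0//.
  by apply: aO; rewrite mul0r scale0r addr0.
have q0 : 0 < r ^+ N by rewrite exprn_gt0.
pose a' := a + r *: delta_mx ord0 i0.
have {}IH : (\int[leb]_(x in box a' r) (`|w x| `^ p)%:E <=
    (b m * \int[P]_z A z)%:E)%E.
  apply: IH => x; rewrite /a' -addrA -scalerDl => ax; apply: aO.
  by have -> : m.+1%:R * r = r + m%:R * r by rewrite -natr1 mulrDl mul1r addrC.
have ma := measurable_box a r; have ma' := measurable_box a' r.
have := powR_integral_transfer leb (ltW p_gt0) ma ma' mw.
have mu_box (d : E) : lebesgue_rV N (box d r) = (r ^+ N)%:E.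
  by rewrite lebesgue_rV_box// ltW.
rewrite !mu_box => h.
rewrite -(@lee_pmul2l _ (r ^+ N)%:E)// ?lte_fin//.
apply: (le_trans h).
have k0 : 0 <= c * rho `^ sigma by rewrite mulr_ge0 ?powR_ge0.
have h1 : (\int[P]_(z in box a r `*` box a' r) (`|w z.2 - w z.1| `^ p)%:E <=
    (c * rho `^ sigma * \int[P]_z A z)%:E)%E.
  apply: le_trans (nl_control_pairs wA rhod ma ma' _) _.
    by move=> x y ax ay; apply: box_next_enorm ax ay; exact: ltW.
  rewrite [leRHS]EFinM; apply: lee_wpmul2l; first by rewrite lee_fin.
  rewrite EFin_Rintegral//; apply: ge0_subset_integral => //.
  - exact: measurableX.
  - exact: measurable_int iA.
  - by move=> z _; rewrite lee_fin.
have q0' : (0 <= (r ^+ N)%:E)%E by rewrite lee_fin ltW.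
apply: le_trans (lee_wpmul2l _ (leeD h1 (lee_wpmul2l q0' IH))) _.
  by rewrite lee_fin powR_ge0.
rewrite -[X in (_ * (_ + X))%E]EFinM -EFinD -!EFinM lee_fin.
rewrite le_eqVlt; apply/orP; left; apply/eqP; rewrite /= -/(b m).
move: (b m) (\int[P]_z _) => B V.
by field; rewrite gt_eqF.
Qed.

Lemma poincare_bound w A : nl_control w A -> Lpfun leb p w /\
  Lpint leb p w <= #|{ffun 'I_N -> 'I_K}|%:R * b K * \int[P]_z A z.
Proof.
move=> wA; have [mw w0 iA A0 _] := wA; apply: Lpfun_bound => //.
apply: le_trans (integral_le_grid r0 KM _ _ _) _.
- exact: measurable_powR_normr.
- by move=> x; exact: powR_ge0.
- move=> x wx i; apply: OM; apply: contrapT => nO.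
  by move: wx; rewrite w0// normr0 powR0 ?eqxx.
apply: (@le_trans _ _ (\sum_(d : {ffun 'I_N -> 'I_K}) (b K * \int[P]_z A z)%:E)%E).
  apply: lee_sum => d _; apply: poincare_chain => // x xd /OM /(_ i0).
  have := xd i0; rewrite !mxE !eqxx mulr1.
  have : 0 <= (d i0)%:R * r by rewrite mulr_ge0 ?(ltW r0).
  move: (_%:R * r) (K%:R * r) KM => t Kr KM' t0 /andP[h _].
  by rewrite ler_norml; lra.
by rewrite sumEFin lee_fin sumr_const -[leLHS]mulr_natl mulrA.
Qed.

End poincare.

(** [Omega] is bounded, so the walks out of it have a bounded number of steps. *)
Lemma poincare (i0 : 'I_N) (M : R) :
  (forall x, Omega x -> forall i, `|x ord0 i| <= M) ->
  exists2 C, 0 <= C & forall w A, nl_control w A ->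
    Lpfun leb p w /\ Lpint leb p w <= C * \int[P]_z A z.
Proof.
move=> OM; have N0 : 0 < N%:R :> R by rewrite ltr0n (leq_trans _ (ltn_ord i0)).
(* two adjacent cubes must lie within distance [delta] *)
pose r := delta / (4 * N%:R).
have r0 : 0 < r by rewrite divr_gt0// mulr_gt0.
have rd : 0 < N%:R * (2 * r) < delta.
  have -> : N%:R * (2 * r) = delta / 2 by rewrite /r; field; rewrite gt_eqF.
  by rewrite divr_gt0//= ltr_pdivrMr// ltr_pMr// ltr1n.
pose K := (Num.truncn (`|2 * M / r|)).+1.
have KM : 2 * M < K%:R * r.
  rewrite -ltr_pdivrMr//; apply: le_lt_trans (ler_norm _) _.
  by have /andP[] := truncn_itv (normr_ge0 (2 * M / r)).
exists (#|{ffun 'I_N -> 'I_K}|%:R * iter K (fun t =>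
    2 `^ p * (c * (N%:R * (2 * r)) `^ sigma / r ^+ N + t)) 0).
  rewrite mulr_ge0//; elim: K {KM} => //= m IH.
  rewrite mulr_ge0 ?powR_ge0// addr_ge0//.
  by rewrite divr_ge0 ?exprn_ge0 ?(ltW r0)// mulr_ge0 ?powR_ge0.
by move=> w A wA; exact: (poincare_bound i0 r0 KM OM rd wA).
Qed.

(** On each cube [w] is its mean up to its oscillation. As the products of a cube
    with itself are disjoint, all oscillations together are at most a
    constant times [r^(sigma - N)] times the integral of [A]. *)
Lemma grid_estimate (M r : R) (K : nat) w A : (0 < N)%N ->
  0 < r -> 2 * M < K%:R * r -> N%:R * r < delta ->
  (forall x, Omega x -> forall i, `|x ord0 i| <= M) ->
  nl_control w A -> Lpfun leb p w ->
  Lpint leb p w <= 2 `^ p * (c * (N%:R * r) `^ sigma / r ^+ N * \int[P]_z A z +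
    \sum_(d : {ffun 'I_N -> 'I_K}) r ^+ N *
      `|(r ^+ N)^-1 * \int[leb]_(x in box (corner M r d) r) w x| `^ p).
Proof.
move=> N0 r0 KM Nrd OM wA wL; have [mw w0 iA A0 _] := wA.
have q0 : 0 < r ^+ N by rewrite exprn_gt0.
have rd : 0 < N%:R * r < delta by rewrite Nrd mulr_gt0// ltr0n.
rewrite -lee_fin EFin_Lpint//.
apply: le_trans (integral_le_grid r0 KM _ _ _) _.
- exact: measurable_powR_normr.
- by move=> x; exact: powR_ge0.
- move=> x wx i; apply: OM; apply: contrapT => nO.
  by move: wx; rewrite w0// normr0 powR0 ?eqxx.
pose k := c * (N%:R * r) `^ sigma.
have k0 : 0 <= k by rewrite mulr_ge0 ?powR_ge0.
pose Q (d : {ffun 'I_N -> 'I_K}) := box (corner M r d) r.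
have mQ (d : {ffun 'I_N -> 'I_K}) : measurable (Q d) by exact: measurable_box.
have AQ0 (d : {ffun 'I_N -> 'I_K}) : (0 <= \int[P]_(z in Q d `*` Q d) (A z)%:E)%E.
  by apply: integral_ge0 => z _; rewrite lee_fin.
apply: (@le_trans _ _ (\sum_(d : {ffun 'I_N -> 'I_K}) (2 `^ p)%:E *
    ((k / r ^+ N)%:E * \int[P]_(z in Q d `*` Q d) (A z)%:E +
     (r ^+ N * `|(r ^+ N)^-1 * \int[leb]_(x in Q d) w x| `^ p)%:E))%E).
  apply: lee_sum => d _.
  apply: le_trans (powR_integral_le_mean p1 q0 (mQ d) _ wL) _.
    exact: lebesgue_rV_box (ltW r0).
  apply: lee_wpmul2l; first by rewrite lee_fin powR_ge0.
  rewrite leeD2r// mulrC EFinM -muleA; apply: lee_wpmul2l.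
    by rewrite lee_fin invr_ge0 ltW.
  apply: nl_control_pairs => // x y Qx Qy.
  by apply: box_enorm Qx Qy; exact: ltW.
rewrite -ge0_sume_distrr; last first.
  move=> d _; apply: adde_ge0.
    by rewrite mule_ge0// lee_fin divr_ge0// ltW.
  by rewrite lee_fin mulr_ge0 ?powR_ge0// ltW.
rewrite [leRHS]EFinM; apply: lee_wpmul2l; first by rewrite lee_fin powR_ge0.
rewrite big_split/= EFinD; apply: leeD; last by rewrite sumEFin.
rewrite -ge0_sume_distrr// [leRHS]EFinM; apply: lee_wpmul2l.
  by rewrite lee_fin divr_ge0// ltW.
rewrite EFin_Rintegral//; apply: grid_pairs_le => //.
by apply/measurable_EFinP; exact: measurable_int iA.
Qed.

(** Since [sigma > N], a fine grid makes the oscillations small, uniformly in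
    [n]. The finitely many means over its cubes converge along an ultrafilter, so
    the sequence is Cauchy along it. *)
Lemma rellich (i0 : 'I_N) (M V : R) (w : nat -> E -> R) (A : nat -> E * E -> R) :
  N%:R < sigma ->
  (forall x, Omega x -> forall i, `|x ord0 i| <= M) ->
  (forall n, nl_control (w n) (A n)) -> (forall n, \int[P]_z A n z <= V) ->
  exists (k : nat -> nat) (w0 : E -> R), [/\ forall n, (n <= k n)%N,
    Lpfun leb p w0, {ae leb, forall x, w (k n) x @[n --> \oo] --> w0 x} &
    Lpint leb p (fun x => w (k n) x - w0 x) @[n --> \oo] --> 0].
Proof.
move=> Nsigma OM wA AV.
have NN : (0 < N)%N by exact: leq_trans (ltn_ord i0).
have N0 : 0 < N%:R :> R by rewrite ltr0n.
have [C C0 CP] := poincare i0 OM.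
have wL n : Lpfun leb p (w n) by have [] := CP _ _ (wA n).
have V0 : 0 <= V.
  by apply: le_trans (AV 0%N); apply: Rintegral_ge0 => z _; case: (wA 0%N).
have wV n : Lpint leb p (w n) <= C * V.
  by have [_ /le_trans] := CP _ _ (wA n); apply; rewrite ler_wpM2l.
have [U [UU oU]] := ultraFilterLemma eventually_filter.
have UF : ProperFilter U by exact: ultra_proper.
have [k [g [kn gL kg Lg]]] : exists (k : nat -> nat) (g : E -> R),
    [/\ forall n, (n <= k n)%N, Lpfun leb p g,
    {ae leb, forall x, w (k n) x @[n --> \oo] --> g x} &
    Lpint leb p (fun x => w (k n) x - g x) @[n --> \oo] --> 0]; last by exists k, g.
apply: (@Lp_Cauchy_filter _ _ _ leb p _ U w (fun n m => (n <= m)%N)) => //.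
  by move=> n; apply: oU; exists n.
move=> eps eps0.
have W0 : 0 < (2 : R) `^ p by rewrite powR_gt0.
(* [eta] and [tau] make the oscillations and the means contribute [eps / 2] each *)
pose D := c * N%:R `^ sigma * (2 `^ p * (V + V)).
have D0 : 0 <= D.
  by rewrite mulr_ge0 ?mulr_ge0 ?powR_ge0 ?addr_ge0.
pose eta := eps / (2 * 2 `^ p * (D + 1)).
have eta0 : 0 < eta by rewrite divr_gt0// mulr_gt0 ?mulr_gt0//; lra.
have sN : 0 < sigma - N%:R by rewrite subr_gt0.
pose r := Num.min (eta `^ (sigma - N%:R)^-1) (delta / (2 * N%:R)).
have r0 : 0 < r by rewrite lt_min powR_gt0//= divr_gt0// mulr_gt0.
have rd : N%:R * r < delta.
  apply: (@le_lt_trans _ _ (N%:R * (delta / (2 * N%:R)))).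
    by rewrite ler_pM2l// ge_min lexx orbT.
  have -> : N%:R * (delta / (2 * N%:R)) = delta / 2 by field; rewrite gt_eqF.
  by rewrite ltr_pdivrMr// ltr_pMr// ltr1n.
have reta : (N%:R * r) `^ sigma / r ^+ N <= N%:R `^ sigma * eta.
  rewrite powRM ?(ltW r0) ?(ltW N0)// -mulrA ler_wpM2l ?powR_ge0//.
  rewrite -powR_mulrn ?(ltW r0)// -powRB; last by rewrite gt_eqF ?implybT.
  apply: (@le_trans _ _ ((eta `^ (sigma - N%:R)^-1) `^ (sigma - N%:R))).
    by apply: le_powR; rewrite ?(ltW sN) ?(ltW r0)// ge_min lexx.
  by rewrite -powRrM mulVf ?gt_eqF// powRr1// ltW.
pose K := (Num.truncn (`|2 * M / r|)).+1.
have KM : 2 * M < K%:R * r.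
  rewrite -ltr_pdivrMr//; apply: le_lt_trans (ler_norm _) _.
  by have /andP[] := truncn_itv (normr_ge0 (2 * M / r)).
pose Q (d : {ffun 'I_N -> 'I_K}) := box (corner M r d) r.
have mQ d : measurable (Q d) by exact: measurable_box.
have q0 : 0 < r ^+ N by rewrite exprn_gt0.
have Qq d : leb (Q d) = (r ^+ N)%:E by exact: lebesgue_rV_box (ltW r0).
have Qoo d : (leb (Q d) < +oo)%E by rewrite Qq ltry.
pose s d n : R := \int[leb]_(x in Q d) w n x.
have wQ d n := Lpfun_integrable (ltW p1) (mQ d) (Qoo d) (wL n).
have sB d n : `|s d n| <= r ^+ N + C * V.
  have [_] := wQ d n; rewrite -/(s d n) Qq -EFinD lee_fin => /le_trans; apply.
  by rewrite lerD2l.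
have /choice[l lP] d : exists l : R, s d @ U --> l.
  exact: ultra_bounded_cvg (sB d).
pose m := #|{ffun 'I_N -> 'I_K}|%:R * r ^+ N.
have m0 : 0 <= m by rewrite mulr_ge0// ltW.
pose tau := eps / (2 * 2 `^ p * (m + 1)).
have tau0 : 0 < tau by rewrite divr_gt0// mulr_gt0 ?mulr_gt0//; lra.
pose eta1 := r ^+ N * tau `^ p^-1 / 2.
have eta10 : 0 < eta1 by rewrite divr_gt0// mulr_gt0// powR_gt0.
have Ul : \forall n \near U, forall d, `|l d - s d n| < eta1.
  by apply: filter_forall => d; exact: (cvgr_dist_lt _ _ (lP d)).
exists [set n | forall d, `|l d - s d n| < eta1] => // i j /= Ui Uj.
have ijA := nl_control_sub (wA i) (wA j).
have ijL := LpfunB (ltW p_gt0) (wL i) (wL j).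
apply: le_trans (grid_estimate NN r0 KM rd OM ijA ijL) _.
have iAi n : P.-integrable setT (EFin \o A n) by case: (wA n).
have h1 : c * (N%:R * r) `^ sigma / r ^+ N *
    \int[P]_z (2 `^ p * (A i z + A j z)) <= eps / (2 * 2 `^ p).
  rewrite RintegralZl//; last exact: integrableD_EFin.
  rewrite RintegralD//.
  apply: (@le_trans _ _ (c * (N%:R `^ sigma * eta) * (2 `^ p * (V + V)))).
    rewrite -[c * _ / _]mulrA; apply: ler_pM.
    - by rewrite mulr_ge0// divr_ge0 ?powR_ge0// ltW.
    - rewrite mulr_ge0 ?powR_ge0// addr_ge0//; apply: Rintegral_ge0 => z _.
        by case: (wA i).
      by case: (wA j).
    - exact: ler_wpM2l.
    - by rewrite ler_wpM2l ?powR_ge0// lerD.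
  have -> : c * (N%:R `^ sigma * eta) * (2 `^ p * (V + V)) = D * eta.
    by rewrite /D; ring.
  rewrite /eta; apply: (@le_trans _ _ ((D + 1) * (eps / (2 * 2 `^ p * (D + 1))))).
    by rewrite ler_wpM2r ?lerDl// ltW.
  rewrite le_eqVlt; apply/orP; left; apply/eqP; field.
  by rewrite (gt_eqF W0)/= gt_eqF//; lra.
have h2 : \sum_(d : {ffun 'I_N -> 'I_K}) r ^+ N *
    `|(r ^+ N)^-1 * \int[leb]_(x in Q d) (w i x - w j x)| `^ p <= eps / (2 * 2 `^ p).
  apply: (@le_trans _ _ (\sum_(d : {ffun 'I_N -> 'I_K}) r ^+ N * tau)).
    apply: ler_sum => d _; rewrite ler_pM2l//.
    rewrite RintegralB//; [|by case: (wQ d i)|by case: (wQ d j)].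
    have -> : tau = (tau `^ p^-1) `^ p.
      by rewrite -powRrM mulVf// powRr1// ltW.
    apply: le_powR => //; first exact: ltW.
    rewrite normrM gtr0_norm ?invr_gt0// ler_pdivrMl//.
    have -> : r ^+ N * tau `^ p^-1 = eta1 + eta1 by rewrite /eta1; field.
    have -> : \int[leb]_(x in Q d) w i x - \int[leb]_(x in Q d) w j x =
      (l d - s d j) - (l d - s d i) by rewrite /s; ring.
    by apply: le_trans (ler_normB _ _) _; apply: lerD; exact: ltW.
  rewrite sumr_const -[leLHS]mulr_natl mulrA -/m.
  apply: (@le_trans _ _ ((m + 1) * tau)).
    by rewrite ler_wpM2r ?lerDl// ltW.
  rewrite /tau le_eqVlt; apply/orP; left; apply/eqP; field.
  by rewrite (gt_eqF W0)/= gt_eqF//; lra.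
apply: le_trans (ler_wpM2l (ltW W0) (lerD h1 h2)) _.
rewrite le_eqVlt; apply/orP; left; apply/eqP; field.
by rewrite gt_eqF.
Qed.

End nonlocal_control.

(** * The energy form as a p-th power *)

Section weighted_difference.
Context {R : realType} {N : nat}.
Local Notation E := 'rV[R]_N.
Local Notation leb := (lebesgue_rV N).
Local Notation P := (leb \x leb)%E.
Variables (p : R) (k : R -> R) (D : set E).
Hypotheses (p1 : 1 < p) (mD : measurable D).
Hypothesis mk : measurable_fun setT (fun z : E => k (enorm z)).
Hypothesis k0 : forall r, 0 <= r -> 0 <= k r.
Implicit Types (eta u w : E -> R) (z : E * E).

Let p_gt0 : 0 < p. Proof. exact: lt_trans p1. Qed.

Let p_neq0 : p != 0. Proof. by rewrite gt_eqF. Qed.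

Definition avg eta z := (eta z.2 + eta z.1) / 2.

(** The increment of [u] with the p-th root of the weight of the form, so that
    [|wdiff eta u|^p] is the integrand of [B_eta(u, u)] on [D * D] while
    [wdiff eta u] is linear in [u]. *)
Definition wdiff eta u z :=
  \1_(D `*` D) z * ((avg eta z * k (enorm (z.2 - z.1))) `^ p^-1 /
    enorm (z.2 - z.1)) * ((u \_ D) z.2 - (u \_ D) z.1).

Lemma measurable_fun_ext u : measurable_fun D u -> measurable_fun setT (u \_ D).
Proof. by move=> mu; apply/measurable_restrict => //; rewrite setTI. Qed.

Lemma measurable_sub_rV : measurable_fun setT (fun z : E * E => z.2 - z.1).
Proof.
apply: measurable_fun_rV => i; under eq_fun do rewrite !mxE.
apply: measurable_funB.
  exact: (measurableT_comp (measurable_coord i) measurable_snd).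
exact: (measurableT_comp (measurable_coord i) measurable_fst).
Qed.

Lemma measurable_avg eta : measurable_fun setT eta -> measurable_fun setT (avg eta).
Proof.
move=> me; apply: measurable_funM => //.
by apply: measurable_funD; apply: measurableT_comp.
Qed.

Lemma measurable_enorm_powR (a : R) :
  measurable_fun setT (fun z : E * E => enorm (z.2 - z.1) `^ a).
Proof.
apply: (measurableT_comp (measurable_powR a)).
exact: (measurableT_comp measurable_enorm measurable_sub_rV).
Qed.

Lemma measurable_ext_diff u : measurable_fun D u ->
  measurable_fun setT (fun z => (u \_ D) z.2 - (u \_ D) z.1).
Proof.
move=> /measurable_fun_ext mu.
by apply: measurable_funB; apply: measurableT_comp.
Qed.

Lemma measurable_wdiff eta u : measurable_fun setT eta -> measurable_fun D u ->
  measurable_fun setT (wdiff eta u).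
Proof.
move=> me mu; apply: measurable_funM; last exact: measurable_ext_diff.
apply: measurable_funM.
  by apply: measurable_indic; exact: measurableX.
apply: measurable_funM.
  apply: (measurableT_comp (measurable_powR _)); apply: measurable_funM.
    exact: measurable_avg.
  exact: (measurableT_comp mk measurable_sub_rV).
rewrite (_ : (fun z => _) = (fun z => enorm (z.2 - z.1) `^ (-1))).
  exact: measurable_enorm_powR.
by apply/funext => z; rewrite powR_inv1// enorm_ge0.
Qed.

Lemma wdiffD eta u w z :
  wdiff eta (fun x => u x + w x) z = wdiff eta u z + wdiff eta w z.
Proof.
rewrite /wdiff -mulrDr; congr (_ * _).
by rewrite !patchE; case: ifP => _; case: ifP => _; rewrite /point/=; ring.
Qed.

Lemma wdiffZ (c : R) eta u z : wdiff eta (fun x => c * u x) z = c * wdiff eta u z.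
Proof.
rewrite /wdiff [RHS]mulrCA; congr (_ * _).
by rewrite !patchE; case: ifP => _; case: ifP => _; rewrite /point/=; ring.
Qed.

Lemma wdiff_out eta u z : ~ (D `*` D) z -> wdiff eta u z = 0.
Proof. by move=> nz; rewrite /wdiff indicE memNset// !mul0r. Qed.

(** The three factors contribute the powers [p - 2], [1] and [1] of the root of
    the weight, hence the weight. On the diagonal both sides are [0]. *)
Lemma dpow_wdiff eta u w z : 0 <= avg eta z -> (D `*` D) z ->
  dpow p (wdiff eta u z) * wdiff eta w z =
  avg eta z * k (enorm (z.2 - z.1)) *
  (`|u z.2 - u z.1| `^ (p - 2) * (u z.2 - u z.1) / enorm (z.2 - z.1) `^ p) *
  (w z.2 - w z.1).
Proof.
move=> eta0 zD; have [z1 z2] := zD.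
rewrite /wdiff indicE mem_set// mul1r !patchE !mem_set//.
set e := enorm _; have e0 : 0 <= e by exact: enorm_ge0.
have ek0 : 0 <= avg eta z * k e by rewrite mulr_ge0// k0.
set t := (_ `^ p^-1 / e).
have t0 : 0 <= t by rewrite divr_ge0// powR_ge0.
have tp : t `^ p = avg eta z * k e / e `^ p.
  rewrite /t powRM ?powR_ge0 ?invr_ge0// -powRrM mulVf// powRr1//.
  by rewrite -(powR_inv1 e0) powRAC powR_inv1 ?powR_ge0.
have tE : t `^ (p - 2) * t * t = t `^ p.
  rewrite -mulrA -expr2 -powR_mulrn// -powRD ?subrK//.
  by rewrite (negbTE p_neq0).
rewrite /dpow normrM (ger0_norm t0) powRM//.
transitivity ((t `^ (p - 2) * t * t) *
  (`|u z.2 - u z.1| `^ (p - 2) * (u z.2 - u z.1)) * (w z.2 - w z.1)); first ring.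
by rewrite tE tp; ring.
Qed.

Lemma powR_wdiff eta u z : 0 <= avg eta z ->
  `|wdiff eta u z| `^ p = avg eta z * `|wdiff (cst 1) u z| `^ p.
Proof.
move=> eta0; have [zD|zD] := pselect ((D `*` D) z); last first.
  by rewrite !wdiff_out// normr0 powR0// mulr0.
have a1 : avg (cst 1) z = 1 by rewrite /avg/=; field.
rewrite -!dpowE// !dpow_wdiff// ?a1//.
by rewrite mul1r !mulrA.
Qed.

Lemma integral_out (F : E * E -> R) : (forall z, ~ (D `*` D) z -> F z = 0) ->
  (\int[P]_(z in D `*` D) (F z)%:E = \int[P]_z (F z)%:E)%E.
Proof.
move=> F0; rewrite integral_mkcond; apply: eq_integral => z _.
by rewrite patchE; case: ifPn => // /negP nz; rewrite F0// => /mem_set.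
Qed.

Lemma B1E u : measurable_fun D u ->
  B1 p k D u u = (\int[P]_z (`|wdiff (cst 1) u z| `^ p)%:E)%E.
Proof.
move=> mu; have mw : measurable_fun setT (wdiff (cst 1) u).
  by apply: measurable_wdiff => //; exact: measurable_cst.
have mwp := measurable_EFin_powR p mw.
rewrite -integral_out; last first.
  by move=> z nz; rewrite wdiff_out// normr0 powR0.
rewrite -(ge0_integral_setX leb leb mD mD mwp); last first.
  by move=> z; rewrite lee_fin powR_ge0.
rewrite /B1 /nlform; apply: eq_integral => x /set_mem Dx.
apply: eq_integral => y /set_mem Dy.
have a1 : avg (cst 1) (x, y) = 1 by rewrite /avg/=; field.
rewrite -(dpowE (wdiff (cst 1) u (x, y)) p1) dpow_wdiff ?a1//.
Qed.

(** Fubini's theorem needs an integrand that is measurable on all pairs: [F]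
    below, which is the integrand of the form on [D * D] and agrees almost
    everywhere with the right-hand side. *)
Lemma Beta_wdiff eta eta' u w : measurable_fun setT eta ->
  (forall x, 0 <= eta x) -> measurable_fun D eta' ->
  {ae leb, forall x, D x -> eta' x = eta x} ->
  measurable_fun D u -> measurable_fun D w ->
  Lpfun P p (wdiff eta u) -> Lpfun P p (wdiff eta w) ->
  Beta p k D eta' u w = (\int[P]_z (dpow p (wdiff eta u z) * wdiff eta w z))%:E.
Proof.
move=> me eta0 me' ee mu mw uL wL.
have avg0 z : 0 <= avg eta z by rewrite divr_ge0// addr_ge0.
have iG : P.-integrable setT (EFin \o (fun z => dpow p (wdiff eta u z) * wdiff eta w z)).
  have z01 : 0 <= (0 : R) <= 1 by rewrite lexx ler01.
  have := integrable_dpow p1 z01 uL wL.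
  by apply: eq_integrable => // z _ /=; rewrite mul0r addr0.
pose du z := (u \_ D) z.2 - (u \_ D) z.1.
pose F z : R := \1_(D `*` D) z * (avg (eta' \_ D) z * k (enorm (z.2 - z.1)) *
  (`|du z| `^ (p - 2) * du z * enorm (z.2 - z.1) `^ (- p)) *
  ((w \_ D) z.2 - (w \_ D) z.1)).
have mF : measurable_fun setT F.
  apply: measurable_funM; first by apply: measurable_indic; exact: measurableX.
  apply: measurable_funM; last exact: measurable_ext_diff.
  apply: measurable_funM.
    apply: measurable_funM; last exact: (measurableT_comp mk measurable_sub_rV).
    exact: measurable_avg (measurable_fun_ext me').
  apply: measurable_funM; last exact: measurable_enorm_powR.
  apply: measurable_funM; last exact: measurable_ext_diff.
  by apply: measurable_powR_normr; exact: measurable_ext_diff.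
have Fin x y : D x -> D y -> F (x, y) = (eta' y + eta' x) / 2 * k (enorm (y - x)) *
    (`|u y - u x| `^ (p - 2) * (u y - u x) / enorm (y - x) `^ p) * (w y - w x).
  move=> Dx Dy; rewrite /F /du /avg indicE mem_set// mul1r/= !patchE !mem_set//.
  by rewrite powRN.
have Fout z : ~ (D `*` D) z -> F z = 0.
  by move=> nz; rewrite /F indicE memNset// mul0r.
have FG : {ae P, forall z, (F z)%:E = (dpow p (wdiff eta u z) * wdiff eta w z)%:E}.
  have e1 := ae_fst leb ee; have e2 := ae_snd leb ee.
  apply: filterS2 e1 e2 => -[x y] /= e1 e2; congr EFin.
  have [[Dx Dy]|nz] := pselect ((D `*` D) (x, y)); last first.
    by rewrite Fout// !wdiff_out// mulr0.
  by rewrite Fin// e1// e2// dpow_wdiff.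
have mFE : measurable_fun setT (EFin \o F) by exact/measurable_EFinP.
have mGE := measurable_int _ iG.
have iF : P.-integrable setT (EFin \o F).
  apply/integrableP; split => //.
  have /integrableP[_] := iG; apply: le_lt_trans.
  rewrite le_eqVlt; apply/orP; left; apply/eqP; apply: ae_eq_integral => //.
  - exact: measurableT_comp.
  - exact: measurableT_comp.
  - by apply: filterS FG => z Fz _; congr (`|_|)%E; exact: Fz.
rewrite EFin_Rintegral//.
transitivity (\int[P]_z (F z)%:E)%E; last first.
  apply: ae_eq_integral => //.
  by apply: filterS FG => z Fz _; exact: Fz.
refine (etrans _ (integral12_prod_meas1 iF)).
rewrite /Beta /nlform [LHS]integral_mkcond.
apply: eq_integral => x _; rewrite patchE /fubini_F; case: ifPn => [/set_mem Dx|/negP nx].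
  rewrite [LHS]integral_mkcond; apply: eq_integral => y _.
  rewrite patchE; case: ifPn => [/set_mem Dy|/negP ny]; first by rewrite /= Fin.
  by rewrite /= Fout// => -[_ /mem_set].
rewrite integral0_eq// => y _ /=; rewrite Fout// => -[/mem_set].
by [].
Qed.

End weighted_difference.

Lemma Lfun_Lpfun d (T : measurableType d) (R : realType)
    (mu : {measure set T -> \bar R}) (p : R) (f : T -> R) : 0 < p ->
  f \in Lfun mu p%:E <-> Lpfun mu p f.
Proof.
move=> p0; have p0' : p != 0 by rewrite gt_eqF.
have NE : ('N[mu]_p%:E[EFin \o f] `^ p = \int[mu]_x (`|f x| `^ p)%:E)%E.
  by rewrite powR_Lnorm.
split.
  move=> /[!inE] /andP[]; rewrite !inE/= => mf; rewrite /finite_norm => fN.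
  by apply: LpfunP => //; rewrite -NE poweR_lty.
move=> fL; have [mf _] := fL; rewrite inE; apply/andP; split; rewrite inE//=.
rewrite /finite_norm ltey; apply/eqP => Noo.
by have := EFin_Lpint fL; rewrite -NE Noo/= (negbTE p0').
Qed.

Section ae_equal.
Context d (T : measurableType d) (R : realType).
Variable mu : {measure set T -> \bar R}.
Implicit Types (f g : T -> R) (p : R).

Lemma Lpfun_ae p f g : measurable_fun setT g -> {ae mu, forall x, f x = g x} ->
  Lpfun mu p f -> Lpfun mu p g /\ Lpint mu p g = Lpint mu p f.
Proof.
move=> mg fg fL; have [mf _] := fL.
have E : (\int[mu]_x (`|f x| `^ p)%:E = \int[mu]_x (`|g x| `^ p)%:E)%E.
  apply: ae_eq_integral => //.
  - by apply/measurable_EFinP; exact: measurable_powR_normr.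
  - by apply/measurable_EFinP; exact: measurable_powR_normr.
  - by apply: filterS fg => x -> _.
have gL : Lpfun mu p g by apply: LpfunP => //; rewrite -E -EFin_Lpint// ltry.
by split; [exact: gL|rewrite /Lpint /Rintegral E].
Qed.

Lemma Lpfun0 p : p != 0 -> Lpfun mu p (cst 0).
Proof.
move=> p0; split; first exact: measurable_cst.
rewrite (_ : _ \o _ = cst 0%E); first exact: integrable0.
by apply/funext => x; rewrite /= normr0 powR0.
Qed.

Lemma ae_eq0_Lpint p f : Lpfun mu p f -> Lpint mu p f <= 0 ->
  {ae mu, forall x, f x = 0}.
Proof.
move=> fL f0; have [mf fi] := fL.
have : (\int[mu]_x `|(`|f x| `^ p)%:E| = 0)%E.
  under eq_integral do rewrite gee0_abs ?lee_fin ?powR_ge0//.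
  rewrite -EFin_Lpint//; congr EFin; apply/eqP.
  by rewrite eq_le f0 Lpint_ge0.
move/(ae_eq_integral_abs mu measurableT (measurable_int _ fi)).
by apply: filterS => x /(_ I) [] /eqP; rewrite powR_eq0 normr_eq0 => /andP[/eqP].
Qed.

End ae_equal.

Section clamp.
Context {R : realType} {N : nat}.
Implicit Types (Omega D : set 'rV[R]_N) (h : 'rV[R]_N -> R).

(** A representative that satisfies everywhere the bounds that a coefficient
    satisfies almost everywhere. *)
Definition clamp Omega (hmin hmax : R) h : 'rV[R]_N -> R :=
  (fun x => Num.min hmax (Num.max hmin (h x))) \_ Omega.

Lemma clampP Omega D (hmin hmax : R) h : measurable Omega ->
  measurable D -> Omega `<=` D -> 0 < hmin -> hmin < hmax -> coefficients Omega D hmin hmax h ->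
  [/\ measurable_fun setT (clamp Omega hmin hmax h),
    forall x, 0 <= clamp Omega hmin hmax h x <= hmax,
    forall x, Omega x -> hmin <= clamp Omega hmin hmax h x &
    {ae lebesgue_rV N, forall x, D x -> h x = clamp Omega hmin hmax h x}].
Proof.
move=> mO mD OD h0 hh [mh hO hD].
have cin x : Omega x -> clamp Omega hmin hmax h x = Num.min hmax (Num.max hmin (h x)).
  by move=> Ox; rewrite /clamp patchE mem_set.
have cout x : ~ Omega x -> clamp Omega hmin hmax h x = 0.
  by move=> Ox; rewrite /clamp patchE memNset.
split.
- apply/measurable_restrict => //; rewrite setTI.
  apply: measurable_minr => //; apply: measurable_maxr => //.
  exact: measurable_funS mD OD mh.
- move=> x; have [Ox|nOx] := pselect (Omega x); last first.
    by rewrite cout// lexx; lra.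
  rewrite cin// ge_min lexx andbT le_min le_max.
  by apply/andP; split; [lra|apply/orP; left; lra].
- by move=> x Ox; rewrite cin// le_min le_max lexx/= andbT ltW.
- apply: filterS2 hO hD => x hO hD Dx.
  have [Ox|nOx] := pselect (Omega x); last by rewrite cout// hD.
  have /andP[h1 h2] := hO Ox.
  by rewrite cin// (max_idPr h1) (min_idPr h2).
Qed.

End clamp.

Lemma enorm_eq0 {R : realType} {N : nat} (v : 'rV[R]_N) : enorm v = 0 -> v = 0.
Proof.
move=> /eqP; rewrite sqrtr_eq0 => v0.
have v2 i : 0 <= v ord0 i ^+ 2 by exact: sqr_ge0.
apply/rowP => i; rewrite mxE; apply/eqP; rewrite -sqrf_eq0.
have : \sum_i v ord0 i ^+ 2 == 0 by rewrite eq_le v0 sumr_ge0.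
by rewrite psumr_eq0// => /allP/(_ i (mem_index_enum _)).
Qed.

(** * States and optimal controls *)

Section nonlocal_space.
Context {R : realType} {N : nat}.
Local Notation E := 'rV[R]_N.
Local Notation leb := (lebesgue_rV N).
Local Notation P := (leb \x leb)%E.
Variables (Omega : set E) (delta p s : R) (k : R -> R) (c0 : R) (hmin hmax : R).
Hypotheses (Omega_open : open Omega) (Omega_bounded : bounded_set Omega).
Hypotheses (delta_gt0 : 0 < delta) (p1 : 1 < p) (s_gt0 : 0 < s).
Hypothesis N_gt_ps : p * s < N%:R.
Hypothesis mk : measurable_fun setT (fun z : E => k (enorm z)).
Hypothesis k0 : forall r, 0 <= r -> 0 <= k r.
Hypothesis c0_gt0 : 0 < c0.
Hypothesis k_lower :
  forall r, 0 < r < delta -> c0 / r `^ (N%:R + (s - 1) * p) <= k r.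
Hypotheses (hmin_gt0 : 0 < hmin) (hmin_lt_hmax : hmin < hmax).
Implicit Types (u v w g h : E -> R).

Let D := delta_nbhd Omega delta.

Let p_gt0 : 0 < p. Proof. exact: lt_trans p1. Qed.

Let p_neq0 : p != 0. Proof. by rewrite gt_eqF. Qed.

Let OD : Omega `<=` D. Proof. by move=> x Ox; left. Qed.

Let mO : measurable Omega. Proof. exact: open_measurable_rV. Qed.

Let mD : measurable D.
Proof. by apply: open_measurable_rV; exact: open_delta_nbhd. Qed.

Notation wd := (wdiff p k D).
Notation energy eta u := (Lpint P p (wd eta u)).

(** The representatives of the elements of [X_0] that vanish at every point
    outside [Omega]. *)
Definition X0fun w := [/\ Lpfun leb p w, forall x, ~ Omega x -> w x = 0 &
  Lpfun P p (wd (cst 1) w)].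

Definition weight (eta : E -> R) := measurable_fun setT eta /\
  ((forall x, 0 <= eta x <= hmax) /\ forall x, Omega x -> hmin <= eta x).

Let avg_ge0 eta z : weight eta -> 0 <= avg eta z.
Proof.
move=> [_ [e0 _]]; have /andP[e1 _] := e0 z.1; have /andP[e2 _] := e0 z.2.
by rewrite divr_ge0// addr_ge0.
Qed.

Let avg_le eta z : weight eta -> avg eta z <= hmax.
Proof.
move=> [_ [e0 _]]; have /andP[_ e1] := e0 z.1; have /andP[_ e2] := e0 z.2.
by rewrite /avg ler_pdivrMr//; lra.
Qed.

Lemma Lpfun_wdiff eta u : weight eta -> measurable_fun D u ->
  Lpfun P p (wd (cst 1) u) -> Lpfun P p (wd eta u).
Proof.
move=> we mu [_ iu]; apply: (@Lpfun_le _ _ _ _ _ _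
    (fun z => hmax * `|wd (cst 1) u z| `^ p)).
- by apply: measurable_wdiff => //; case: we.
- exact: integrableZ_EFin.
- move=> z; rewrite (powR_wdiff D p1 k0 u (avg_ge0 z we)).
  by rewrite ler_wpM2r ?powR_ge0// avg_le.
Qed.

(** Coercivity, although the coefficient vanishes outside [Omega]: a non-zero
    increment of [w] has an end in [Omega], where the coefficient is at least
    [hmin]. *)
Lemma wdiff1_le eta w z : weight eta -> (forall x, ~ Omega x -> w x = 0) ->
  `|wd (cst 1) w z| `^ p <= 2 / hmin * `|wd eta w z| `^ p.
Proof.
move=> we w0; have a0 := avg_ge0 z we; have [_ [e0 eO]] := we.
have [zO|zO] := pselect (Omega z.1 \/ Omega z.2); last first.
  have -> : wd (cst 1) w z = 0.
    have wD x : ~ Omega x -> (w \_ D) x = 0.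
      by move=> /w0 wx; rewrite patchE wx; case: ifP.
    rewrite /wdiff !wD ?subrr ?mulr0// => zO'; apply: zO; [left|right];
    exact: zO'.
  by rewrite normr0 powR0// mulr_ge0 ?powR_ge0// divr_ge0// ltW.
rewrite (powR_wdiff D p1 k0 w a0) mulrA ler_peMl ?powR_ge0//.
have /andP[e1 _] := e0 z.1; have /andP[e2 _] := e0 z.2.
have h2 : hmin <= eta z.2 + eta z.1.
  by case: zO => /eO; lra.
have -> : 2 / hmin * avg eta z = (eta z.2 + eta z.1) / hmin.
  by rewrite /avg; field; rewrite gt_eqF.
by rewrite ler_pdivlMr// mul1r.
Qed.

(** [|w y - w x|^p] is the energy density divided by [k(e) / e^p], with [e] the
    distance, and the lower bound on the kernel makes it at most the density times
    [e^(N + s p) / c0]. *)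
Lemma X0fun_control w : X0fun w ->
  nl_control Omega p (N%:R + s * p) c0^-1 delta w
    (fun z => `|wd (cst 1) w z| `^ p).
Proof.
move=> [[mw _] w0 [_ iw]]; split; [exact: mw|exact: w0|exact: iw| |].
  by move=> z; exact: powR_ge0.
move=> rho z /andP[rho0 rhod] zr.
set e := enorm (z.2 - z.1) in zr.
have R0 : 0 <= c0^-1 * rho `^ (N%:R + s * p) * `|wd (cst 1) w z| `^ p.
  by rewrite !mulr_ge0 ?powR_ge0// invr_ge0 ltW.
have [ze|ze] := eqVneq e 0.
  have : z.2 - z.1 = 0 by exact: enorm_eq0.
  by move/eqP; rewrite subr_eq0 => /eqP ->; rewrite subrr normr0 powR0.
have e0 : 0 < e by rewrite lt0r ze enorm_ge0.
have ed : e < delta by exact: le_lt_trans zr rhod.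
have [zO|zO] := pselect (Omega z.1 \/ Omega z.2); last first.
  rewrite !w0; [by rewrite subrr normr0 powR0|..].
    by move=> z1; apply: zO; left.
  by move=> z2; apply: zO; right.
have zD : (D `*` D) z.
  case: zO => zO; split; [exact: OD| |..|exact: OD].
    exact: delta_nbhd_eball zO _.
  apply: delta_nbhd_eball zO _ => //.
  by rewrite -opprB -scaleN1r enormZ normrN1 mul1r.
have a1 : avg (cst 1) z = 1 by rewrite /avg/=; field.
rewrite -(dpowE (wd _ _ _) p1) dpow_wdiff ?a1// mul1r.
rewrite -/e; set dw := w z.2 - w z.1.
have -> : k e * (`|dw| `^ (p - 2) * dw / e `^ p) * dw = k e * (`|dw| `^ p / e `^ p).
  by rewrite -(dpowE dw p1) /dpow; ring.
have ke : c0 / e `^ (N%:R + (s - 1) * p) <= k e by apply: k_lower; rewrite e0.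
have ep : 0 < e `^ p by rewrite powR_gt0.
apply: (@le_trans _ _ (c0^-1 * rho `^ (N%:R + s * p) *
    (c0 / e `^ (N%:R + (s - 1) * p) * (`|dw| `^ p / e `^ p)))); last first.
  apply: ler_wpM2l; first by rewrite mulr_ge0 ?powR_ge0// invr_ge0 ltW.
  by apply: ler_wpM2r ke; rewrite divr_ge0 ?powR_ge0.
have eE : e `^ (N%:R + (s - 1) * p) * e `^ p = e `^ (N%:R + s * p).
  by rewrite -powRD; [congr (_ `^ _); ring|rewrite (negbTE ze) implybT].
have es : 0 < e `^ (N%:R + s * p) by rewrite powR_gt0.
have -> : c0^-1 * rho `^ (N%:R + s * p) *
    (c0 / e `^ (N%:R + (s - 1) * p) * (`|dw| `^ p / e `^ p)) =
    (rho `^ (N%:R + s * p) / e `^ (N%:R + s * p)) * `|dw| `^ p.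
  rewrite -eE; field; rewrite !gt_eqF// ?powR_gt0//.
rewrite ler_peMl ?powR_ge0// ler_pdivlMr// mul1r.
apply: le_powR; [|exact: ltW|exact: zr].
by rewrite addr_ge0// mulr_ge0// ltW.
Qed.

Lemma measurable_Lpfun w : Lpfun leb p w -> measurable_fun D w.
Proof. by move=> [mw _]; exact: measurable_funTS. Qed.

Lemma wdiff_sub eta u v z : wd eta (fun x => u x - v x) z = wd eta u z - wd eta v z.
Proof.
rewrite -[wd eta v z]mul1r -mulNr -wdiffZ -wdiffD.
by congr (wdiff _ _ _ _ _ z); apply/funext => x; rewrite mulN1r.
Qed.

Lemma X0fun_lin (c : R) w v : X0fun w -> X0fun v -> X0fun (fun x => w x + c * v x).
Proof.
move=> [wL w0 wE] [vL v0 vE]; split.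
- by apply: LpfunD => //; [exact: ltW|exact: LpfunZ].
- by move=> x nx; rewrite w0// v0// mulr0 addr0.
- have := LpfunD (ltW p_gt0) wE (LpfunZ c vE).
  by congr (Lpfun _ _ _); apply/funext => z; rewrite wdiffD wdiffZ.
Qed.

Lemma X0fun_sub w v : X0fun w -> X0fun v -> X0fun (fun x => w x - v x).
Proof.
move=> wZ vZ; have := X0fun_lin (-1) wZ vZ.
by congr X0fun; apply/funext => x; rewrite mulN1r.
Qed.

Lemma X0fun_mid w v : X0fun w -> X0fun v -> X0fun (fun x => (w x + v x) / 2).
Proof.
move=> wZ vZ; have := X0fun_lin (2^-1) wZ (X0fun_sub vZ wZ).
by congr X0fun; apply/funext => x; field.
Qed.

Let i0 : 'I_N.
Proof.
by apply: (@Ordinal N 0); rewrite -(ltr0n R); apply: lt_trans N_gt_ps; exact: mulr_gt0.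
Qed.

Let Omega_bound : exists M : R, forall x, Omega x -> forall i, `|x ord0 i| <= M.
Proof.
have [M [_ OM]] := Omega_bounded; exists (M + 1) => x Ox i.
have : `|x| <= M + 1 by apply: OM => //; rewrite ltrDl.
apply: le_trans; rewrite [leRHS]/Num.Def.normr/= mx_normrE.
by apply: (le_bigmax _ (fun ij => `|x ij.1 ij.2|) (ord0, i)).
Qed.

Lemma X0fun_poincare : exists2 C, 0 <= C & forall w, X0fun w ->
  Lpint leb p w <= C * energy (cst 1) w.
Proof.
have [M OM] := Omega_bound.
have c00 : 0 <= c0^-1 by rewrite invr_ge0 ltW.
have [C C0 CP] := poincare (N%:R + s * p) p1 c00 delta_gt0 i0 OM.
by exists C => // w /X0fun_control /CP[].
Qed.

Lemma wdiff_cvg eta (u : nat -> E -> R) v :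
  {ae leb, forall x, u n x @[n --> \oo] --> v x} ->
  {ae P, forall z, wd eta (u n) z @[n --> \oo] --> wd eta v z}.
Proof.
move=> uv; have uv1 := ae_fst leb uv; have uv2 := ae_snd leb uv.
apply: filterS2 uv1 uv2 => -[x y] /= ux uy.
have ext (t : E) : u n t @[n --> \oo] --> v t ->
    (u n \_ D) t @[n --> \oo] --> (v \_ D) t.
  move=> ut; rewrite patchE; under eq_fun do rewrite patchE.
  by case: ifP => // _; exact: cvg_cst.
rewrite /wdiff; apply: cvgM; first exact: cvg_cst.
by apply: cvgB; exact: ext.
Qed.

Variable u0 : E -> R.
Hypotheses (mu0 : measurable_fun D u0) (eu0 : Lpfun P p (wd (cst 1) u0)).

Let plus_u0 w : E -> R := fun x => u0 x + w x.

Lemma measurable_plus_u0 w : X0fun w -> measurable_fun D (plus_u0 w).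
Proof.
by move=> [/measurable_Lpfun mw _ _]; exact: measurable_funD.
Qed.

Lemma Lpfun_wdiff_plus_u0 eta w : weight eta -> X0fun w -> Lpfun P p (wd eta (plus_u0 w)).
Proof.
move=> we wZ; apply: Lpfun_wdiff => //; first exact: measurable_plus_u0.
have [_ _ wE] := wZ; have := LpfunD (ltW p_gt0) eu0 wE.
by congr (Lpfun _ _ _); apply/funext => z; rewrite wdiffD.
Qed.

Lemma Lpfun_wdiff_X0fun eta w : weight eta -> X0fun w -> Lpfun P p (wd eta w).
Proof.
move=> we [wL w0 wE]; apply: Lpfun_wdiff => //.
exact: measurable_Lpfun wL.
Qed.

Lemma X0fun_energy_le eta w (M : R) : weight eta -> X0fun w ->
  energy eta (plus_u0 w) <= M ->
  energy (cst 1) w <= 2 / hmin * (2 `^ p * (M + energy eta u0)).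
Proof.
move=> we wZ eM; have [wL w0 wE] := wZ; have weL := Lpfun_wdiff_X0fun we wZ.
have hh : 0 <= 2 / hmin by rewrite divr_ge0// ltW.
have u0L : Lpfun P p (wd eta u0) by exact: Lpfun_wdiff.
apply: (@le_trans _ _ (2 / hmin * energy eta w)).
  rewrite /Lpint -RintegralZl//; last by case: weL.
  apply: le_Rintegral => //; [by case: wE|by apply: integrableZ_EFin; case: weL|].
  by move=> z _; exact: wdiff1_le.
apply: ler_wpM2l => //.
have sL := Lpfun_wdiff_plus_u0 we wZ.
apply: (@le_trans _ _ (2 `^ p * (energy eta (plus_u0 w) + energy eta u0))).
  have wE' : (fun z => wd eta (plus_u0 w) z - wd eta u0 z) = wd eta w.
    by apply/funext => z; rewrite wdiffD addrC addKr.
  by have := Lpint_sub_le (ltW p_gt0) sL u0L; rewrite wE'.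
by rewrite ler_wpM2l ?powR_ge0// lerD2r.
Qed.

(** The limit given by [rellich] vanishes almost everywhere outside [Omega] and
    is modified there; its energy is finite by Fatou's lemma. *)
Lemma X0fun_compact eta (w : nat -> E -> R) (M : R) : weight eta ->
  (forall n, X0fun (w n)) -> (forall n, energy eta (plus_u0 (w n)) <= M) ->
  exists (j : nat -> nat) v, [/\ forall n, (n <= j n)%N, X0fun v,
    {ae leb, forall x, w (j n) x @[n --> \oo] --> v x} &
    Lpint leb p (fun x => w (j n) x - v x) @[n --> \oo] --> 0].
Proof.
move=> we wZ wM; have [B OB] := Omega_bound.
have c00 : 0 <= c0^-1 by rewrite invr_ge0 ltW.
have Ns : N%:R < N%:R + s * p by rewrite ltrDl mulr_gt0.
have eM n := X0fun_energy_le we (wZ n) (wM n).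
have [j [v' [nj v'L wv' Lv']]] := rellich p1 c00 delta_gt0 i0 Ns OB
  (fun n => X0fun_control (wZ n)) eM.
pose v := v' \_ Omega.
have [mv' _] := v'L.
have mv : measurable_fun setT v.
  by apply/measurable_restrict => //; rewrite setTI; exact: measurable_funTS.
have vv' : {ae leb, forall x, v' x = v x}.
  apply: filterS wv' => x wx; rewrite /v patchE; case: ifPn => // /negP nO.
  have : (fun n => w (j n) x) = cst 0.
    by apply/funext => n; have [_ -> //] := wZ (j n); move=> Ox; apply: nO; exact: mem_set.
  by move=> E0; move: wx; rewrite E0 => /(cvg_lim _) <-//; rewrite lim_cst.
have [vL _] := Lpfun_ae mv vv' v'L.
have wv : {ae leb, forall x, w (j n) x @[n --> \oo] --> v x}.
  by apply: filterS2 wv' vv' => x wx <-.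
have v0 x : ~ Omega x -> v x = 0 by move=> Ox; rewrite /v patchE memNset.
exists j, v; split; [exact: nj| |exact: wv|].
- split; [exact: vL|exact: v0|].
  have mwv : measurable_fun setT (wd (cst 1) v).
    by apply: measurable_wdiff => //; exact: measurable_Lpfun vL.
  have [] // := @Lpfun_bound _ _ _ P p (wd (cst 1) v)
    (2 / hmin * (2 `^ p * (M + energy eta u0))) mwv _.
  apply: (@fatou_ae _ _ _ P (fun n z => `|wd (cst 1) (w (j n)) z| `^ p)).
  + by move=> n; apply: measurable_powR_normr; have [_ _ []] := wZ (j n).
  + exact: measurable_powR_normr.
  + by move=> n z; exact: powR_ge0.
  + apply: filterS (wdiff_cvg (cst 1) wv) => z wz.
    apply: (@continuous_cvg _ _ _ _ _ _ (fun y : R => `|y| `^ p)) => //.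
    exact: continuous_powR_normr.
  + by apply: nearW => n; rewrite -EFin_Lpint ?lee_fin//; have [] := wZ (j n).
- suff -> : (fun n => Lpint leb p (fun x => w (j n) x - v x)) =
    (fun n => Lpint leb p (fun x => w (j n) x - v' x)) by [].
  apply/funext => n; have [wL _ _] := wZ (j n).
  have [mw _] := wL.
  apply: (Lpfun_ae _ _ _).2; first exact: measurable_funB.
    by apply: filterS vv' => x ->.
  by apply: LpfunB => //; exact: ltW.
Qed.

Lemma energy_lsc eta (w : nat -> E -> R) v (r : R) : weight eta ->
  (forall n, X0fun (w n)) -> X0fun v ->
  {ae leb, forall x, w n x @[n --> \oo] --> v x} ->
  r < energy eta (plus_u0 v) -> \forall n \near \oo, r < energy eta (plus_u0 (w n)).
Proof.
move=> we wZ vZ wv rv; have mst u : X0fun u -> measurable_fun setT (wd eta (plus_u0 u)).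
  by move=> /(Lpfun_wdiff_plus_u0 we)[].
have : \forall n \near \oo, (r%:E < \int[P]_z (`|wd eta (plus_u0 (w n)) z| `^ p)%:E)%E.
  apply: (@fatou_ae_near _ _ _ P _ (fun z => `|wd eta (plus_u0 v) z| `^ p)).
  - by move=> n; apply: measurable_powR_normr; exact: mst.
  - by apply: measurable_powR_normr; exact: mst.
  - by move=> n z; exact: powR_ge0.
  - have wv' : {ae leb, forall x, plus_u0 (w n) x @[n --> \oo] --> plus_u0 v x}.
      by apply: filterS wv => x wx; apply: cvgD => //; exact: cvg_cst.
    apply: filterS (wdiff_cvg eta wv') => z wz.
    apply: (@continuous_cvg _ _ _ _ _ _ (fun y : R => `|y| `^ p)) => //.
    exact: continuous_powR_normr.
  - by rewrite -EFin_Lpint ?lte_fin//; exact: Lpfun_wdiff_plus_u0.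
by apply: filterS => n; rewrite -EFin_Lpint ?lte_fin//; exact: Lpfun_wdiff_plus_u0.
Qed.

Notation q := (p / (p - 1)).

Definition pairing g w : R := \int[leb]_x (g x * w x).

Lemma pairing_lin g w v (c : R) : Lpfun leb q g -> X0fun w -> X0fun v ->
  pairing g (fun x => w x + c * v x) = pairing g w + c * pairing g v.
Proof.
move=> gL [wL _ _] [vL _ _].
have iw := Lpfun_mul p1 gL wL; have iv := Lpfun_mul p1 gL vL.
rewrite /pairing -RintegralZl// -RintegralD//; last exact: integrableZ_EFin.
by apply: eq_Rintegral => x _; rewrite mulrDr mulrCA.
Qed.

Lemma pairing_sub g w v : Lpfun leb q g -> X0fun w -> X0fun v ->
  pairing g (fun x => w x - v x) = pairing g w - pairing g v.
Proof.
move=> gL wZ vZ; rewrite -[pairing g v]mul1r -mulNr -pairing_lin//.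
by congr pairing; apply/funext => x; rewrite mulN1r.
Qed.

(** The state equation as a minimum principle: [w] minimizes
    [energy eta (u0 + v) / p - pairing g v]. Semicontinuity of the energy is
    enough to pass to the limit in this form. *)
Definition minimizer eta g w := X0fun w /\ forall v, X0fun v ->
  energy eta (plus_u0 w) / p <= energy eta (plus_u0 v) / p + pairing g (fun x => w x - v x).

Lemma wdiff_plus_u0_lin eta w v (t : R) :
  wd eta (plus_u0 (fun x => w x + t * v x)) =
  (fun z => wd eta (plus_u0 w) z + t * wd eta v z).
Proof.
apply/funext => z; rewrite -wdiffZ -wdiffD.
by congr (wdiff _ _ _ _ _ z); apply/funext => x; rewrite /plus_u0 addrA.
Qed.

(** Comparing two minimizers with their midpoint, uniform convexity makes the
    energy of their difference vanish, and the Poincare inequality concludes. *)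
Lemma minimizer_unique eta g w v : weight eta -> Lpfun leb q g ->
  minimizer eta g w -> minimizer eta g v -> {ae leb, forall x, w x = v x}.
Proof.
have arith (a b x y m : R) : x / p <= m / p + (a - (a + b) / 2) ->
    y / p <= m / p + (b - (a + b) / 2) -> (x + y) / 2 - m <= 0.
  move=> h1 h2; have h3 : (x + y) / p <= (m + m) / p by rewrite !mulrDl; lra.
  by move: h3; rewrite ler_pM2r ?invr_gt0//; lra.
move=> we gL [wZ wm] [vZ vm].
have mZ := X0fun_mid wZ vZ; have dZ := X0fun_sub wZ vZ.
have wm' := wm _ mZ; have vm' := vm _ mZ.
have mP : pairing g (fun x => (w x + v x) / 2) = (pairing g w + pairing g v) / 2.
  have -> : (fun x => (w x + v x) / 2) = (fun x => w x + 2^-1 * (v x - w x)).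
    by apply/funext => x; field.
  rewrite pairing_lin//; last exact: X0fun_sub.
  by rewrite pairing_sub//; field.
move: wm' vm'; rewrite !pairing_sub// mP.
set em := energy eta (plus_u0 (fun x => (w x + v x) / 2)).
have wL := Lpfun_wdiff_plus_u0 we wZ; have vL := Lpfun_wdiff_plus_u0 we vZ.
set ew := energy eta (plus_u0 w); set ev := energy eta (plus_u0 v).
move=> h1 h2; have h3 : (ew + ev) / 2 - em <= 0 by exact: arith h1 h2.
have ew0 : 0 <= ew by exact: Lpint_ge0.
have ev0 : 0 <= ev by exact: Lpint_ge0.
have dle (eps : R) : 0 < eps -> energy eta (fun x => w x - v x) <= eps * (ew + ev).
  move=> eps0; have [C C0 uC] := Lpint_uniform_convex P p1 eps0.
  have mE : (fun z => (wd eta (plus_u0 w) z + wd eta (plus_u0 v) z) / 2) =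
      wd eta (plus_u0 (fun x => (w x + v x) / 2)).
    apply/funext => z; rewrite mulrC -wdiffD -wdiffZ.
    by congr (wdiff _ _ _ _ _ z); apply/funext => x; rewrite /plus_u0; field.
  have dE : (fun z => wd eta (plus_u0 w) z - wd eta (plus_u0 v) z) =
      wd eta (fun x => w x - v x).
    apply/funext => z; rewrite -wdiff_sub.
    by congr (wdiff _ _ _ _ _ z); apply/funext => x; rewrite /plus_u0; ring.
  have := uC _ _ wL vL; rewrite mE dE => /le_trans; apply.
  by rewrite -[leRHS]addr0 lerD2l mulr_ge0_le0.
have d0 : energy eta (fun x => w x - v x) <= 0.
  apply/ler_addgt0Pl => e e0; rewrite addr0.
  have s0 : 0 < ew + ev + 1 by lra.
  apply: le_trans (dle (e / (ew + ev + 1)) _) _; first exact: divr_gt0.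
  rewrite -mulrA ler_piMr ?(ltW e0)// mulrC ler_pdivrMr// mul1r.
  by rewrite lerDl.
have [C C0 CP] := X0fun_poincare.
have dL := Lpfun_wdiff_X0fun we dZ; have [dLp d_0 dE] := dZ.
have hh : 0 <= 2 / hmin by rewrite divr_ge0// ltW.
have d1 : energy (cst 1) (fun x => w x - v x) <= 0.
  apply: (@le_trans _ _ (2 / hmin * energy eta (fun x => w x - v x))).
    rewrite /Lpint -RintegralZl//; last by case: dL.
    apply: le_Rintegral => //; [by case: dE|by apply: integrableZ_EFin; case: dL|].
    by move=> z _; exact: wdiff1_le.
  exact: mulr_ge0_le0.
have d2 : Lpint leb p (fun x => w x - v x) <= 0.
  by apply: le_trans (CP _ dZ) _; exact: mulr_ge0_le0.
apply: filterS (ae_eq0_Lpint dLp d2) => x /eqP.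
by rewrite subr_eq0 => /eqP.
Qed.

Lemma XspaceP u : Xspace p k D u <->
  Lpfun leb p (u \_ D) /\ Lpfun P p (wd (cst 1) u).
Proof.
have Lm : Lpfun leb p (u \_ D) -> measurable_fun D u.
  by move=> [/(measurable_restrict _ mD measurableT)]; rewrite setTI.
have mw : measurable_fun D u -> measurable_fun setT (wd (cst 1) u).
  by move=> mu; apply: measurable_wdiff.
split=> [[/(Lfun_Lpfun _ _ p_gt0) uL uB]|[uL uE]].
  split => //; apply: LpfunP; first by apply: mw; exact: Lm.
  by move: uB; rewrite (B1E p1 mD mk k0 (Lm uL)).
split; first exact/(Lfun_Lpfun _ _ p_gt0).
by rewrite (B1E p1 mD mk k0 (Lm uL)) -EFin_Lpint// ltry.
Qed.

Lemma wdiff_ae eta u v : {ae leb, forall x, D x -> u x = v x} ->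
  {ae P, forall z, wd eta u z = wd eta v z}.
Proof.
move=> uv; apply: filterS2 (ae_fst leb uv) (ae_snd leb uv) => -[x y] /= ux uy.
have ext (t : E) : (D t -> u t = v t) -> (u \_ D) t = (v \_ D) t.
  by move=> ut; rewrite !patchE; case: ifP => // /set_mem.
by rewrite /wdiff (ext _ ux) (ext _ uy).
Qed.

Lemma X0fun_X0space w : X0fun w -> X0space p k Omega D w.
Proof.
move=> [wL w0 wE]; split.
  apply/XspaceP; split => //; suff -> : w \_ D = w by [].
  apply/funext => x; rewrite patchE; case: ifPn => // /negP nD.
  by rewrite w0// => /OD Dx; apply: nD; exact: mem_set.
by apply: aeW => x [_ nO]; exact: w0.
Qed.

Lemma X0space_X0fun w : X0space p k Omega D w ->
  X0fun (w \_ Omega) /\ {ae leb, forall x, D x -> w x = (w \_ Omega) x}.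
Proof.
move=> [/XspaceP[wL wE] w0].
have ww : {ae leb, forall x, D x -> w x = (w \_ Omega) x}.
  apply: filterS w0 => x w0 Dx; rewrite patchE; case: ifPn => // /negP nO.
  by rewrite w0//; split => // Ox; apply: nO; exact: mem_set.
have mw : measurable_fun D w.
  by case: wL => /(measurable_restrict _ mD measurableT); rewrite setTI.
have mwO : measurable_fun setT (w \_ Omega).
  by apply/measurable_restrict => //; rewrite setTI; exact: measurable_funS mD OD mw.
split => //; split.
- apply: (Lpfun_ae mwO _ wL).1; apply: filterS ww => x ww.
  rewrite patchE; case: ifPn => [/set_mem/ww//|/negP nD].
  rewrite patchE; case: ifPn => // /set_mem/OD Dx.
  by exfalso; apply: nD; exact: mem_set.
- by move=> x nO; rewrite patchE memNset.
- apply: (Lpfun_ae _ _ wE).1; last exact: wdiff_ae.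
  by apply: measurable_wdiff => //; exact: measurable_funTS.
Qed.

Lemma integral_pairing g w : Lpfun leb q (g \_ Omega) ->
  X0space p k Omega D w ->
  (\int[leb]_(x in Omega) (g x * w x)%:E)%E =
  (pairing (g \_ Omega) (w \_ Omega))%:E.
Proof.
move=> gL /X0space_X0fun[[wL _ _] _]; rewrite /pairing EFin_Rintegral; last exact: Lpfun_mul gL wL.
rewrite [LHS]integral_mkcond; apply: eq_integral => x _.
by rewrite !patchE; case: ifP => // _; rewrite mulr0.
Qed.

Lemma clamp_weight h : coefficients Omega D hmin hmax h ->
  weight (clamp Omega hmin hmax h) /\
  {ae leb, forall x, D x -> h x = clamp Omega hmin hmax h x}.
Proof.
by move=> /(clampP mO mD OD hmin_gt0 hmin_lt_hmax)[].
Qed.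

Lemma Xspace_measurable u : Xspace p k D u -> measurable_fun D u.
Proof.
by move=> /XspaceP[[/(measurable_restrict _ mD measurableT)]]; rewrite setTI.
Qed.

Lemma Lpfun_wdiff_Xspace eta u : weight eta -> Xspace p k D u -> Lpfun P p (wd eta u).
Proof.
move=> we uX; have /XspaceP[_ uE] := uX.
exact: Lpfun_wdiff we (Xspace_measurable uX) uE.
Qed.

Lemma Beta_energy h u w : coefficients Omega D hmin hmax h ->
  Xspace p k D u -> Xspace p k D w ->
  Beta p k D h u w =
  (\int[P]_z (dpow p (wd (clamp Omega hmin hmax h) u z) *
              wd (clamp Omega hmin hmax h) w z))%:E.
Proof.
move=> hc uX wX; have [we he] := clamp_weight hc.
have [me [e0 _]] := we; have [mh _ _] := hc.
apply: (Beta_wdiff p1 mD mk k0 me _ mh he (Xspace_measurable uX)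
  (Xspace_measurable wX)).
- by move=> x; have /andP[] := e0 x.
- exact: Lpfun_wdiff_Xspace.
- exact: Lpfun_wdiff_Xspace.
Qed.

Lemma Beta_diag h u : coefficients Omega D hmin hmax h -> Xspace p k D u ->
  Beta p k D h u u = (energy (clamp Omega hmin hmax h) u)%:E.
Proof.
move=> hc uX; rewrite Beta_energy//; congr EFin.
by apply: eq_Rintegral => z _; rewrite dpowE.
Qed.

Lemma energy_ae eta u v : weight eta -> Xspace p k D u -> Xspace p k D v ->
  {ae leb, forall x, D x -> u x = v x} -> energy eta u = energy eta v.
Proof.
move=> we uX vX uv; apply/esym.
have [mv _] := Lpfun_wdiff_Xspace we vX.
exact: (Lpfun_ae mv (wdiff_ae eta uv) (Lpfun_wdiff_Xspace we uX)).2.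
Qed.

Variable h : E -> R.
Hypothesis h_coef : coefficients Omega D hmin hmax h.
Let eta := clamp Omega hmin hmax h.
Let we : weight eta := (clamp_weight h_coef).1.

Lemma Xspace_add u v : Xspace p k D u -> Xspace p k D v ->
  Xspace p k D (fun x => u x + v x).
Proof.
move=> /XspaceP[uL uE] /XspaceP[vL vE]; apply/XspaceP; split.
  have -> : (fun x => u x + v x) \_ D = (fun x => (u \_ D) x + (v \_ D) x).
    by apply/funext => x; rewrite !patchE; case: ifP => // _; rewrite addr0.
  by apply: LpfunD => //; exact: ltW.
have -> : wd (cst 1) (fun x => u x + v x) =
    (fun z => wd (cst 1) u z + wd (cst 1) v z).
  by apply/funext => z; rewrite wdiffD.
by apply: LpfunD => //; exact: ltW.
Qed.

Hypothesis u0X : Xspace p k D u0.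

Lemma Xspace_plus_u0 w : X0fun w -> Xspace p k D (plus_u0 w).
Proof. by move=> /X0fun_X0space[wX _]; exact: Xspace_add. Qed.

Lemma Rintegral_dpow_ae u u' w w' :
  {ae P, forall z, wd eta u z = wd eta u' z} ->
  {ae P, forall z, wd eta w z = wd eta w' z} ->
  Lpfun P p (wd eta u) -> Lpfun P p (wd eta w) ->
  Lpfun P p (wd eta u') -> Lpfun P p (wd eta w') ->
  \int[P]_z (dpow p (wd eta u z) * wd eta w z) =
  \int[P]_z (dpow p (wd eta u' z) * wd eta w' z).
Proof.
have z01 : 0 <= (0 : R) <= 1 by rewrite lexx ler01.
have mI (f g : E * E -> R) : Lpfun P p f -> Lpfun P p g ->
    measurable_fun setT (fun z => (dpow p (f z) * g z)%:E).
  move=> fL gL; have := measurable_int _ (integrable_dpow p1 z01 fL gL).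
  by congr measurable_fun; apply/funext => z /=; rewrite mul0r addr0.
move=> uu ww uL wL uL' wL'; rewrite /Rintegral; congr fine.
apply: ae_eq_integral; [exact: measurableT|exact: mI|exact: mI|].
by apply: filterS2 uu ww => z -> ->.
Qed.

(** The tangent inequality for the energy at [u] in the direction [v - w], whose
    linear term is the state equation tested with [v - w]. *)
Lemma weak_solution_minimizer g u : Lpfun leb q (g \_ Omega) ->
  weak_solution p k Omega D h u0 g u ->
  [/\ minimizer eta (g \_ Omega) ((u \- u0) \_ Omega), Xspace p k D u &
  {ae leb, forall x, D x -> u x = plus_u0 ((u \- u0) \_ Omega) x}].
Proof.
have arith (a b x y : R) : a + (y - x) <= b -> a <= b + (x - y) by lra.
move=> gL [uX0 uw]; have [wZ ww] := X0space_X0fun uX0.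
set w := _ \_ Omega in wZ ww *.
have uX : Xspace p k D u.
  have := Xspace_add u0X uX0.1; congr Xspace.
  by apply/funext => x /=; rewrite addrC subrK.
have ust : {ae leb, forall x, D x -> u x = plus_u0 w x}.
  by apply: filterS ww => x wx Dx; rewrite /plus_u0 -(wx Dx) /= addrC subrK.
split => //; split => // v vZ.
have dZ := X0fun_sub vZ wZ.
have eq1 : \int[P]_z (dpow p (wd eta (plus_u0 w) z) * wd eta (fun x => v x - w x) z) =
    pairing (g \_ Omega) (fun x => v x - w x).
  apply: EFin_inj.
  rewrite -(Beta_energy h_coef); [|exact: Xspace_plus_u0|by case: (X0fun_X0space dZ)].
  have -> : Beta p k D h (plus_u0 w) (fun x => v x - w x) =
      Beta p k D h u (fun x => v x - w x).
    have dX := (X0fun_X0space dZ).1; have sX := Xspace_plus_u0 wZ.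
    rewrite !(Beta_energy h_coef)//; congr EFin.
    apply: Rintegral_dpow_ae; try exact: Lpfun_wdiff_Xspace.
      by apply: filterS (wdiff_ae eta ust) => z ->.
    exact: aeW.
  rewrite uw; last exact: X0fun_X0space.
  rewrite (integral_pairing gL (X0fun_X0space dZ)); congr (pairing _ _)%:E.
  apply/funext => x; rewrite patchE; case: ifPn => // /negP nO.
  by have [_ -> //] := dZ; move=> Ox; apply: nO; exact: mem_set.
have := Lpint_tangent_le p1 (Lpfun_wdiff_plus_u0 we wZ) (Lpfun_wdiff_X0fun we dZ).
have -> : (fun z => wd eta (plus_u0 w) z + wd eta (fun x => v x - w x) z) = wd eta (plus_u0 v).
  apply/funext => z; rewrite -wdiffD.
  by congr (wdiff _ _ _ _ _ z); apply/funext => x; rewrite /plus_u0; ring.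
rewrite eq1 !pairing_sub// => tan.
have := tan; rewrite -(ler_pM2r (x := p^-1)) ?invr_gt0// mulrDl.
have -> : p * (pairing (g \_ Omega) v - pairing (g \_ Omega) w) / p =
  pairing (g \_ Omega) v - pairing (g \_ Omega) w by field.
exact: arith.
Qed.

Lemma minimizer_weak_solution g w : Lpfun leb q (g \_ Omega) ->
  minimizer eta (g \_ Omega) w -> weak_solution p k Omega D h u0 g (plus_u0 w).
Proof.
have arith (a b x y : R) : a <= b + (x - (x + y)) -> a <= b - y by lra.
move=> gL [wZ wm]; split.
  have -> : plus_u0 w \- u0 = w by apply/funext => x; rewrite /plus_u0/= addrC addKr.
  exact: X0fun_X0space.
move=> v vX0; have [vZ vv] := X0space_X0fun vX0; set v' := v \_ Omega in vZ vv.
have vX := vX0.1; have sX := Xspace_plus_u0 wZ.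
rewrite (Beta_energy h_coef sX vX) (integral_pairing gL vX0); congr EFin.
have sL := Lpfun_wdiff_plus_u0 we wZ; have v'L := Lpfun_wdiff_X0fun we vZ.
have vL := Lpfun_wdiff_Xspace we vX.
transitivity (\int[P]_z (dpow p (wd eta (plus_u0 w) z) * wd eta v' z)).
  by apply: Rintegral_dpow_ae => //; [exact: aeW|exact: wdiff_ae].
apply: Lpint_minimizerP => // t; rewrite -wdiff_plus_u0_lin.
have := wm _ (X0fun_lin t wZ vZ); rewrite pairing_sub ?pairing_lin//; last first.
  exact: X0fun_lin.
exact: arith.
Qed.

Lemma minimizer_state g w : Lpfun leb q (g \_ Omega) ->
  minimizer eta (g \_ Omega) w -> is_state p k Omega D h u0 g (plus_u0 w).
Proof.
move=> gL wm; split; first exact: minimizer_weak_solution.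
move=> v /(weak_solution_minimizer gL)[vm _ vst].
apply: filterS2 vst (minimizer_unique we gL vm wm) => x vx vw /vx ->.
by rewrite /plus_u0 vw.
Qed.

Lemma X0fun0 : X0fun (cst 0).
Proof.
split => //; first exact: Lpfun0.
have -> : wd (cst 1) (cst 0) = cst 0.
  apply/funext => z; have -> : cst 0 = (fun x => 0 * u0 x) :> (E -> R).
    by apply/funext => x; rewrite mul0r.
  by rewrite wdiffZ mul0r.
exact: Lpfun0.
Qed.

(** The direct method for the energy alone. It shows that there are admissible
    pairs, without which an infinite infimum could not be attained. *)
Lemma minimizer0_exists : exists w, minimizer eta (cst 0) w.
Proof.
pose V := [set energy eta (plus_u0 w) | w in X0fun].
have Vinf : has_inf V.
  split; first by exists (energy eta (plus_u0 (cst 0))), (cst 0); first exact: X0fun0.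
  by exists 0 => _ [w _ <-]; exact: Lpint_ge0.
pose a := inf V.
have aV w : X0fun w -> a <= energy eta (plus_u0 w).
  by move=> wZ; apply: ge_inf; [case: Vinf|exists w].
have /choice[w wP] n : exists w, X0fun w /\ energy eta (plus_u0 w) < a + n.+1%:R^-1.
  have n0 : 0 < n.+1%:R^-1 :> R by rewrite invr_gt0.
  by have [_ [w wZ <-] wa] := inf_adherent n0 Vinf; exists w.
have wZ n := (wP n).1.
have wM n : energy eta (plus_u0 (w n)) <= a + 1.
  apply: ltW; apply: lt_le_trans (wP n).2 _; rewrite lerD2l.
  by rewrite invf_le1// ler1n.
have [j [v [nj vZ wv _]]] := X0fun_compact we wZ wM.
exists v; split => // u uZ.
have -> : pairing (cst 0) (fun x => v x - u x) = 0.
  by rewrite /pairing; under eq_Rintegral do rewrite mul0r; rewrite Rintegral_cst// mul0r.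
rewrite addr0; apply: ler_wpM2r; first by rewrite invr_ge0 ltW.
apply: le_trans (aV _ uZ).
rewrite leNgt; apply/negP => av.
pose t := energy eta (plus_u0 v) - a.
have t0 : 0 < t by rewrite subr_gt0.
have near1 : \forall n \near \oo, a + t / 2 < energy eta (plus_u0 (w (j n))).
  apply: (energy_lsc we (fun n => wZ (j n)) vZ wv).
  by rewrite /t; lra.
have t20 : 0 < t / 2 by rewrite divr_gt0.
have [n [h1 h2]] := filter_ex (filterI near1 (near_infty_natSinv_lt (PosNum t20))).
have := (wP (j n)).2; apply/negP; rewrite -leNgt.
apply: ltW; apply: le_lt_trans h1; rewrite lerD2l; apply: ltW.
apply: le_lt_trans h2; rewrite lef_pV2 ?posrE// ler_nat ltnS.
exact: nj.
Qed.

Let q_gt1 : 1 < q.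
Proof. by rewrite ltr_pdivlMr ?subr_gt0// mul1r gtrBl. Qed.

Let conj_q : q / (q - 1) = p.
Proof.
have h1 : p - 1 != 0 by rewrite subr_eq0 gt_eqF.
have -> : q - 1 = (p - 1)^-1 by field.
by field.
Qed.

Lemma pairing_mid f g w : Lpfun leb q f -> Lpfun leb q g -> X0fun w ->
  pairing (fun x => (f x + g x) / 2) w = (pairing f w + pairing g w) / 2.
Proof.
move=> fL gL [wL _ _]; have fw := Lpfun_mul p1 fL wL; have gw := Lpfun_mul p1 gL wL.
rewrite /pairing mulrC -RintegralD// -RintegralZl//; last exact: integrableD_EFin.
by apply: eq_Rintegral => x _; field.
Qed.

Lemma pairing_subl f g w : Lpfun leb q f -> Lpfun leb q g -> X0fun w ->
  pairing (fun x => f x - g x) w = pairing f w - pairing g w.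
Proof.
move=> fL gL [wL _ _]; have fw := Lpfun_mul p1 fL wL; have gw := Lpfun_mul p1 gL wL.
by rewrite /pairing -RintegralB//; apply: eq_Rintegral => x _; ring.
Qed.

Lemma pairing_cvgl (f : nat -> E -> R) g w : (forall n, Lpfun leb q (f n)) ->
  Lpfun leb q g -> X0fun w ->
  Lpint leb q (fun x => f n x - g x) @[n --> \oo] --> 0 ->
  pairing (f n) w @[n --> \oo] --> pairing g w.
Proof.
move=> fL gL wZ fg; have [wL _ _] := wZ; apply/cvgrPdist_le => e e0.
have W0 := Lpint_ge0 leb p w.
have e10 : 0 < e / (2 * (Lpint leb p w + 1)) by rewrite divr_gt0//; lra.
have [C C0 yC] := Rintegral_mul_le leb q_gt1 e10; rewrite conj_q in yC.
have e2 : 0 < e / (2 * C) by rewrite divr_gt0// mulr_gt0.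
have near1 : \forall n \near \oo, Lpint leb q (fun x => f n x - g x) < e / (2 * C).
  exact: (cvgr_lt (0 : R) fg).
apply: filterS near1 => n fn.
rewrite -normrN opprB -pairing_subl//.
have -> : pairing (fun x => f n x - g x) w = \int[leb]_x (w x * (f n x - g x)).
  by apply: eq_Rintegral => x _; rewrite mulrC.
apply: le_trans (yC _ _ wL (LpfunB _ (fL n) gL)) _.
  by rewrite ltW// (lt_trans ltr01).
have h1 : e / (2 * (Lpint leb p w + 1)) * Lpint leb p w <= e / 2.
  rewrite mulrC mulrA ler_pdivrMr; last by lra.
  rewrite mulrC; have -> : e / 2 * (2 * (Lpint leb p w + 1)) = e * (Lpint leb p w + 1).
    by field.
  by rewrite ler_pM2l// lerDl.
have h2 : C * Lpint leb q (fun x => f n x - g x) <= e / 2.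
  apply: (@le_trans _ _ (C * (e / (2 * C)))); first by rewrite ler_pM2l// ltW.
  by rewrite le_eqVlt; apply/orP; left; apply/eqP; field; rewrite gt_eqF.
by apply: le_trans (lerD h1 h2) _; rewrite -splitr.
Qed.

(** Strong convergence of the states makes up for controls that are only
    bounded. *)
Lemma pairing_cvgr (f : nat -> E -> R) (w : nat -> E -> R) v (M e : R) : 0 < e ->
  (forall n, Lpfun leb q (f n)) -> (forall n, Lpint leb q (f n) <= M) ->
  (forall n, X0fun (w n)) -> X0fun v ->
  Lpint leb p (fun x => w n x - v x) @[n --> \oo] --> 0 ->
  \forall n \near \oo, pairing (f n) (fun x => w n x - v x) <= e.
Proof.
move=> e0 fL fM wZ vZ wv.
have M0 : 0 <= M by apply: le_trans (fM 0%N); exact: Lpint_ge0.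
have e10 : 0 < e / (2 * (M + 1)) by rewrite divr_gt0//; lra.
have [C C0 yC] := Rintegral_mul_le leb p1 e10.
have e2 : 0 < e / (2 * C) by rewrite divr_gt0// mulr_gt0.
have near1 : \forall n \near \oo, Lpint leb p (fun x => w n x - v x) < e / (2 * C).
  exact: (cvgr_lt (0 : R) wv).
apply: filterS near1 => n wn.
have [dL _ _] := X0fun_sub (wZ n) vZ.
apply: le_trans (ler_norm _) _; apply: le_trans (yC _ _ (fL n) dL) _.
have h1 : e / (2 * (M + 1)) * Lpint leb q (f n) <= e / 2.
  apply: (@le_trans _ _ (e / (2 * (M + 1)) * (M + 1))).
    by rewrite ler_pM2l// (le_trans (fM n))// lerDl.
  by rewrite le_eqVlt; apply/orP; left; apply/eqP; field; rewrite gt_eqF//; lra.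
have h2 : C * Lpint leb p (fun x => w n x - v x) <= e / 2.
  apply: (@le_trans _ _ (C * (e / (2 * C)))); first by rewrite ler_pM2l// ltW.
  by rewrite le_eqVlt; apply/orP; left; apply/eqP; field; rewrite gt_eqF.
by apply: le_trans (lerD h1 h2) _; rewrite -splitr.
Qed.

Variables (h0 : E -> R) (G : E -> R -> R) (beta gamma L : R).
Hypothesis h0_coef : coefficients Omega D hmin hmax h0.
Hypotheses (beta_gt0 : 0 < beta) (gamma_gt0 : 0 < gamma) (L_gt0 : 0 < L).
Hypothesis G_measurable : measurable_fun (Omega `*` [set: R])
  (fun xa : E * R => G xa.1 xa.2).
Hypothesis G_ge0 : forall x a, Omega x -> 0 <= G x a.
Hypothesis G_lipschitz :
  forall x a b, Omega x -> `|G x a - G x b| <= L * `|a - b|.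
Let eta0 := clamp Omega hmin hmax h0.
Let we0 : weight eta0 := (clamp_weight h0_coef).1.

Definition integral_G v : \bar R := (\int[leb]_(x in Omega) (G x (v x))%:E)%E.

Lemma measurable_G v : measurable_fun D v ->
  measurable_fun Omega (fun x => G x (v x)).
Proof.
move=> mv.
have mvD : measurable_fun setT (v \_ D).
  by apply/(measurable_restrict _ mD measurableT); rewrite setTI.
apply: (@eq_measurable_fun _ _ _ _ _ (fun x => G x ((v \_ D) x))).
  by move=> x /set_mem Ox; rewrite patchE mem_set//; exact: OD.
apply: (@measurable_comp _ _ _ _ _ _ (Omega `*` [set: R])
  (fun xa : E * R => G xa.1 xa.2) Omega (fun x => (x, (v \_ D) x))) => //.
- exact: measurableX.
- by move=> _ [x Ox <-].
- apply: (@measurable_funTS _ _ _ _ Omega).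
  by apply: measurable_fun_pair => //; exact: measurable_id.
Qed.

Lemma costE f v : Lpfun leb q (f \_ Omega) -> Xspace p k D v ->
  cost p k Omega D h0 G beta gamma f v =
  (integral_G v + (beta * Lpint leb q (f \_ Omega) + gamma * energy eta0 v)%:E)%E.
Proof.
move=> fL vX; rewrite /cost (Beta_diag h0_coef vX) -EFinM [in RHS]EFinD addeA.
congr (_ + _)%E; have [mf fi] := fL.
have mfO : measurable_fun Omega f.
  by move: mf => /(measurable_restrict _ mO measurableT); rewrite setTI.
have mfp : measurable_fun Omega (fun x => (`|f x| `^ q)%:E).
  apply/measurable_EFinP; apply: (measurableT_comp (measurable_powR q)).
  exact: measurableT_comp.
under eq_integral do rewrite EFinD EFinM.
have fE : (\int[leb]_(x in Omega) (`|f x| `^ q)%:E = (Lpint leb q (f \_ Omega))%:E)%E.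
  rewrite EFin_Lpint// [in LHS]integral_mkcond.
  apply: eq_integral => x _; rewrite !patchE; case: ifP => // _.
  by rewrite normr0 powR0// gt_eqF// (lt_trans ltr01).
rewrite ge0_integralD//.
- congr (_ + _)%E; rewrite ge0_integralZl_EFin//; last exact: ltW.
  by rewrite fE EFinM.
- by move=> x Ox; rewrite lee_fin G_ge0.
- apply/measurable_EFinP; apply: measurable_G; exact: Xspace_measurable vX.
- by move=> x _; rewrite mule_ge0// lee_fin ?powR_ge0// ltW.
- exact: measurable_funeM.
Qed.

Lemma integral_G_ae u v : Xspace p k D u -> Xspace p k D v ->
  {ae leb, forall x, D x -> u x = v x} -> integral_G u = integral_G v.
Proof.
move=> uX vX uv; apply: ae_eq_integral => //.
- by apply/measurable_EFinP; apply: measurable_G; exact: Xspace_measurable.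
- by apply/measurable_EFinP; apply: measurable_G; exact: Xspace_measurable.
- by apply: filterS uv => x uvx Ox; rewrite uvx//; exact: OD.
Qed.

(** [G x] is continuous, so Fatou's lemma applies. The integral of the limit may
    be infinite: this will be excluded by the bound on the costs. *)
Lemma integral_G_lsc (w : nat -> E -> R) v (r : R) : (forall n, X0fun (w n)) -> X0fun v ->
  {ae leb, forall x, w n x @[n --> \oo] --> v x} ->
  (r%:E < integral_G (plus_u0 v))%E ->
  \forall n \near \oo, (r%:E < integral_G (plus_u0 (w n)))%E.
Proof.
move=> wZ vZ wv.
have GE u : integral_G u = (\int[leb]_x (((fun y => G y (u y)) \_ Omega) x)%:E)%E.
  rewrite /integral_G integral_mkcond; apply: eq_integral => x _.
  by rewrite !patchE; case: ifP.
have mG u : X0fun u -> measurable_fun setT ((fun y => G y (plus_u0 u y)) \_ Omega).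
  move=> uZ; apply/measurable_restrict => //; rewrite setTI.
  by apply: measurable_G; exact: measurable_plus_u0.
rewrite GE => rv; under eq_near do rewrite GE.
apply: fatou_ae_near rv => //.
- by move=> n; exact: mG.
- exact: mG.
- by move=> n x; rewrite patchE; case: ifPn => // /set_mem; exact: G_ge0.
- apply: filterS wv => x wx; rewrite patchE; under eq_fun do rewrite patchE.
  case: ifPn => [/set_mem Ox|_]; last exact: cvg_cst.
  apply: (@continuous_cvg _ _ _ _ _ _ (G x)); last first.
    by apply: cvgD => //; exact: cvg_cst.
  rewrite /continuous_at; apply/cvgrPdist_lt => e e0.
  have eL : 0 < e / L by rewrite divr_gt0.
  exists (e / L) => //= b ab.
  apply: le_lt_trans (G_lipschitz _ _ Ox) _.
  by rewrite mulrC -ltr_pdivlMr.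
Qed.

Lemma integral_G_ge0 v : (0 <= integral_G v)%E.
Proof. by apply: integral_ge0 => x Ox; rewrite lee_fin G_ge0. Qed.

(** The sets [C n] are convex in the control because the limit state [v] is
    already fixed in them; strong convergence of the states and semicontinuity of
    the energies put late controls of the sequence into [C n]. Their strong limit
    point satisfies the conditions of all [C n]. *)
Lemma cost_limit (f w : nat -> E -> R) (i : R) :
  (forall n, Lpfun leb q (f n)) -> (forall n, minimizer eta (f n) (w n)) ->
  (forall n, (integral_G (plus_u0 (w n)) +
    (beta * Lpint leb q (f n) + gamma * energy eta0 (plus_u0 (w n)))%:E <=
    (i + n.+1%:R^-1)%:E)%E) ->
  exists g v, [/\ Lpfun leb q g, minimizer eta g v &
    (integral_G (plus_u0 v) + (beta * Lpint leb q g + gamma * energy eta0 (plus_u0 v))%:E <=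
     i%:E)%E].
Proof.
(* linear arithmetic, kept apart from the integrals to which it applies *)
have ar1 (x y z c t : R) : 0 <= x -> 0 <= y -> 0 <= z -> t <= 1 ->
    x + (y + z) <= c + t -> [/\ x <= c + 1, y <= c + 1 & z <= c + 1].
  by move=> *; split; lra.
have ar2 (x y z x' z' c t r : R) : x' - t / 4 < x -> z' - t / 4 < z -> r < t / 4 ->
  x + (y + z) <= c + r -> 0 < t -> y + x' + z' <= c + t by lra.
have ar3 (x x' y d d' d'' t : R) : x' - t / 2 < x -> x <= y + (d - d') ->
  d - d'' <= t / 2 -> x' <= y + (d'' - d') + t by lra.
have ar4 (x y z a b : R) : x + a + b <= z -> y + a + b <= z ->
  (x + y) / 2 + a + b <= z by lra.
have ar5 (x y d d' t : R) : x <= y + d + t -> x <= y + d' + t ->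
  x <= y + (d + d') / 2 + t by lra.
have ar6 (x y d d' t e : R) : x <= y + d + t -> d < d' + e / 2 -> t < e / 2 ->
  x <= y + d' + e by lra.
have ar10 (x y t : R) : x - t / 2 * p < y -> x / p - t / 2 < y / p.
  by move=> xy; rewrite ltr_pdivlMr// mulrBl divfK ?gt_eqF.
move=> fL fm fC.
have wZ n : X0fun (w n) := (fm n).1.
have inv1 n : n.+1%:R^-1 <= 1 :> R by rewrite invf_le1// ler1n.
have GE n : exists2 x : R, integral_G (plus_u0 (w n)) = x%:E & 0 <= x /\
    x + (beta * Lpint leb q (f n) + gamma * energy eta0 (plus_u0 (w n))) <= i + n.+1%:R^-1.
  move: (fC n) (integral_G_ge0 (plus_u0 (w n))); case: (integral_G _) => [x|//|//].
  by rewrite lee_fin => xC x0; exists x.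
have bounds n : [/\ (integral_G (plus_u0 (w n)) <= (i + 1)%:E)%E,
    beta * Lpint leb q (f n) <= i + 1 & gamma * energy eta0 (plus_u0 (w n)) <= i + 1].
  have [x -> [x0 xC]] := GE n.
  have [? ? ?] := ar1 _ _ _ _ _ x0 (mulr_ge0 (ltW beta_gt0) (Lpint_ge0 leb q (f n)))
    (mulr_ge0 (ltW gamma_gt0) (Lpint_ge0 P p (wd eta0 (plus_u0 (w n))))) (inv1 n) xC.
  by split; rewrite ?lee_fin.
have wM n : energy eta0 (plus_u0 (w n)) <= (i + 1) / gamma.
  by rewrite ler_pdivlMr// mulrC; have [] := bounds n.
have [j [v [nj vZ wv wv0]]] := X0fun_compact we0 wZ wM.
have jZ n := wZ (j n).
(* bounded costs exclude that the limit state has an infinite cost *)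
have [a aE] : exists a : R, integral_G (plus_u0 v) = a%:E.
  move: (integral_G_ge0 (plus_u0 v)); case E : (integral_G (plus_u0 v)) => [a| |] // _.
    by exists a.
  have /(integral_G_lsc jZ vZ wv) : ((i + 1)%:E < integral_G (plus_u0 v))%E by rewrite E ltry.
  by move=> /filter_ex[n]; rewrite ltNge; have [-> _ _] := bounds (j n).
pose b := gamma * energy eta0 (plus_u0 v).
pose C n := [set g | [/\ Lpfun leb q g,
  beta * Lpint leb q g + a + b <= i + n.+1%:R^-1 &
  forall u, X0fun u -> energy eta (plus_u0 v) / p <=
    energy eta (plus_u0 u) / p + pairing g (fun x => v x - u x) + n.+1%:R^-1]].
have Cdec m n : (m <= n)%N -> C n `<=` C m.
  move=> mn g [gL gC gm].
  have nm : n.+1%:R^-1 <= m.+1%:R^-1 :> R by rewrite lef_pV2 ?posrE// ler_nat.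
  split=> //; first by apply: le_trans gC _; rewrite lerD2l.
  by move=> u /gm h1; apply: le_trans h1 _; rewrite lerD2l.
have C0 n : C n !=set0.
  pose t : R := n.+1%:R^-1; have t0 : 0 < t by rewrite invr_gt0.
  have t20 : 0 < t / 2 by rewrite divr_gt0.
  have t40 : 0 < t / 4 by rewrite divr_gt0.
  have N1 : \forall m \near \oo, ((a - t / 4)%:E < integral_G (plus_u0 (w (j m))))%E.
    by apply: (integral_G_lsc jZ vZ wv); rewrite aE lte_fin ltrBlDr ltrDl.
  have N2 : \forall m \near \oo,
      energy eta0 (plus_u0 v) - t / 4 / gamma < energy eta0 (plus_u0 (w (j m))).
    by apply: (energy_lsc we0 jZ vZ wv); rewrite ltrBlDr ltrDl divr_gt0.
  have N3 : \forall m \near \oo,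
      energy eta (plus_u0 v) - t / 2 * p < energy eta (plus_u0 (w (j m))).
    by apply: (energy_lsc we jZ vZ wv); rewrite ltrBlDr ltrDl mulr_gt0.
  have fM m : Lpint leb q (f (j m)) <= (i + 1) / beta.
    by rewrite ler_pdivlMr// mulrC; have [] := bounds (j m).
  have N4 := pairing_cvgr t20 (fun m => fL (j m)) fM jZ vZ wv0.
  have [m [[m1 m2] [[m3 m4] m5]]] := filter_ex (filterI (filterI N1 N2)
    (filterI (filterI N3 N4) (near_infty_natSinv_lt (PosNum t40)))).
  exists (f (j m)); split=> //.
    have [x xE [_ xC]] := GE (j m); rewrite xE lte_fin in m1.
    apply: ar2 m1 _ _ xC t0.
      by rewrite -(ltr_pM2l gamma_gt0) mulrBr mulrCA divff ?mulr1 ?gt_eqF// in m2.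
    apply: le_lt_trans m5; rewrite lef_pV2 ?posrE// ler_nat ltnS; exact: nj.
  move=> u uZ; rewrite pairing_sub//; rewrite pairing_sub// in m4.
  have h1 := (fm (j m)).2 _ uZ; rewrite pairing_sub// in h1.
  apply: ar3 _ h1 m4.
  exact: ar10.
have CM n g : C n g -> Lpfun leb q g /\ Lpint leb q g <= (i + 1 - a - b) / beta.
  move=> [gL gC _]; split => //; rewrite ler_pdivlMr// mulrC !lerBrDr.
  by rewrite [leLHS]addrAC; apply: le_trans gC _; rewrite lerD2l.
have Cmid n g1 g2 : C n g1 -> C n g2 -> C n (fun x => (g1 x + g2 x) / 2).
  move=> [g1L g1C g1m] [g2L g2C g2m].
  have [mL mC] := Lpint_midpoint q_gt1 g1L g2L; split; first exact: mL.
    apply: le_trans (ar4 _ _ _ _ _ g1C g2C); rewrite !lerD2r.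
    by rewrite -mulrDr -mulrA ler_pM2l.
  by move=> u uZ; rewrite pairing_mid//; [apply: ar5; [exact: g1m|exact: g2m]|exact: X0fun_sub].
have [g [gl [gC glL gae gcvg]]] := Lp_midconvex_limit q_gt1 Cdec C0 CM Cmid.
have gL n : Lpfun leb q (g n) by case: (gC n).
exists gl, v; split; [exact: glL| |].
  split=> [//|u uZ]; apply/ler_addgt0Pr => e e0.
  have e20 : 0 < e / 2 by rewrite divr_gt0.
  have dZ := X0fun_sub vZ uZ.
  have pc := pairing_cvgl gL glL dZ gcvg.
  have N1 : \forall n \near \oo, pairing (g n) (fun x => v x - u x) <
      pairing gl (fun x => v x - u x) + e / 2.
    by apply: (cvgr_lt _ pc); rewrite ltrDl.
  have [n [n1 n2]] := filter_ex (filterI N1 (near_infty_natSinv_lt (PosNum e20))).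
  have [_ _ /(_ _ uZ) h1] := gC n.
  exact: ar6 h1 n1 n2.
have ar7 (x : R) : x + a + b <= i -> a + (x + b) <= i by lra.
rewrite aE -EFinD lee_fin; apply: ar7; apply/ler_addgt0Pr => e e0.
have ar8 (x t : R) : x + a + b <= i + t -> t < e -> x <= i + e - a - b by lra.
have ar9 (x : R) : x <= i + e - a - b -> x + a + b <= i + e by lra.
apply: ar9; rewrite mulrC -ler_pdivlMr// -lee_fin EFin_Lpint//.
apply: (@fatou_ae _ _ _ _ (fun n x => `|g n x| `^ q)).
- by move=> n; apply: measurable_powR_normr; case: (gL n).
- by apply: measurable_powR_normr; case: glL.
- by move=> n x; exact: powR_ge0.
- apply: filterS gae => x gx.
  apply: (@continuous_cvg _ _ _ _ _ _ (fun y : R => `|y| `^ q)) => //.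
  by apply: continuous_powR_normr; exact: lt_trans ltr01 q_gt1.
- apply: filterS (near_infty_natSinv_lt (PosNum e0)) => n ne.
  rewrite -EFin_Lpint// lee_fin ler_pdivlMr// mulrC.
  by have [_ h1 _] := gC n; exact: ar8 h1 ne.
Qed.

Lemma admissible_minimizer (f v : E -> R) : admissible p k Omega D h u0 f v ->
  [/\ Lpfun leb q (f \_ Omega), minimizer eta (f \_ Omega) ((v \- u0) \_ Omega) &
  cost p k Omega D h0 G beta gamma f v =
  (integral_G (plus_u0 ((v \- u0)%R \_ Omega)) + (beta * Lpint leb q (f \_ Omega) +
    gamma * energy eta0 (plus_u0 ((v \- u0)%R \_ Omega)))%:E)%E].
Proof.
have q0 : 0 < q := lt_trans ltr01 q_gt1.
move=> [/(Lfun_Lpfun _ _ q0) fL vX [fv _]].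
have [vm _ vE] := weak_solution_minimizer fL fv; have sX := Xspace_plus_u0 vm.1.
have GE := integral_G_ae vX sX vE; have eE := energy_ae we0 vX sX vE.
by split; [exact: fL|exact: vm|rewrite (costE fL vX) GE eE].
Qed.

Lemma minimizer_admissible g w : Lpfun leb q (g \_ Omega) ->
  minimizer eta (g \_ Omega) w -> admissible p k Omega D h u0 g (plus_u0 w).
Proof.
have q0 : 0 < q := lt_trans ltr01 q_gt1.
move=> gL wm; split; first by apply/(Lfun_Lpfun _ _ q0).
  exact: Xspace_plus_u0 wm.1.
exact: minimizer_state.
Qed.

(** States vanish outside [Omega], so only the values of a control in [Omega]
    matter; a limit of controls is a function on the whole space. *)
Lemma minimizer_restrict g w : Lpfun leb q g -> minimizer eta g w ->
  [/\ Lpfun leb q (g \_ Omega), Lpint leb q (g \_ Omega) <= Lpint leb q g &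
  minimizer eta (g \_ Omega) w].
Proof.
have q0 : 0 < q := lt_trans ltr01 q_gt1.
move=> gL [wZ wm]; have [mg gi] := gL.
have gO x : `|(g \_ Omega) x| `^ q <= `|g x| `^ q.
  by rewrite patchE; case: ifP => // _; rewrite normr0 powR0 ?gt_eqF// powR_ge0.
have gOL : Lpfun leb q (g \_ Omega).
  apply: Lpfun_le gi gO.
  apply/(measurable_restrict _ mO measurableT); rewrite setTI.
  exact: measurable_funS mg.
split=> //.
  rewrite -lee_fin !EFin_Lpint//; apply: ge0_le_integral => //.
  - by apply/measurable_EFinP; apply: measurable_powR_normr; case: gOL.
  - by apply/measurable_EFinP; exact: measurable_powR_normr.
  - by move=> x _; rewrite lee_fin.
split=> // v vZ; apply: le_trans (wm _ vZ) _; rewrite lerD2l.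
rewrite le_eqVlt; apply/orP; left; apply/eqP; apply: eq_Rintegral => x _.
rewrite patchE; case: ifPn => // /negP nO.
have [_ d0 _] := X0fun_sub wZ vZ.
by rewrite d0 ?mulr0// => Ox; apply: nO; exact: mem_set.
Qed.

Lemma optimal_pair_exists : exists g u : E -> R,
  admissible p k Omega D h u0 g u /\
  forall f v : E -> R, admissible p k Omega D h u0 f v ->
    (cost p k Omega D h0 G beta gamma g u <=
     cost p k Omega D h0 G beta gamma f v)%E.
Proof.
pose A := [set c | exists f v, admissible p k Omega D h u0 f v /\
  c = cost p k Omega D h0 G beta gamma f v].
have costA f v : admissible p k Omega D h u0 f v ->
    (ereal_inf A <= cost p k Omega D h0 G beta gamma f v)%E.
  by move=> fv; apply: ereal_inf_lbound; exists f, v.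
have A0 : (0 <= ereal_inf A)%E.
  apply: le_ereal_inf_tmp => _ [f [v [/admissible_minimizer[_ _ ->] ->]]].
  by rewrite adde_ge0 ?integral_G_ge0// lee_fin addr_ge0// mulr_ge0 ?Lpint_ge0// ltW.
have q0 : 0 < q := lt_trans ltr01 q_gt1.
move: A0; case iE : (ereal_inf A) => [i| |] // A0; last first.
  have [w wm] := minimizer0_exists.
  have [zL _ zm] := minimizer_restrict (Lpfun0 leb (lt0r_neq0 q0)) wm.
  exists (cst 0), (plus_u0 w); split; first exact: minimizer_admissible.
  by move=> f v /costA; rewrite iE leye_eq => /eqP ->; exact: leey.
have /choice[fw fwP] n : exists fw : (E -> R) * (E -> R),
    [/\ Lpfun leb q fw.1, minimizer eta fw.1 fw.2 &
    (integral_G (plus_u0 fw.2) +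
      (beta * Lpint leb q fw.1 + gamma * energy eta0 (plus_u0 fw.2))%:E
      <= (i + n.+1%:R^-1)%:E)%E].
  have n0 : 0 < n.+1%:R^-1 :> R by rewrite invr_gt0.
  have iA : ereal_inf A \is a fin_num by rewrite iE.
  have [_ [f [v [/admissible_minimizer[fL fm fc] ->]]]] := lb_ereal_inf_adherent n0 iA.
  rewrite fc iE -EFinD => /ltW fi.
  by exists (f \_ Omega, (v \- u0) \_ Omega).
have fL n : Lpfun leb q (fw n).1 by case: (fwP n).
have fm n : minimizer eta (fw n).1 (fw n).2 by case: (fwP n).
have fc n : (integral_G (plus_u0 (fw n).2) +
  (beta * Lpint leb q (fw n).1 + gamma * energy eta0 (plus_u0 (fw n).2))%:E
      <= (i + n.+1%:R^-1)%:E)%E by case: (fwP n).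
have [g [w [gL wm gi]]] := cost_limit fL fm fc.
have [gOL gO gm] := minimizer_restrict gL wm.
exists g, (plus_u0 w); split; first exact: minimizer_admissible.
move=> f v /costA; rewrite iE; apply: le_trans; apply: le_trans gi.
rewrite (costE gOL (Xspace_plus_u0 wm.1)).
by apply: leeD => //; rewrite lee_fin lerD2r ler_pM2l.
Qed.

End nonlocal_space.

Theorem theorem3 (R : realType) (N : nat) (Omega : set 'rV[R]_N)
  (delta p s : R) (k : R -> R) (e : 'rV[R]_N) (c0 : R) (hmin hmax : R)
  (h h0 u0 : 'rV[R]_N -> R) (G : 'rV[R]_N -> R -> R) (beta gamma L : R)
  (D := delta_nbhd Omega delta)
  (Omega_nonempty : Omega !=set0)
  (Omega_open : open Omega)
  (Omega_connected : connected Omega)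
  (Omega_bounded : bounded_set Omega)
  (delta_gt0 : 0 < delta)
  (p_gt1 : 1 < p)
  (s_gt0 : 0 < s) (s_lt1 : s < 1)
  (N_gt_ps : p * s < N%:R)
  (k_measurable : measurable_fun setT (fun z : 'rV[R]_N => k (enorm z)))
  (k_ge0 : forall r, 0 <= r -> 0 <= k r)
  (k_supp : [set z : 'rV[R]_N | k (enorm z) != 0] `<=`
            [set z : 'rV[R]_N | enorm z <= delta])
  (e_unit : enorm e = 1)
  (k_normalized : (((CN p e)^-1)%:E *
     \int[lebesgue_rV N]_(z in eball 0 delta) (k (enorm z))%:E = 1)%E)
  (c0_gt0 : 0 < c0)
  (k_lower : forall r, 0 < r < delta -> c0 / r `^ (N%:R + (s - 1) * p) <= k r)
  (hmin_gt0 : 0 < hmin) (hmin_lt_hmax : hmin < hmax)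
  (h_coef : coefficients Omega D hmin hmax h)
  (u0_X : Xspace p k D u0)
  (beta_gt0 : 0 < beta) (gamma_gt0 : 0 < gamma)
  (h0_coef : coefficients Omega D hmin hmax h0)
  (G_measurable : measurable_fun (Omega `*` [set: R])
     (fun xa : 'rV[R]_N * R => G xa.1 xa.2))
  (G_ge0 : forall x a, Omega x -> 0 <= G x a)
  (L_gt0 : 0 < L)
  (G_lipschitz : forall x a b, Omega x -> `|G x a - G x b| <= L * `|a - b|) :
  exists g u : 'rV[R]_N -> R,
    admissible p k Omega D h u0 g u /\
    forall f v : 'rV[R]_N -> R, admissible p k Omega D h u0 f v ->
      (cost p k Omega D h0 G beta gamma g u <=
       cost p k Omega D h0 G beta gamma f v)%E.
Proof.
have [_ u0_energy] := proj1 (XspaceP delta Omega_open p_gt1 k_measurable k_ge0 u0) u0_X.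
have u0_measurable := Xspace_measurable Omega_open p_gt1 k_measurable k_ge0 u0_X.
exact: (optimal_pair_exists Omega_open Omega_bounded delta_gt0 p_gt1 s_gt0 N_gt_ps
  k_measurable k_ge0 c0_gt0 k_lower hmin_gt0 hmin_lt_hmax u0_measurable u0_energy
  h_coef u0_X h0_coef beta_gt0 gamma_gt0 L_gt0 G_measurable G_ge0 G_lipschitz).
Qed.
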